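(* Let $\sum_{j=0}^\infty|a(j)|<\infty$ and $\sum_{j=0}^\infty(j+1)|a(j)|^2<\infty$, and let $D$ be a class of spectral densities. A spectral density $f^0\in D$ is least favourable in $D$ for the optimal linear extrapolation of $A\xi=\sum_{j=0}^\infty a(j)\xi(j)$ (from observations of $\xi(j)$, $j=-1,-2,\dots$) if it admits the canonical factorization $$f^0(\lambda)=\left|\sum_{k=0}^\infty d^0(k)e^{-ik\lambda}\right|^2,$$ where $d^0=\{d^0(k):k=0,1,\dots\}$ is a solution to the constrained optimization problem $$\|Ad\|^2\to\max,\qquad f(\lambda)=\left|\sum_{k=0}^\infty d(k)e^{-ik\lambda}\right|^2\in D .$$ In this case the sequence $\xi(j)$ (with spectral density $f^0$) admits the canonical one-sided moving average representation $\xi(j)=\sum_{u=-\infty}^j d^0(j-u)\varepsilon(u)$.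
   Context: Here $\|Ad\|^2=\sum_{k=0}^\infty|(Ad)_k|^2$ with $(Ad)_k=\sum_{l=0}^\infty a(k+l)d(l)$, and $d$ ranges over square-summable complex sequences. $\xi$ is a zero mean wide sense stationary sequence with spectral density $f$, i.e. $E\xi(j+k)\overline{\xi(j)}=\frac1{2\pi}\int_{-\pi}^\pi e^{ik\lambda}f(\lambda)d\lambda$; densities are assumed regular: $\int_{-\pi}^\pi\ln f(\lambda)d\lambda>-\infty$. A factorization $f=|\sum_{k\ge0} d(k)e^{-ik\lambda}|^2$ is canonical when it corresponds to a representation $\xi(j)=\sum_{u\le j}d(j-u)\varepsilon(u)$ with $\varepsilon$ white noise ($E\varepsilon(i)\overline{\varepsilon(j)}=\delta_{ij}$) such that, for every $n$, the closed linear spans of $\{\xi(k):k\le n\}$ and $\{\varepsilon(k):k\le n\}$ coincide. $L_2^-(f)$ is the closed subspace of $L_2(f)$ generated by $e^{in\lambda}$, $n\le-1$; $\Delta(h,f)=\frac1{2\pi}\int_{-\pi}^\pi|A(e^{i\lambda})-h(e^{i\lambda})|^2f(\lambda)d\lambda$ with $A(e^{i\lambda})=\sum_{j\ge0}a(j)e^{ij\lambda}$; $h(f)$ is the minimizer of $\Delta(\cdot,f)$ over $L_2^-(f)$. $f^0\in D$ is least favourable in $D$ if $\Delta(h(f^0),f^0)=\max_{f\in D}\Delta(h(f),f)=\max_{f\in D}\min_{h\in L_2^-(f)}\Delta(h,f)$. *)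

(* Defs.v *)
From HB Require Import structures.
From mathcomp Require Import all_boot all_order all_algebra.
From mathcomp Require Import all_classical all_reals all_analysis.
From mathcomp Require Export complex.
Set Implicit Arguments.
Unset Strict Implicit.
Unset Printing Implicit Defensive.
Import Order.TTheory GRing.Theory Num.Theory.
Import numFieldNormedType.Exports.
Local Open Scope classical_set_scope.
Local Open Scope ring_scope.

Definition sqmod (R : realType) (z : R[i]) : R := Normc.normc z ^+ 2.

(* Sum of a complex series, as the limit of its partial sums; only meaningful
   when both the real and the imaginary parts converge. *)
Definition csum (R : realType) (u : nat -> R[i]) : R[i] :=
  (limn (series (fun k => complex.Re (u k))) +i*
   limn (series (fun k => complex.Im (u k))))%C.

Definition square_summable (R : realType) (d : nat -> R[i]) : Prop :=
  (\sum_(0 <= k <oo) (sqmod (d k))%:E < +oo)%E.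

Section ComplexL2.
Context (R : realType) (disp : measure_display) (T : measurableType disp).
Variables (mu : {measure set T -> \bar R}) (D : set T) (w : T -> R).
Implicit Types g p : T -> R[i].

Definition cmeasurable g : Prop :=
  measurable_fun D (fun t => complex.Re (g t)) /\
  measurable_fun D (fun t => complex.Im (g t)).

Definition cintegral g : R[i] :=
  ((\int[mu]_(t in D) complex.Re (g t))%R +i*
   (\int[mu]_(t in D) complex.Im (g t))%R)%C.

(* L2 is the space L2(D, w mu); its elements are functions, not classes modulo
   almost everywhere equality, so that sqnorm is the square of a seminorm. *)
Definition sqnorm g : \bar R := (\int[mu]_(t in D) (sqmod (g t) * w t)%:E)%E.

Definition L2 : set (T -> R[i]) :=
  [set g | cmeasurable g /\ (sqnorm g < +oo)%E].

Definition lin_span (K : set int) (e : int -> T -> R[i]) : set (T -> R[i]) :=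
  [set p | exists (s : seq int) (c : int -> R[i]),
    (forall k, k \in s -> K k) /\ p = (fun t => \sum_(k <- s) c k * e k t)].

Definition closed_span (K : set int) (e : int -> T -> R[i]) :
    set (T -> R[i]) :=
  [set g | L2 g /\ forall eps : R, 0 < eps ->
    exists p, lin_span K e p /\ (sqnorm (fun t => g t - p t)%R < eps%:E)%E].

Definition L2_sum (u : nat -> T -> R[i]) g : Prop :=
  L2 g /\
  sqnorm (fun t => g t - \sum_(k < n) u k t)%R @[n --> \oo] --> 0%E.

End ComplexL2.

Section Spectral.
Context (R : realType).
Implicit Types (f : R -> R) (h phi : R -> R[i]) (a d : nat -> R[i]).

Definition leb : {measure set (measurableTypeR R) -> \bar R} :=
  @lebesgue_measure R.

Definition circle : set (measurableTypeR R) := [set` `[- pi, pi]].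

(* e^{i k lambda}; functions on the unit circle are functions of lambda *)
Definition expi (k : int) : measurableTypeR R -> R[i] :=
  fun lambda : R => (cos (k%:~R * lambda) +i* sin (k%:~R * lambda))%C.

Definition weight f : measurableTypeR R -> R :=
  fun lambda => f lambda / (2 * pi).

Definition spectral_density f : Prop :=
  (forall lambda, lambda \in `[- pi, pi] -> 0 <= f lambda) /\
  leb.-integrable circle (fun lambda => (f lambda)%:E).

(* lne 0 = -oo, whereas ln 0 = 0.  The integral is well defined in [-oo, +oo[
   since ln f <= f and f is integrable. *)
Definition regular f : Prop :=
  (-oo < \int[leb]_(lambda in circle) lne (f lambda)%:E)%E.

(* f(lambda) = |sum_(k >= 0) d(k) e^{-ik lambda}|^2 almost everywhere, where the
   sum converges in L2([-pi, pi]). *)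
Definition factorization f d : Prop :=
  square_summable d /\
  exists phi : measurableTypeR R -> R[i],
    L2_sum leb circle (cst 1)
      (fun k lambda => d k * expi (- k%:Z) lambda) phi /\
    {ae leb, forall lambda, circle lambda -> f lambda = sqmod (phi lambda)}.

Definition L2minus f : set (measurableTypeR R -> R[i]) :=
  closed_span leb circle (weight f) [set n : int | n <= -1] expi.

Definition Afun a : measurableTypeR R -> R[i] :=
  fun lambda => csum (fun j => a j * expi j%:Z lambda).

Definition Delta a h f : \bar R :=
  sqnorm leb circle (weight f) (fun lambda => Afun a lambda - h lambda).

(* h is (a version of) the spectral characteristic h(f). *)
Definition is_minimizer a f h : Prop :=
  L2minus f h /\ forall h', L2minus f h' -> (Delta a h f <= Delta a h' f)%E.

(* Delta(h(f0), f0) = max_(f in D) Delta(h(f), f), including the existence of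
   the minimizers h(f), f in D. *)
Definition least_favourable a (D : set (R -> R)) f0 : Prop :=
  D f0 /\
  exists h0, is_minimizer a f0 h0 /\
    forall f, D f ->
      exists h, is_minimizer a f h /\ (Delta a h f <= Delta a h0 f0)%E.

(* ||A d||^2, where (A d)_k = sum_(l >= 0) a(k + l) d(l) *)
Definition normAd2 a d : \bar R :=
  (\sum_(0 <= k <oo) (sqmod (csum (fun l => (a (k + l)%N * d l)%R)))%:E)%E.

Definition admissible (D : set (R -> R)) d : Prop :=
  exists f, D f /\ factorization f d.

Definition solves_max_problem a (D : set (R -> R)) d0 : Prop :=
  admissible D d0 /\
  forall d, admissible D d -> (normAd2 a d <= normAd2 a d0)%E.

End Spectral.

Section Sequences.
Context (R : realType) (disp : measure_display) (T : measurableType disp).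
Variable P : probability T R.
Implicit Types (xi eps : int -> T -> R[i]).

Definition L2P : set (T -> R[i]) := L2 P setT (cst 1).

Definition past xi (n : int) : set (T -> R[i]) :=
  closed_span P setT (cst 1) [set k : int | k <= n] xi.

Definition cexpect (X : T -> R[i]) : R[i] := cintegral P setT X.

Definition stationary_with (f : R -> R) xi : Prop :=
  [/\ forall j, L2P (xi j),
      forall j, cexpect (xi j) = 0 &
      forall j k, cexpect (fun t => xi (j + k) t * (xi j t)^*%C) =
        ((2 * pi)^-1)%:C%C *
        cintegral (@leb R) (@circle R)
          (fun lambda => expi k lambda * (f lambda)%:C%C)].

Definition white_noise eps : Prop :=
  (forall j, L2P (eps j)) /\
  forall i j, cexpect (fun t => eps i t * (eps j t)^*%C) = (i == j)%:R.

(* Canonical one-sided moving average representation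
   xi(j) = sum_(u <= j) d(j - u) eps(u) (mean square convergence; k = j - u). *)
Definition canonical_representation xi eps (d : nat -> R[i]) : Prop :=
  [/\ white_noise eps,
      forall j, L2_sum P setT (cst 1)
        (fun k t => d k * eps (j - k%:Z) t) (xi j) &
      forall n, past xi n = past eps n].

End Sequences.

(* The sequence xi behind a canonical factorization lives on some probability
   space, which is not fixed in advance. *)
Definition canonical_factorization (R : realType) (f : R -> R)
    (d : nat -> R[i]) : Prop :=
  factorization f d /\
  exists (disp : measure_display) (T : measurableType disp)
         (P : probability T R) (xi eps : int -> T -> R[i]),
    stationary_with P f xi /\ canonical_representation P xi eps d.

(* Main.v *)
Require Import Defs.
From HB Require Import structures.
From mathcomp Require Import all_boot all_order all_algebra.
From mathcomp Require Import all_classical all_reals all_analysis measurable_realfun.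
From mathcomp Require Import complex zify ring lra.
Set Implicit Arguments.
Unset Strict Implicit.
Unset Printing Implicit Defensive.
Import Order.TTheory GRing.Theory Num.Theory.
Import numFieldNormedType.Exports.
Local Open Scope classical_set_scope.
Local Open Scope ring_scope.

(* Wold decomposition in L2(f).  When ln f is integrable, Jensen's formula for
   polynomials keeps the distance in L2(f) from 1 to the span of e^{ik lambda},
   k <= -1, away from 0.  The normalized innovation eps is such that the
   functions e^{ik lambda} eps, k in Z, are orthonormal; hence |eps|^2 f = 1
   almost everywhere, by uniqueness of Fourier coefficients, and these functions
   form a complete system.  Expanding 1 = sum_(k >= 0) d(k) e^{-ik lambda} eps
   gives a factorization f = |sum_k d(k) e^{-ik lambda}|^2, and, since the past is
   spanned by e^{ik lambda} eps, k <= -1, the minimal error is ||A d||^2.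
   For an arbitrary factorization f = |phi|^2, the same expansion with
   eps = 1 / phi and Bessel's inequality give Delta(h, f) >= ||A d||^2 for all h.
   Therefore min Delta(., f) = ||A d||^2 <= ||A d0||^2 <= min Delta(., f0).
   The noise of the representation of xi is the image of the noise given by the
   canonical factorization under the isometry mapping xi'(k) to xi(k). *)

(** * Complex numbers *)

(** The lower bound needs only causality: if e^{ij lambda} expands in noise of index at most j, then
    everything spanned by indices at most -1 is orthogonal to the noise of index k >= 0, and
    Bessel's inequality applies. Equality needs in addition that the noise of negative index lies in
    the past. The innovation has this by construction, whereas 1 / phi lacks it when phi has a
    nontrivial inner factor; this is why each density receives its own coefficients d from the Wold
    decomposition. Regularity serves twice: it keeps 1 out of the closed past, and it makes f
    positive almost everywhere, so that 1 / phi makes sense. Two classical tools take an elementary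
    form. Jensen's formula is needed only as the inequality that the mean of ln |e^{i lambda} - z|^2
    is nonnegative, which follows from invariance under rotations; zeros on the circle are removed
    by perturbation. Uniqueness of Fourier coefficients rests on trigonometric polynomials that
    converge boundedly to the indicator of an arc, followed by differentiation of the primitive. *)

Lemma sqmodE (R : realType) (z : R[i]) :
  sqmod z = complex.Re z ^+ 2 + complex.Im z ^+ 2.
Proof. by case: z => x y; rewrite /sqmod sqr_sqrtr// addr_ge0 ?sqr_ge0. Qed.

Lemma sqmod_ge0 (R : realType) (z : R[i]) : 0 <= sqmod z.
Proof. by rewrite sqmodE addr_ge0 ?sqr_ge0. Qed.

Lemma sqmod0 (R : realType) : sqmod (0 : R[i]) = 0.
Proof. by rewrite sqmodE /= expr0n/= addr0. Qed.

Lemma sqmodM (R : realType) (z w : R[i]) : sqmod (z * w) = sqmod z * sqmod w.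
Proof. by rewrite !sqmodE; case: z => x y; case: w => u v /=; ring. Qed.

Lemma sqmodJ (R : realType) (z : R[i]) : sqmod z^*%C = sqmod z.
Proof. by rewrite !sqmodE; case: z => x y /=; ring. Qed.

Lemma sqmodN (R : realType) (z : R[i]) : sqmod (- z) = sqmod z.
Proof. by rewrite !sqmodE; case: z => x y /=; ring. Qed.

Lemma sqmod_eq0 (R : realType) (z : R[i]) : sqmod z = 0 -> z = 0.
Proof.
rewrite sqmodE; case: z => x y /= /eqP.
rewrite paddr_eq0 ?sqr_ge0// !sqrf_eq0 => /andP[/eqP-> /eqP->].
by [].
Qed.

Lemma ler_sqmodD (R : realType) (z w : R[i]) :
  sqmod (z + w) <= 2 * sqmod z + 2 * sqmod w.
Proof.
rewrite !sqmodE; case: z => x y; case: w => u v /=.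
have := sqr_ge0 (x - u); have := sqr_ge0 (y - v); nra.
Qed.

Lemma sqmod_real (R : realType) (x : R) : sqmod x%:C%C = x ^+ 2.
Proof. by rewrite sqmodE /=; ring. Qed.
 
Lemma mulcJ (R : realType) (z : R[i]) : z * z^*%C = (sqmod z)%:C%C.
Proof.
by rewrite sqmodE; case: z => x y /=; apply/eqP; rewrite eq_complex /=; apply/andP; split; apply/eqP; ring.
Qed.

Lemma conjcR (R : realType) (x : R) : (x%:C)^*%C = x%:C%C.
Proof. exact: conjc_real. Qed.

Lemma conjcM (R : realType) (z w : R[i]) : (z * w)^*%C = z^*%C * w^*%C.
Proof. exact: rmorphM. Qed.

Lemma cReD (R : realType) (z w : R[i]) : complex.Re (z + w) = complex.Re z + complex.Re w.
Proof. by case: z => ? ?; case: w. Qed.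

Lemma invn_small (R : realType) (e : R) : 0 < e ->
  exists n0, forall n, (n0 <= n)%N -> n.+1%:R^-1 < e.
Proof.
move=> e0; exists (Num.truncn e^-1) => n hn.
rewrite invf_plt ?posrE//.
by apply: lt_le_trans (truncnS_gt _) _; rewrite ler_nat ltnS.
Qed.

(** * Hilbert spaces *)

(* ip may be degenerate: the elements of L2 are functions rather than classes,
   so that limits and projections are only unique up to N2 (x - y) = 0. *)
Record hilbert (R : realType) := Hilbert {
  carrier :> lmodType R[i];
  ip : carrier -> carrier -> R[i];
  ipDl : forall x y z, ip (x + y) z = ip x z + ip y z;
  ipZl : forall c x z, ip (c *: x) z = c * ip x z;
  ipC : forall x y, ip y x = (ip x y)^*%C;
  ip_ge0 : forall x, 0 <= complex.Re (ip x x);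
  ip_complete : forall u : nat -> carrier,
    (forall e : R, 0 < e -> exists n0, forall n m, (n0 <= n)%N -> (n0 <= m)%N ->
      complex.Re (ip (u n - u m) (u n - u m)) < e) ->
    exists x, forall e : R, 0 < e -> exists n0, forall n, (n0 <= n)%N ->
      complex.Re (ip (u n - x) (u n - x)) < e }.

Arguments ip : simpl never.

Section HilbertTheory.
Context (R : realType) (H : hilbert R).
Implicit Types (x y z : H) (c : R[i]).

Definition N2 x : R := complex.Re (ip x x).

Lemma N2_ge0 x : 0 <= N2 x. Proof. exact: ip_ge0. Qed.

Lemma ipDr x y z : ip x (y + z) = ip x y + ip x z.
Proof. by rewrite ipC ipDl [ip y x]ipC [ip z x]ipC rmorphD /= !conjcK. Qed.

Lemma ipZr c x y : ip x (c *: y) = c^*%C * ip x y.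
Proof. by rewrite ipC ipZl [ip y x]ipC rmorphM /= conjcK. Qed.

Lemma ip0l x : ip 0 x = 0.
Proof. by rewrite -(scale0r (0 : H)) ipZl mul0r. Qed.

Lemma ip0r x : ip x 0 = 0.
Proof. by rewrite ipC ip0l conjc0. Qed.

Lemma ipNl x y : ip (- x) y = - ip x y.
Proof. by rewrite -scaleN1r ipZl mulN1r. Qed.

Lemma ipNr x y : ip x (- y) = - ip x y.
Proof. by rewrite -scaleN1r ipZr rmorphN1 mulN1r. Qed.

Lemma ipBl x y z : ip (x - y) z = ip x z - ip y z.
Proof. by rewrite ipDl ipNl. Qed.

Lemma ipBr x y z : ip x (y - z) = ip x y - ip x z.
Proof. by rewrite ipDr ipNr. Qed.

Lemma ip_suml (I : Type) (s : seq I) (F : I -> H) y :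
  ip (\sum_(i <- s) F i) y = \sum_(i <- s) ip (F i) y.
Proof.
elim: s => [|i s IH]; first by rewrite !big_nil ip0l.
by rewrite !big_cons ipDl IH.
Qed.

Lemma ip_sumr (I : Type) (s : seq I) (F : I -> H) y :
  ip y (\sum_(i <- s) F i) = \sum_(i <- s) ip y (F i).
Proof.
elim: s => [|i s IH]; first by rewrite !big_nil ip0r.
by rewrite !big_cons ipDr IH.
Qed.

Lemma ipxx x : ip x x = (N2 x)%:C%C.
Proof.
rewrite /N2; have := ipC x x; case: (ip x x) => a b [] hb.
by congr (_ +i* _)%C; lra.
Qed.

Lemma N2_0 : N2 0 = 0. Proof. by rewrite /N2 ip0l. Qed.

Lemma N2Z c x : N2 (c *: x) = sqmod c * N2 x.
Proof.
rewrite /N2 ipZl ipZr mulrA mulcJ ipxx.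
by rewrite -rmorphM.
Qed.

Lemma N2N x : N2 (- x) = N2 x.
Proof. by rewrite /N2 ipNl ipNr opprK. Qed.

Lemma N2D x y : N2 (x + y) = N2 x + N2 y + 2 * complex.Re (ip x y).
Proof.
rewrite /N2 ipDl !ipDr [ip y x]ipC !cReD.
by case: (ip x y) => a b /=; ring.
Qed.

Lemma N2C x y : N2 (x - y) = N2 (y - x).
Proof. by rewrite -N2N opprB. Qed.

Lemma parallelogram x y : N2 (x + y) + N2 (x - y) = 2 * N2 x + 2 * N2 y.
Proof. by rewrite !N2D N2N ipNr; case: (ip x y) => a b /=; ring. Qed.

Lemma ler_N2D x y : N2 (x + y) <= 2 * N2 x + 2 * N2 y.
Proof. by rewrite -parallelogram lerDl N2_ge0. Qed.

Lemma ler_N2_mid z x y : N2 (x - y) <= 2 * N2 (x - z) + 2 * N2 (y - z).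
Proof.
by rewrite -(N2N (y - z)) opprB; have := ler_N2D (x - z) (z - y); rewrite addrA subrK.
Qed.

Lemma cauchy_schwarz x y : sqmod (ip x y) <= N2 x * N2 y.
Proof.
have [y0|ny0] := eqVneq (N2 y) 0; last first.
  have yp : 0 < N2 y by rewrite lt_def ny0 N2_ge0.
  have := N2_ge0 ((N2 y)%:C%C *: x - ip x y *: y).
  rewrite N2D N2N !N2Z sqmod_real ipNr ipZl ipZr.
  rewrite [_^*%C * _]mulrC mulcJ -rmorphM -rmorphN /=.
  move=> h; rewrite -subr_ge0 -(pmulr_rge0 _ yp); lra.
(* The form may be degenerate, so [N2 y = 0] does not give [y = 0]. Here the nonnegative number
   [N2 (x - t <x,y> y)] is affine in the real t, which forces its slope to vanish. *)
rewrite y0 mulr0.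
have key (t : R) : 0 <= N2 x - 2 * t * sqmod (ip x y).
  have := N2_ge0 (x - (t%:C%C * ip x y) *: y).
  rewrite N2D N2N N2Z y0 mulr0 addr0 ipNr ipZr conjcM conjcR.
  rewrite -mulrA [_^*%C * _]mulrC mulcJ -rmorphM -rmorphN /=; lra.
have [//|sp] := leP (sqmod (ip x y)) 0.
have := key ((N2 x + 1) / (2 * sqmod (ip x y))).
have -> : 2 * ((N2 x + 1) / (2 * sqmod (ip x y))) * sqmod (ip x y) = N2 x + 1.
  by field; rewrite gt_eqF.
lra.
Qed.

Definition cvgH (u : nat -> H) x := forall e : R, 0 < e ->
  exists n0, forall n, (n0 <= n)%N -> N2 (u n - x) < e.

Record closed_subspace (S : set H) : Prop := ClosedSubspace {
  csub0 : S 0;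
  csubD : forall x y, S x -> S y -> S (x + y);
  csubZ : forall c x, S x -> S (c *: x);
  csubC : forall x, (forall e : R, 0 < e -> exists2 y, S y & N2 (x - y) < e) -> S x }.

Lemma csubB S x y : closed_subspace S -> S x -> S y -> S (x - y).
Proof. by move=> cS Sx Sy; apply: csubD => //; rewrite -scaleN1r; apply: csubZ. Qed.

Lemma csub_sum S (I : eqType) (s : seq I) (F : I -> H) : closed_subspace S ->
  (forall i, i \in s -> S (F i)) -> S (\sum_(i <- s) F i).
Proof.
move=> cS; elim: s => [|i s IH] h; first by rewrite big_nil; apply: csub0.
rewrite big_cons; apply: csubD => //; first by apply: h; rewrite inE eqxx.
by apply: IH => j js; apply: h; rewrite inE js orbT.
Qed.

Lemma closed_cvg S u x : closed_subspace S -> (forall n, S (u n)) -> cvgH u x -> S x.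
Proof.
move=> cS Su ux; apply: (csubC cS) => e /ux[n0 h].
by exists (u n0) => //; rewrite N2C; exact: h.
Qed.

(** The midpoint of [y] and [z] lies in [S], so the parallelogram law turns two nearly minimal
    distances into closeness of [y] and [z]. This makes minimizing sequences Cauchy. *)
Lemma le_min_midpoint (m : R) S x y z : closed_subspace S ->
  (forall s, S s -> m <= N2 (x - s)) -> S y -> S z ->
  N2 (y - z) <= 2 * (N2 (x - y) - m) + 2 * (N2 (x - z) - m).
Proof.
move=> cS mS Sy Sz.
have Sm : S ((2^-1 : R)%:C%C *: (y + z)) by apply: csubZ => //; apply: csubD.
have := parallelogram (x - y) (x - z).
have -> : x - y - (x - z) = z - y.
  by rewrite opprB addrC addrA subrK.
have -> : x - y + (x - z) = (2 : R)%:C%C *: (x - (2^-1 : R)%:C%C *: (y + z)).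
  rewrite scalerBr scalerA -rmorphM /= divff ?pnatr_eq0// scale1r.
  by rewrite rmorph_nat scaler_nat mulr2n opprD addrACA.
have := mS _ Sm; rewrite N2Z sqmod_real (N2C z y) => h1 h2.
nra.
Qed.

Lemma projection S x : closed_subspace S ->
  exists2 y, S y & forall s, S s -> N2 (x - y) <= N2 (x - s).
Proof.
move=> cS.
pose E := [set r : R | exists2 s, S s & r = N2 (x - s)].
have E0 : has_inf E.
  split; first by exists (N2 (x - 0)); exists 0 => //; apply: csub0.
  by exists 0 => r [s _ ->]; exact: N2_ge0.
pose m := inf E.
have mS s : S s -> m <= N2 (x - s).
  by move=> Ss; apply: ge_inf; [exact: E0.2|exists s].
have /choice[u hu] n : exists s, S s /\ N2 (x - s) < m + n.+1%:R^-1.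
  have : exists2 r, E r & r < m + n.+1%:R^-1 by apply: inf_adherent.
  by move=> [r [s Ss ->] hr]; exists s.
have [|y hy] := @ip_complete R H u.
  move=> e e0; have [n0 hn0] := @invn_small R (e / 4) ltac:(lra).
  exists n0 => n k hn hk; have := le_min_midpoint cS mS (hu n).1 (hu k).1.
  rewrite /N2; move/le_lt_trans; apply.
  have := (hu n).2; have := (hu k).2; have := hn0 _ hn; have := hn0 _ hk.
  by rewrite /N2; move: (k.+1%:R^-1) (n.+1%:R^-1) => p q; lra.
have Sy : S y by apply: closed_cvg cS _ hy => n; exact: (hu n).1.
exists y => // s Ss; apply: le_trans (mS s Ss).
apply/ler_addgt0Pr => e e0.
(* [N2] is a squared norm: passing to the limit produces a cross term, bounded by Cauchy-Schwarz. *)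
have key n : N2 (x - y) <= N2 (x - u n) + N2 (u n - y) + 2 * Num.sqrt (N2 (x - u n) * N2 (u n - y)).
  have -> : x - y = (x - u n) + (u n - y) by rewrite addrA subrK.
  rewrite [in leLHS]N2D lerD2l ler_pM2l//.
  apply: le_trans (ler_norm _) _; rewrite -sqrtr_sqr ler_sqrt; last first.
    by rewrite mulr_ge0 ?N2_ge0.
  apply: le_trans (cauchy_schwarz _ _); rewrite sqmodE lerDl sqr_ge0 //.
pose C := m + 1.
have m0 : 0 <= m by apply: lb_le_inf; [exact: E0.1|move=> r [s' _ ->]; exact: N2_ge0].
(* [C] will bound [N2 (x - u n)], so the second entry makes the cross term at most 2 (e / 8). The
   gap to [m], the term [N2 (u n - y)] and the cross term then take at most e / 4 each. *)
pose d := Num.min (e / 4) ((e / 8) ^+ 2 / C).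
have C0 : 0 < C by rewrite /C; lra.
have d0 : 0 < d by rewrite lt_min !divr_gt0 ?exprn_gt0// divr_gt0.
have [n1 h1] := @invn_small R (e / 4) ltac:(lra).
have [n2 h2] := hy d d0.
pose n := maxn n1 n2.
apply: le_trans (key n) _.
have := h2 n (leq_maxr _ _); rewrite -/(N2 _) lt_min => /andP[k1 k2].
have k3 := h1 n (leq_maxl _ _); have k4 := (hu n).2.
have k5 : n.+1%:R^-1 <= 1 :> R by rewrite invf_le1 ?ltr0n// ler1n.
have : Num.sqrt (N2 (x - u n) * N2 (u n - y)) <= e / 8.
  rewrite -[leRHS]ger0_norm; last lra.
  rewrite -sqrtr_sqr ler_sqrt ?sqr_ge0//.
  move: k2; rewrite ltr_pdivlMr// => k2.
  apply: le_trans (ltW k2); rewrite mulrC ler_wpM2l ?N2_ge0//; rewrite /C; move: k4 k5; move: (n.+1%:R^-1) => p; lra.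
by move: k3 k4 k5; move: (n.+1%:R^-1) (Num.sqrt _) => p q; lra.
Qed.

Lemma projection_orth S x y : closed_subspace S -> S y ->
  (forall s, S s -> N2 (x - y) <= N2 (x - s)) -> forall s, S s -> ip (x - y) s = 0.
Proof.
move=> cS Sy hy s Ss; apply: sqmod_eq0; apply/eqP; rewrite eq_le sqmod_ge0 andbT.
set a := ip (x - y) s.
(* The competitor is y + t a s, for which the first-order term is real. The value t = 1 / N2 s used
   below minimizes the resulting quadratic. *)
have key (t : R) : 2 * t * sqmod a <= t ^+ 2 * (sqmod a * N2 s).
  have := hy (y + (t%:C%C * a) *: s) (csubD cS Sy (csubZ cS _ Ss)).
  rewrite opprD addrA [leRHS]N2D N2N N2Z ipNr ipZr -/a conjcM conjcR.
  rewrite -mulrA [_^*%C * _]mulrC mulcJ -rmorphM -rmorphN /= sqmodM sqmod_real; lra.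
have sa := sqmod_ge0 a; have sN := N2_ge0 s.
have [z0|n0] := eqVneq (N2 s) 0.
  by have := key 1; rewrite z0; lra.
have p0 : 0 < N2 s by rewrite lt_def n0.
have i0 : 0 < (N2 s)^-1 by rewrite invr_gt0.
have := key (N2 s)^-1.
have -> : (N2 s)^-1 ^+ 2 * (sqmod a * N2 s) = (N2 s)^-1 * sqmod a by field.
by rewrite -(pmulr_rle0 _ i0); lra.
Qed.

Lemma orth_closed (Y : set H) :
  closed_subspace [set x | forall y, Y y -> ip x y = 0].
Proof.
split.
- by move=> y _; rewrite ip0l.
- by move=> x y hx hy z Yz; rewrite ipDl hx// hy// addr0.
- by move=> c x hx z Yz; rewrite ipZl hx// mulr0.
- move=> x hx y Yy; apply: sqmod_eq0; apply/eqP; rewrite eq_le sqmod_ge0 andbT.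
  apply/ler_addgt0Pr => e e0; rewrite add0r.
  have N1 : 0 < N2 y + 1 by rewrite ltr_wpDl ?N2_ge0.
  have [z hz hN] := hx (e / (N2 y + 1)) (divr_gt0 e0 N1).
  rewrite -(subr0 (ip x y)) -(hz y Yy) -ipBl.
  apply: le_trans (cauchy_schwarz _ _) _.
  move: hN; rewrite ltr_pdivlMr// => /ltW; apply: le_trans.
  by rewrite ler_wpM2l ?N2_ge0// lerDl.
Qed.

(** * Closed linear spans *)

Section Cspan.
Context (I : eqType) (K : set I) (e : I -> H).

Definition cspan : set H :=
  [set x | forall d : R, 0 < d -> exists (s : seq I) (c : I -> R[i]),
    (forall k, k \in s -> K k) /\ N2 (x - \sum_(k <- s) c k *: e k) < d].

(** Coefficients are functions of the index, not of the position in the list, so two combinations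
    can be added only after both are written over one duplicate-free list. *)
Lemma lincomb_uniq (s u : seq I) (c : I -> R[i]) : uniq u -> {subset s <= u} ->
  exists c' : I -> R[i], \sum_(k <- s) c k *: e k = \sum_(k <- u) c' k *: e k.
Proof.
move=> uu; elim: s => [_|i s IH su].
  by exists (fun=> 0); rewrite big_nil big1// => k _; rewrite scale0r.
have [|c' hc'] := IH; first by move=> k ks; apply: su; rewrite inE ks orbT.
exists (fun k => (k == i)%:R * c i + c' k).
have iu : i \in u by apply: su; rewrite inE eqxx.
rewrite big_cons hc'; under [RHS]eq_bigr do rewrite scalerDl.
rewrite big_split/=; congr (_ + _).
rewrite (bigD1_seq i)//= eqxx mul1r big1 ?addr0// => k /negPf ->.
by rewrite mul0r scale0r.
Qed.

Lemma lincombD (s1 s2 : seq I) (c1 c2 : I -> R[i]) :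
  exists c : I -> R[i], \sum_(k <- s1) c1 k *: e k + \sum_(k <- s2) c2 k *: e k =
            \sum_(k <- undup (s1 ++ s2)) c k *: e k.
Proof.
have [|d1 ->] := @lincomb_uniq s1 (undup (s1 ++ s2)) c1 (undup_uniq _).
  by move=> k; rewrite mem_undup mem_cat => ->.
have [|d2 ->] := @lincomb_uniq s2 (undup (s1 ++ s2)) c2 (undup_uniq _).
  by move=> k; rewrite mem_undup mem_cat => ->; rewrite orbT.
exists (fun k => d1 k + d2 k); rewrite -big_split/=.
by apply: eq_bigr => k _; rewrite scalerDl.
Qed.

Lemma cspan_closed : closed_subspace cspan.
Proof.
split.
- by move=> d d0; exists [::], (fun=> 0); split=> //; rewrite big_nil subr0 N2_0.
- move=> x y hx hy d d0.
  have [s1 [c1 [k1 h1]]] := hx (d / 4) ltac:(lra).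
  have [s2 [c2 [k2 h2]]] := hy (d / 4) ltac:(lra).
  have [c hc] := lincombD s1 s2 c1 c2.
  exists (undup (s1 ++ s2)), c; split.
    by move=> k; rewrite mem_undup mem_cat => /orP[/k1|/k2].
  rewrite -hc opprD addrACA; apply: le_lt_trans (ler_N2D _ _) _; lra.
- move=> c x hx d d0.
  have s0 := sqmod_ge0 c.
  have [s [c' [k1 h1]]] := hx (d / (sqmod c + 1)) ltac:(rewrite divr_gt0//; lra).
  exists s, (fun k => c * c' k); split=> //.
  under eq_bigr do rewrite -scalerA.
  rewrite -scaler_sumr -scalerBr N2Z.
  move: h1; rewrite ltr_pdivlMr; last lra.
  by move=> h1; have := N2_ge0 (x - \sum_(k <- s) c' k *: e k); lra.
- move=> x hx d d0.
  have [y hy xy] := hx (d / 4) ltac:(lra).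
  have [s [c [k h]]] := hy (d / 4) ltac:(lra).
  exists s, c; split=> //.
  rewrite -(subrK y x) -addrA; apply: le_lt_trans (ler_N2D _ _) _; lra.
Qed.

Lemma cspan_gen k : K k -> cspan (e k).
Proof.
move=> Kk d d0; exists [:: k], (fun=> 1); split; first by move=> j; rewrite inE => /eqP ->.
by rewrite big_seq1 scale1r subrr N2_0.
Qed.

Lemma cspan_min S : closed_subspace S -> (forall k, K k -> S (e k)) -> cspan `<=` S.
Proof.
move=> cS Se x hx; apply: (csubC cS) => d /hx[s [c [ks h]]].
exists (\sum_(k <- s) c k *: e k) => //; apply: csub_sum => // k /ks Kk.
by apply: csubZ => //; exact: Se.
Qed.
End Cspan.

Lemma cspan_sub (I J : eqType) (K : set I) (e : I -> H) (K' : set J) (e' : J -> H) x :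
  (forall k, K k -> cspan K' e' (e k)) -> cspan K e x -> cspan K' e' x.
Proof.
move=> h hx; have := cspan_min (cspan_closed K' e') h; exact.
Qed.

Lemma cspan_orth (I : eqType) (K : set I) (e : I -> H) x y :
  (forall k, K k -> ip (e k) y = 0) -> cspan K e x -> ip x y = 0.
Proof.
move=> h hx; have hS : cspan K e `<=` [set z | forall w, [set w | w = y] w -> ip z w = 0].
  by apply: (cspan_min (orth_closed _)) => k Kk w ->; exact: h.
exact: (hS x hx y erefl).
Qed.

Lemma cspan_isometry (I : eqType) (K : set I) (e : I -> H) (g : H -> H) x :
  (forall c x y, g (c *: x + y) = c *: g x + g y) -> (forall x, N2 (g x) = N2 x) ->
  cspan K e x -> cspan K (g \o e) (g x).
Proof.
move=> glin gN hx d /hx[s [c [ks h]]]; exists s, c; split=> //.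
have g0 : g 0 = 0 by have := glin (-1) 0 0; rewrite scaler0 addr0 scaleN1r addNr.
have gs (r : seq I) : g (\sum_(k <- r) c k *: e k) = \sum_(k <- r) c k *: g (e k).
  by elim: r => [|i r IH]; rewrite ?big_nil// !big_cons glin IH.
rewrite /= -gs -(gN (x - _)) in h *; move: h.
have := glin (-1) (\sum_(k <- s) c k *: e k) x.
by rewrite !scaleN1r addrC => ->; rewrite addrC.
Qed.

Lemma cvg_ip u x y : cvgH u x -> forall d : R, 0 < d ->
  exists n0, forall n, (n0 <= n)%N -> sqmod (ip (u n) y - ip x y) < d.
Proof.
move=> ux d d0; have N1 : 0 < N2 y + 1 by rewrite ltr_wpDl ?N2_ge0.
have [n0 h] := ux (d / (N2 y + 1)) (divr_gt0 d0 N1).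
exists n0 => n /h; rewrite ltr_pdivlMr// -ipBl.
apply: le_lt_trans; apply: le_trans (cauchy_schwarz _ _) _.
by rewrite ler_wpM2l ?N2_ge0// lerDl.
Qed.

(** * Orthonormal sequences: Bessel and Parseval *)

Section Orthonormal.
Variable e : nat -> H.
Hypothesis eo : forall i j, ip (e i) (e j) = (i == j)%:R.

Definition fourier_sum x n := \sum_(k < n) ip x (e k) *: e k.

Lemma ip_fourier_sum x n k : (k < n)%N -> ip (x - fourier_sum x n) (e k) = 0.
Proof.
move=> kn; rewrite ipBl ip_suml (bigD1 (Ordinal kn))//= ipZl eo eqxx mulr1.
rewrite big1 ?addr0 ?subrr// => i ik; rewrite ipZl eo.
rewrite (_ : (_ == k) = false) ?mulr0//.
by apply: contraNF ik => /eqP ik; apply/eqP/val_inj.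
Qed.

Lemma N2_fourier_rem x n :
  N2 (x - fourier_sum x n) = N2 x - \sum_(k < n) sqmod (ip x (e k)).
Proof.
rewrite [in LHS]/N2 ipBr [X in _ - X]ip_sumr [X in _ - X]big1; last first.
  by move=> i _; rewrite ipZr ip_fourier_sum// mulr0.
rewrite subr0 ipBl ip_suml.
under eq_bigr => i _.
  rewrite ipZl [ip (e i) x]ipC mulcJ; over.
rewrite -rmorph_sum ipxx -rmorphB /=. by [].
Qed.

Lemma bessel x n : \sum_(k < n) sqmod (ip x (e k)) <= N2 x.
Proof. by rewrite -subr_ge0 -N2_fourier_rem N2_ge0. Qed.

Lemma le_fourier_rem x n s (c : nat -> R[i]) : (forall k, k \in s -> (k < n)%N) ->
  N2 (x - fourier_sum x n) <= N2 (x - \sum_(k <- s) c k *: e k).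
Proof.
move=> hs; set p := \sum_(k <- s) _.
have -> : x - p = (x - fourier_sum x n) + (fourier_sum x n - p).
  by rewrite addrA subrK.
rewrite [leRHS]N2D (_ : ip (x - _) _ = 0) /=; last first.
  rewrite ipBr !ip_sumr !big1_seq ?subrr//.
    by move=> i /andP[_ /hs i_n]; rewrite ipZr ip_fourier_sum// mulr0.
  by move=> i _; rewrite ipZr ip_fourier_sum// mulr0.
by rewrite mulr0 addr0 lerDl N2_ge0.
Qed.

Lemma cvg_fourier_sum x : cspan setT e x -> cvgH (fourier_sum x) x.
Proof.
move=> hx d d0; have [s [c [_ h]]] := hx d d0.
exists (\max_(k <- s) k).+1 => n hn; rewrite N2C; apply: le_lt_trans h.
apply: le_fourier_rem => k ks; apply: leq_trans hn; rewrite ltnS.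
by rewrite (big_rem k)//= leq_maxl.
Qed.

Lemma cvg_parseval x : cspan setT e x ->
  (\sum_(0 <= k <oo) (sqmod (ip x (e k)))%:E)%E = (N2 x)%:E.
Proof.
move=> hx; apply: cvg_lim => //.
rewrite (_ : (fun n => _) = (EFin \o (fun n => \sum_(k < n) sqmod (ip x (e k))))); last first.
  by apply/funext => n /=; rewrite big_mkord sumEFin.
apply: cvg_EFin; first exact: nearW.
apply/(@cvgrPdist_lt _ R^o) => d d0; have [n0 h] := cvg_fourier_sum hx d0.
exists n0 => // n /= hn; have := h n hn; rewrite N2C N2_fourier_rem.
by rewrite ger0_norm// subr_ge0 bessel.
Qed.

End Orthonormal.
End HilbertTheory.

(** * Transport along an isometry *)

Section ProdHilbert.
Context (R : realType) (H1 H2 : hilbert R).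

Definition ip_prod (z w : (H1 * H2)%type) : R[i] := ip z.1 w.1 + ip z.2 w.2.

Lemma ip_prodDl x y z : ip_prod (x + y) z = ip_prod x z + ip_prod y z.
Proof. by rewrite /ip_prod !ipDl addrACA. Qed.

Lemma ip_prodZl c x z : ip_prod (c *: x) z = c * ip_prod x z.
Proof. by rewrite /ip_prod !ipZl mulrDr. Qed.

Lemma ip_prodC x y : ip_prod y x = (ip_prod x y)^*%C.
Proof. by rewrite /ip_prod ipC [ip y.2 _]ipC [RHS]rmorphD. Qed.

Lemma Re_ip_prod x : complex.Re (ip_prod x x) = N2 x.1 + N2 x.2.
Proof. by rewrite /ip_prod cReD. Qed.

Lemma ip_prod_ge0 x : 0 <= complex.Re (ip_prod x x).
Proof. by rewrite Re_ip_prod addr_ge0 ?N2_ge0. Qed.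

Lemma ip_prod_complete (u : nat -> (H1 * H2)%type) :
    (forall e : R, 0 < e -> exists n0, forall n m, (n0 <= n)%N -> (n0 <= m)%N ->
      complex.Re (ip_prod (u n - u m) (u n - u m)) < e) ->
    exists x, forall e : R, 0 < e -> exists n0, forall n, (n0 <= n)%N ->
      complex.Re (ip_prod (u n - x) (u n - x)) < e.
Proof.
move=> hu.
have [e /hu[n0 h]|x1 hx1] := @ip_complete R H1 (fun n => (u n).1).
  exists n0 => n m hn hm; have := h n m hn hm; rewrite Re_ip_prod /=.
  by have := N2_ge0 ((u n).2 - (u m).2); rewrite /N2; lra.
have [e /hu[n0 h]|x2 hx2] := @ip_complete R H2 (fun n => (u n).2).
  exists n0 => n m hn hm; have := h n m hn hm; rewrite Re_ip_prod /=.
  by have := N2_ge0 ((u n).1 - (u m).1); rewrite /N2; lra.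
exists (x1, x2) => e e0.
have [n1 h1] := hx1 (e / 2) ltac:(lra).
have [n2 h2] := hx2 (e / 2) ltac:(lra).
exists (maxn n1 n2) => n; rewrite geq_max => /andP[/h1 k1 /h2 k2].
by rewrite Re_ip_prod /N2 /=; lra.
Qed.

Definition prod_hilbert : hilbert R :=
  @Hilbert R (H1 * H2)%type ip_prod ip_prodDl ip_prodZl ip_prodC ip_prod_ge0
    ip_prod_complete.

Lemma N2_prod (z : prod_hilbert) : N2 z = N2 z.1 + N2 z.2.
Proof. exact: Re_ip_prod. Qed.

Lemma pair_lincomb (I : Type) (s : seq I) (c : I -> R[i]) (x : I -> H1) (y : I -> H2) :
  \sum_(k <- s) c k *: ((x k, y k) : prod_hilbert) =
  (\sum_(k <- s) c k *: x k, \sum_(k <- s) c k *: y k).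
Proof.
elim: s => [|i s IH]; first by rewrite !big_nil.
by rewrite !big_cons IH.
Qed.
End ProdHilbert.

Section Transfer.
Context (R : realType) (H1 H2 : hilbert R) (I : eqType).
Variables (x : I -> H1) (y : I -> H2).
Hypothesis gram : forall i j, ip (x i) (x j) = ip (y i) (y j).

(* The closed span of xy is the graph of the isometry mapping x k to y k. *)
Let xy k : prod_hilbert H1 H2 := (x k, y k).

Lemma cspan_pair_snd K z : cspan K xy z -> cspan K y z.2.
Proof.
move=> hz d /hz[s [c [ks h]]]; exists s, c; split=> //.
apply: le_lt_trans h; rewrite N2_prod pair_lincomb/=.
by rewrite lerDr N2_ge0.
Qed.

(** The conclusion says that [z] is orthogonal to [(w.1, - w.2)], a closed condition on [z] and, by
    symmetry, on [w]. It extends from the generators, where it is [gram], in one variable after the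
    other. *)
Lemma cspan_pair_ip K L z w : cspan K xy z -> cspan L xy w ->
  ip z.1 w.1 = ip z.2 w.2.
Proof.
pose S (w : prod_hilbert H1 H2) :=
  [set z : prod_hilbert H1 H2 | forall v, v = (w.1, - w.2) -> ip z v = 0].
have SE v u : S v u <-> ip u.1 v.1 = ip u.2 v.2.
  split=> [/(_ _ erefl)|h _ ->]; rewrite {1}/ip/= /ip_prod/= ipNr.
    by move/eqP; rewrite subr_eq0 => /eqP.
  by rewrite h subrr.
have cS v : closed_subspace (S v) by exact: orth_closed.
move=> hz hw; apply/SE; suff : cspan K xy `<=` S w by exact.
apply: cspan_min => // k _.
apply/SE; rewrite ipC [RHS]ipC; congr (_^*%C); apply/SE.
suff : cspan L xy `<=` S (xy k) by exact.
by apply: cspan_min => // j _; apply/SE; exact: gram.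
Qed.

(** Take combinations of the [x k] converging to [u]. The same combinations of the [y k] form a
    Cauchy sequence because the graph is isometric, and completeness of [H2] supplies the second
    coordinate. *)
Lemma cspan_pair_ex K u : cspan K x u -> exists v, cspan K xy (u, v).
Proof.
move=> hu.
have /choice[sc hsc] (n : nat) : exists sc : seq I * (I -> R[i]),
    (forall k, k \in sc.1 -> K k) /\ N2 (u - \sum_(k <- sc.1) sc.2 k *: x k) < n.+1%:R^-1.
  have [|s [c h]] := hu n.+1%:R^-1; first by rewrite invr_gt0.
  by exists (s, c).
pose z n : prod_hilbert H1 H2 := \sum_(k <- (sc n).1) (sc n).2 k *: xy k.
have zE n : z n = (\sum_(k <- (sc n).1) (sc n).2 k *: x k,
                   \sum_(k <- (sc n).1) (sc n).2 k *: y k).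
  exact: pair_lincomb.
have zK n : cspan K xy (z n).
  apply: csub_sum; first exact: cspan_closed.
  move=> k ks; have Kk := (hsc n).1 k ks; apply: (csubZ (cspan_closed _ _)).
  exact: cspan_gen.
have [|v hv] := @ip_complete R H2 (fun n => (z n).2).
  move=> d d0; have [n0 hn0] := @invn_small R (d / 4) ltac:(lra).
  exists n0 => n m hn hm.
  have zz : cspan K xy (z n - z m) by exact: (csubB (cspan_closed _ _) (zK n) (zK m)).
  have -> : ip ((z n).2 - (z m).2) ((z n).2 - (z m).2) = ip (z n - z m).1 (z n - z m).1.
    by rewrite (cspan_pair_ip zz zz).
  have h1 := lt_trans (hsc n).2 (hn0 n hn).
  have h2 := lt_trans (hsc m).2 (hn0 m hm).
  apply: le_lt_trans (ler_N2_mid u _ _) _.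
  by rewrite !(zE _) /= (N2C _ u) [N2 (_ - u)]N2C; lra.
exists v; apply: (closed_cvg (cspan_closed _ _) zK _).
move=> d d0.
have [n1 h1] := @invn_small R (d / 2) ltac:(lra).
have [n2 h2] := hv (d / 2) ltac:(lra).
exists (maxn n1 n2) => n; rewrite geq_max => /andP[/h1 k1 /h2 k2].
rewrite N2_prod /=; have := lt_trans (hsc n).2 k1.
by rewrite N2C zE /= in k2 *; rewrite /N2 in k2 *; lra.
Qed.
End Transfer.

(** [e' n] is the second coordinate of a graph point over [e n]. Differences of graph points stay in
    the graph, where both coordinates have the same norm, so inner products and limits carry over
    from [x], [e] to [y], [e']. *)
Lemma transfer_representation (R : realType) (H1 H2 : hilbert R)
    (x e : int -> H1) (y : int -> H2) (d : nat -> R[i]) :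
  (forall i j, ip (x i) (x j) = ip (y i) (y j)) ->
  (forall i j, ip (e i) (e j) = (i == j)%:R) ->
  (forall j, cvgH (fun n => \sum_(k < n) d k *: e (j - k%:Z)) (x j)) ->
  (forall n : int, cspan [set k | k <= n] x (e n)) ->
  exists e' : int -> H2,
    [/\ forall i j, ip (e' i) (e' j) = (i == j)%:R,
        forall j, cvgH (fun n => \sum_(k < n) d k *: e' (j - k%:Z)) (y j) &
        forall n : int, cspan [set k | k <= n] y = cspan [set k | k <= n] e'].
Proof.
move=> gram eo xe ex.
pose xy k : prod_hilbert H1 H2 := (x k, y k).
have /choice[e' he'] (n : int) := cspan_pair_ex gram (ex n).
exists e'.
have ye (j : int) : cvgH (fun n => \sum_(k < n) d k *: e' (j - k%:Z)) (y j).
  move=> eps /(xe j)[n0 h]; exists n0 => n /h; rewrite /N2.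
  pose z : prod_hilbert H1 H2 := \sum_(k < n) d k *: ((e (j - k%:Z), e' (j - k%:Z)) : prod_hilbert H1 H2)
     - (x j, y j).
  have zE : z = (\sum_(k < n) d k *: e (j - k%:Z) - x j, \sum_(k < n) d k *: e' (j - k%:Z) - y j).
    by rewrite /z pair_lincomb.
  have zs : cspan setT xy z.
    apply: (csubB (cspan_closed _ _) _ _).
    - apply: csub_sum => [|k _]; first exact: cspan_closed.
      apply: (csubZ (cspan_closed _ _)).
      suff : cspan [set i : int | i <= j - k%:Z] xy `<=` cspan setT xy by exact.
      apply: cspan_min; first exact: cspan_closed.
      by move=> i _; exact: cspan_gen.
    - exact: (@cspan_gen _ _ _ _ xy).
  by have := cspan_pair_ip gram zs zs; rewrite zE/= => ->.
split=> //.
  by move=> i j; rewrite -eo; have := cspan_pair_ip gram (he' i) (he' j).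
(* One inclusion comes from the moving average, whose indices k - i do not exceed k; the other from
   [e' k] being a limit of combinations of the [y i], i <= k. *)
move=> n; apply/seteqP; split.
- apply: cspan_min; first exact: cspan_closed.
  move=> k /= kn; apply: (closed_cvg (cspan_closed _ _)) (ye k).
  move=> m; apply: (csub_sum (cspan_closed _ _)) => i _.
  apply: (csubZ (cspan_closed _ _)).
  by apply: cspan_gen => /=; rewrite lerBlDr (le_trans kn)// lerDl.
- apply: cspan_min; first exact: cspan_closed.
  move=> k /= kn; have := cspan_pair_snd (he' k) => /=.
  suff : cspan [set i : int | i <= k] y `<=` cspan [set i : int | i <= n] y by exact.
  apply: cspan_min; first exact: cspan_closed.
  by move=> i /= ik; apply: cspan_gen => /=; exact: le_trans kn.
Qed.

Lemma cReM (R : realType) (z w : R[i]) :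
  complex.Re (z * w) = complex.Re z * complex.Re w - complex.Im z * complex.Im w.
Proof. by case: z => ? ?; case: w. Qed.

Lemma cImM (R : realType) (z w : R[i]) :
  complex.Im (z * w) = complex.Re z * complex.Im w + complex.Im z * complex.Re w.
Proof. by case: z => ? ?; case: w => ? ? /=; rewrite addrC. Qed.

Lemma cImD (R : realType) (z w : R[i]) : complex.Im (z + w) = complex.Im z + complex.Im w.
Proof. by case: z => ? ?; case: w. Qed.

Lemma cReN (R : realType) (z : R[i]) : complex.Re (- z) = - complex.Re z.
Proof. by case: z. Qed.

Lemma cImN (R : realType) (z : R[i]) : complex.Im (- z) = - complex.Im z.
Proof. by case: z. Qed.

Lemma cReJ (R : realType) (z : R[i]) : complex.Re z^*%C = complex.Re z.
Proof. by case: z. Qed.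

Lemma cImJ (R : realType) (z : R[i]) : complex.Im z^*%C = - complex.Im z.
Proof. by case: z. Qed.

Lemma complex_eq (R : realType) (z w : R[i]) :
  complex.Re z = complex.Re w -> complex.Im z = complex.Im w -> z = w.
Proof. by case: z => ? ?; case: w => ? ? /= -> ->. Qed.

Lemma Re_sum (R : realType) (I : Type) (s : seq I) (F : I -> R[i]) :
  complex.Re (\sum_(i <- s) F i) = \sum_(i <- s) complex.Re (F i).
Proof. by elim: s => [|i s IH]; rewrite ?big_nil// !big_cons cReD IH. Qed.

Lemma Im_sum (R : realType) (I : Type) (s : seq I) (F : I -> R[i]) :
  complex.Im (\sum_(i <- s) F i) = \sum_(i <- s) complex.Im (F i).
Proof. by elim: s => [|i s IH]; rewrite ?big_nil// !big_cons cImD IH. Qed.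

(** * Integration of complex functions *)

Section ComplexMeasurable.
Context (R : realType) (disp : measure_display) (T : measurableType disp).
Variables (D : set T).
Implicit Types g h : T -> R[i].

Lemma cmeasurable_cst (c : R[i]) : cmeasurable D (fun=> c).
Proof. by split; exact: measurable_cst. Qed.

Lemma cmeasurableD g h : cmeasurable D g -> cmeasurable D h ->
  cmeasurable D (fun t => g t + h t).
Proof.
move=> [g1 g2] [h1 h2]; split.
  by under eq_fun do rewrite cReD; exact: measurable_funD.
by under eq_fun do rewrite cImD; exact: measurable_funD.
Qed.

Lemma cmeasurableM g h : cmeasurable D g -> cmeasurable D h ->
  cmeasurable D (fun t => g t * h t).
Proof.
move=> [g1 g2] [h1 h2]; split.
  under eq_fun do rewrite cReM.
  by apply: measurable_funB; exact: measurable_funM.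
under eq_fun do rewrite cImM.
by apply: measurable_funD; exact: measurable_funM.
Qed.

Lemma cmeasurableJ g : cmeasurable D g -> cmeasurable D (fun t => (g t)^*%C).
Proof.
move=> [g1 g2]; split; first by under eq_fun do rewrite cReJ.
by under eq_fun do rewrite cImJ; exact: measurableT_comp.
Qed.

Lemma cmeasurable_real (w : T -> R) : measurable_fun D w ->
  cmeasurable D (fun t => (w t)%:C%C).
Proof. by move=> mw; split=> //; exact: measurable_cst. Qed.

Lemma cmeasurableB g h : cmeasurable D g -> cmeasurable D h ->
  cmeasurable D (fun t => g t - h t).
Proof.
move=> mg mh; under eq_fun do rewrite -mulN1r.
by apply: cmeasurableD => //; apply: cmeasurableM => //; exact: cmeasurable_cst.
Qed.

Lemma cmeasurable_sum (I : Type) (s : seq I) (F : I -> T -> R[i]) :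
  (forall i, cmeasurable D (F i)) -> cmeasurable D (fun t => \sum_(i <- s) F i t).
Proof.
move=> mF; elim: s => [|i s IH].
  by under eq_fun do rewrite big_nil; exact: cmeasurable_cst.
by under eq_fun do rewrite big_cons; exact: cmeasurableD.
Qed.

Lemma measurable_sqmod g : cmeasurable D g -> measurable_fun D (fun t => sqmod (g t)).
Proof.
move=> [g1 g2]; under eq_fun do rewrite sqmodE.
by apply: measurable_funD; exact: measurable_funX.
Qed.

End ComplexMeasurable.

Section ComplexIntegral.
Context (R : realType) (disp : measure_display) (T : measurableType disp).
Variables (mu : {measure set T -> \bar R}) (D : set T).
Hypothesis mD : measurable D.
Implicit Types g h : T -> R[i].

Definition cintegrable g : Prop :=
  mu.-integrable D (fun t => (complex.Re (g t))%:E) /\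
  mu.-integrable D (fun t => (complex.Im (g t))%:E).

Lemma integrableDE (f1 f2 : T -> R) : mu.-integrable D (fun t => (f1 t)%:E) ->
  mu.-integrable D (fun t => (f2 t)%:E) -> mu.-integrable D (fun t => (f1 t + f2 t)%:E).
Proof. by move=> h1 h2; have := integrableD mD h1 h2. Qed.

Lemma integrableZE (c : R) (f1 : T -> R) : mu.-integrable D (fun t => (f1 t)%:E) ->
  mu.-integrable D (fun t => (c * f1 t)%:E).
Proof. by move=> h1; have := integrableZl mD c h1. Qed.

Lemma integrableNE (f1 : T -> R) : mu.-integrable D (fun t => (f1 t)%:E) ->
  mu.-integrable D (fun t => (- f1 t)%:E).
Proof.
by move=> h; under eq_fun do rewrite -mulN1r; exact: integrableZE.
Qed.

Lemma le_integrableE (f1 u : T -> R) : measurable_fun D f1 ->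
  (forall t, D t -> `|f1 t| <= u t) -> mu.-integrable D (fun t => (u t)%:E) ->
  mu.-integrable D (fun t => (f1 t)%:E).
Proof.
move=> m1 h; apply: le_integrable => //; first exact/measurable_EFinP.
by move=> t Dt /=; rewrite lee_fin (le_trans (h t Dt))// ler_norm.
Qed.

Lemma integrable_meas (f1 : T -> R) : mu.-integrable D (fun t => (f1 t)%:E) ->
  measurable_fun D f1.
Proof. by move/measurable_int/measurable_EFinP. Qed.

Lemma cintegrableD g h : cintegrable g -> cintegrable h ->
  cintegrable (fun t => g t + h t).
Proof.
move=> [g1 g2] [h1 h2]; split.
  by under eq_fun do rewrite cReD; exact: integrableDE.
by under eq_fun do rewrite cImD; exact: integrableDE.
Qed.

Lemma cintegrableZ c g : cintegrable g -> cintegrable (fun t => c * g t).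
Proof.
move=> [g1 g2]; split.
  under eq_fun do rewrite cReM.
  by apply: integrableDE; [exact: integrableZE|apply/integrableNE/integrableZE].
under eq_fun do rewrite cImM.
by apply: integrableDE; exact: integrableZE.
Qed.

Lemma cintegrableB g h : cintegrable g -> cintegrable h ->
  cintegrable (fun t => g t - h t).
Proof.
move=> ig ih; under eq_fun do rewrite -mulN1r.
by apply: cintegrableD => //; exact: cintegrableZ.
Qed.

Lemma cintegrable_meas g : cintegrable g -> cmeasurable D g.
Proof. by move=> [g1 g2]; split; exact: integrable_meas. Qed.

Lemma le_cintegrable g (u : T -> R) : cmeasurable D g ->
  (forall t, D t -> `|complex.Re (g t)| <= u t) ->
  (forall t, D t -> `|complex.Im (g t)| <= u t) ->
  mu.-integrable D (fun t => (u t)%:E) -> cintegrable g.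
Proof. by move=> [m1 m2] h1 h2 iu; split; exact: le_integrableE iu. Qed.

Lemma cintegralD g h : cintegrable g -> cintegrable h ->
  cintegral mu D (fun t => g t + h t) = cintegral mu D g + cintegral mu D h.
Proof.
move=> [g1 g2] [h1 h2]; apply: complex_eq => /=.
  by under eq_Rintegral do rewrite cReD; rewrite RintegralD.
by under eq_Rintegral do rewrite cImD; rewrite RintegralD.
Qed.

Lemma cintegralZ c g : cintegrable g ->
  cintegral mu D (fun t => c * g t) = c * cintegral mu D g.
Proof.
move=> [g1 g2]; apply: complex_eq => /=.
  under eq_Rintegral do rewrite cReM.
  rewrite cReM /= RintegralB//; [|exact: integrableZE..].
  by rewrite !RintegralZl.
under eq_Rintegral do rewrite cImM.
rewrite cImM /= RintegralD//; [|exact: integrableZE..].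
by rewrite !RintegralZl.
Qed.

Lemma cintegralB g h : cintegrable g -> cintegrable h ->
  cintegral mu D (fun t => g t - h t) = cintegral mu D g - cintegral mu D h.
Proof.
move=> ig ih; rewrite -mulN1r -cintegralZ// -cintegralD//; last exact: cintegrableZ.
by congr (cintegral _ _ _); apply/funext => t; rewrite mulN1r.
Qed.

Lemma cintegralJ g : cintegrable g ->
  cintegral mu D (fun t => (g t)^*%C) = (cintegral mu D g)^*%C.
Proof.
move=> [g1 g2]; apply: complex_eq; rewrite ?cReJ ?cImJ /=.
  by apply: eq_Rintegral => t _; rewrite cReJ.
rewrite -[RHS]mulN1r -RintegralZl//.
by apply: eq_Rintegral => t _; rewrite cImJ mulN1r.
Qed.

Lemma eq_cintegral g h : (forall t, D t -> g t = h t) ->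
  cintegral mu D g = cintegral mu D h.
Proof.
by move=> gh; apply: complex_eq => /=; apply: eq_Rintegral => t /set_mem Dt; rewrite gh.
Qed.

Lemma ae_eq_cintegral g h : cmeasurable D g -> cmeasurable D h ->
  {ae mu, forall t, D t -> g t = h t} -> cintegral mu D g = cintegral mu D h.
Proof.
move=> [g1 g2] [h1 h2] gh; apply: complex_eq => /=; congr fine.
  apply: ae_eq_integral => //; [exact/measurable_EFinP..|].
  by apply: filterS gh => t + Dt => ->.
apply: ae_eq_integral => //; [exact/measurable_EFinP..|].
by apply: filterS gh => t + Dt => ->.
Qed.

Lemma ae_le_Rintegral (f1 f2 : T -> R) : mu.-integrable D (fun t => (f1 t)%:E) ->
  mu.-integrable D (fun t => (f2 t)%:E) -> {ae mu, forall t, D t -> f1 t <= f2 t} ->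
  \int[mu]_(t in D) f1 t <= \int[mu]_(t in D) f2 t.
Proof.
move=> i1 i2 le12; pose g t := Num.min (f1 t) (f2 t).
have mg : measurable_fun D g by apply: measurable_minr; exact: integrable_meas.
have ig : mu.-integrable D (fun t => (g t)%:E).
  have : mu.-integrable D (fun t => (`|f1 t| + `|f2 t|)%:E).
    by apply: integrableDE; [exact: (integrable_norm i1)|exact: (integrable_norm i2)].
  apply: le_integrableE => // t _; rewrite /g.
  by case: (leP (f1 t) (f2 t)) => _; rewrite ?lerDl ?lerDr.
rewrite (_ : \int[mu]_(t in D) f1 t = \int[mu]_(t in D) g t).
  by apply: le_Rintegral => //= t _; rewrite /g ge_min lexx orbT.
congr fine; apply: ae_eq_integral => //.
- exact: measurable_int i1.
- exact/measurable_EFinP.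
- by apply: filterS le12 => t + Dt => /(_ Dt) h; rewrite /g min_l.
Qed.

End ComplexIntegral.

(** * Weighted L2 spaces *)

Lemma cvg_of_fast_increments (R : realType) (v : nat -> R) (M : R) :
  (forall k, 4 ^+ k * (v k.+1 - v k) ^+ 2 <= M) -> cvgn v.
Proof.
move=> hM.
(* [M + 1] stands in for the square root of [M]: a^2 <= M implies a <= M + 1. *)
have h k : `|v k.+1 - v k| <= (M + 1) * 2^-1 ^+ k.
  have p : 0 < (2 : R) ^+ k by rewrite exprn_gt0.
  rewrite exprVn ler_pdivlMr//.
  have : (`|v k.+1 - v k| * 2 ^+ k) ^+ 2 <= M.
    rewrite exprMn real_normK ?num_real// -exprM mulnC exprM.
    by rewrite (_ : 2 ^+ 2 = 4) ?[_ * 4 ^+ _]mulrC ?hM// -natrX.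
  set a := _ * _ => ha; have := sqr_ge0 (a - 1); have := sqr_ge0 a; nra.
have cs : cvgn (series (fun k => v k.+1 - v k)).
  apply: normed_cvg; apply: (series_le_cvg (v_ := fun k => (M + 1) * 2^-1 ^+ k)).
  - by move=> k; exact: normr_ge0.
  - by move=> k; apply: le_trans (h k); exact: normr_ge0.
  - by move=> k; exact: h.
  - by apply: is_cvg_geometric_series; rewrite ger0_norm// invf_lt1// ltr1n.
have E : v = (fun n => v 0%N + series (fun k => v k.+1 - v k) n).
  apply/funext => n; rewrite seriesEnat /= telescope_sumr// addrC subrK//.
by rewrite E; apply: is_cvgD => //; exact: is_cvg_cst.
Qed.

Lemma einf_le_near (R : realType) (u : nat -> \bar R) (e : \bar R) n0 :
  (forall n, (n0 <= n)%N -> (u n <= e)%E) -> (limn_einf u <= e)%E.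
Proof.
move=> h; rewrite limn_einf_lim; apply: lime_le; first exact: is_cvg_einfs.
apply: nearW => n; apply: (@le_trans _ _ (u (maxn n n0))); last first.
  by apply: h; rewrite leq_maxr.
by apply: ereal_inf_lbound; exists (maxn n n0) => //=; rewrite leq_maxl.
Qed.

Lemma norm_mulcJ_le (R : realType) (z v : R[i]) : `|complex.Re (z * v^*%C)| <= sqmod z + sqmod v /\
  `|complex.Im (z * v^*%C)| <= sqmod z + sqmod v.
Proof.
rewrite !sqmodE cReM cImM cReJ cImJ; case: z => a b; case: v => c d /=; split.
  rewrite ler_norml; apply/andP; split.
    by have := sqr_ge0 (a + c); have := sqr_ge0 (b + d); have := sqr_ge0 a; have := sqr_ge0 b;
    have := sqr_ge0 c; have := sqr_ge0 d; lra.
  by have := sqr_ge0 (a - c); have := sqr_ge0 (b - d); have := sqr_ge0 a; have := sqr_ge0 b;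
    have := sqr_ge0 c; have := sqr_ge0 d; lra.
rewrite ler_norml; apply/andP; split.
  by have := sqr_ge0 (b + c); have := sqr_ge0 (a - d); have := sqr_ge0 a; have := sqr_ge0 b;
    have := sqr_ge0 c; have := sqr_ge0 d; lra.
by have := sqr_ge0 (b - c); have := sqr_ge0 (a + d); have := sqr_ge0 a; have := sqr_ge0 b;
  have := sqr_ge0 c; have := sqr_ge0 d; lra.
Qed.

(** One structure covers both spaces in play, L2(f) on the circle and L2(P) with weight 1, so that
    completeness and closed spans are treated once. *)
Record wspace (R : realType) := WSpace {
  wdisp : measure_display;
  wT : measurableType wdisp;
  wmu : {measure set wT -> \bar R};
  wD : set wT;
  ww : wT -> R;
  wmD : measurable wD;
  wmw : measurable_fun wD ww;
  ww_ge0 : forall t, wD t -> 0 <= ww t }.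

Section WeightedL2.
Context (R : realType) (W : wspace R).
Let T := wT W.
Let mu := wmu W.
Let D := @wD R W.
Let w : T -> R := @ww R W.
Let mD : measurable D := wmD W.
Implicit Types g h : T -> R[i].

Notation L2W := (L2 mu D w).
Notation sqn := (sqnorm mu D w).

Lemma sqw_ge0 g t : D t -> 0 <= sqmod (g t) * w t.
Proof. by move=> Dt; rewrite mulr_ge0 ?sqmod_ge0// ww_ge0. Qed.

Lemma measurable_sqw g : cmeasurable D g -> measurable_fun D (fun t => sqmod (g t) * w t).
Proof. by move=> mg; apply: measurable_funM; [exact: measurable_sqmod|exact: wmw]. Qed.

Lemma sqn_ge0 g : (0 <= sqn g)%E.
Proof. by apply: integral_ge0 => t Dt; rewrite lee_fin sqw_ge0. Qed.

Lemma integrable_sqw g : L2W g -> mu.-integrable D (fun t => (sqmod (g t) * w t)%:E).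
Proof.
move=> [mg hg]; apply/integrableP; split.
  by apply/measurable_EFinP; exact: measurable_sqw.
apply: le_lt_trans hg; apply: ge0_le_integral => //.
- by apply: measurableT_comp => //; apply/measurable_EFinP; exact: measurable_sqw.
- by apply/measurable_EFinP; exact: measurable_sqw.
- by move=> t Dt; rewrite /= ger0_norm// sqw_ge0.
Qed.

Lemma L2P_integrable g : cmeasurable D g ->
  mu.-integrable D (fun t => (sqmod (g t) * w t)%:E) -> L2W g.
Proof. by move=> mg ig; split=> //; exact: integrable_lty. Qed.

Lemma le_L2 g h1 h2 (c : R) : cmeasurable D g -> L2W h1 -> L2W h2 ->
  (forall t, D t -> sqmod (g t) <= c * (sqmod (h1 t) + sqmod (h2 t))) -> L2W g.
Proof.
move=> mg i1 i2 gh; apply: L2P_integrable => //.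
have := integrableZE mD c (integrableDE mD (integrable_sqw i1) (integrable_sqw i2)).
apply: le_integrableE => //; first exact: measurable_sqw.
move=> t Dt; rewrite ger0_norm ?sqw_ge0// -mulrDl mulrA.
by rewrite ler_wpM2r ?gh// ww_ge0.
Qed.

Lemma L2_0 : L2W (fun=> 0).
Proof.
split; first exact: cmeasurable_cst.
by rewrite /sqnorm; under eq_integral do rewrite sqmod0 mul0r; rewrite integral0 ltry.
Qed.

Lemma L2_D g h : L2W g -> L2W h -> L2W (fun t => g t + h t).
Proof.
move=> Lg Lh; apply: (le_L2 (c := 2) _ Lg Lh).
  by apply: cmeasurableD; [exact: Lg.1|exact: Lh.1].
by move=> t _; rewrite mulrDr ler_sqmodD.
Qed.

Lemma L2_Z c g : L2W g -> L2W (fun t => c * g t).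
Proof.
move=> Lg; apply: (le_L2 (c := sqmod c) _ Lg L2_0).
  by apply: cmeasurableM; [exact: cmeasurable_cst|exact: Lg.1].
by move=> t _; rewrite sqmodM sqmod0 addr0.
Qed.

Lemma L2_B g h : L2W g -> L2W h -> L2W (fun t => g t - h t).
Proof.
move=> Lg Lh; apply: (le_L2 (c := 2) _ Lg Lh).
  by apply: cmeasurableB; [exact: Lg.1|exact: Lh.1].
by move=> t _; rewrite mulrDr -(sqmodN (h t)) ler_sqmodD.
Qed.

Lemma sqnB g h : sqn (fun t => g t - h t) = sqn (fun t => h t - g t).
Proof. by apply: eq_integral => t _; rewrite -sqmodN opprB. Qed.

Definition L2pred : {pred (T -> R[i])} := fun g => `[< L2W g >].

Lemma L2predP g : reflect (L2W g) (g \in L2pred).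
Proof. exact: asboolP. Qed.

Lemma L2pred_submod : submod_closed L2pred.
Proof.
split; first by apply/L2predP; exact: L2_0.
move=> c g h /L2predP Lg /L2predP Lh; apply/L2predP.
by apply: L2_D => //; exact: L2_Z.
Qed.

HB.instance Definition _ := GRing.isSubmodClosed.Build _ _ L2pred L2pred_submod.

Record L2t := L2T { L2f :> T -> R[i]; _ : L2f \in L2pred }.
HB.instance Definition _ := [isSub for L2f].
HB.instance Definition _ := [Choice of L2t by <:].
HB.instance Definition _ := [SubChoice_isSubLmodule of L2t by <:].

Lemma L2fP (x : L2t) : L2W x.
Proof. by case: x => g pg; apply/L2predP. Qed.

Definition mkL2 g (Lg : L2W g) : L2t := L2T (introT (L2predP g) Lg).

Definition ipw (x y : L2t) : R[i] := cintegral mu D (fun t => x t * (y t)^*%C * (w t)%:C%C).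

Lemma cintegrable_ip g h : L2W g -> L2W h ->
  cintegrable mu D (fun t => g t * (h t)^*%C * (w t)%:C%C).
Proof.
move=> Lg Lh.
have := integrableDE mD (integrable_sqw Lg) (integrable_sqw Lh).
apply: le_cintegrable => //.
- apply: cmeasurableM; last by apply: cmeasurable_real; exact: wmw.
  by apply: cmeasurableM; [exact: Lg.1|apply: cmeasurableJ; exact: Lh.1].
- move=> t Dt; rewrite cReM /= mulr0 subr0 normrM -mulrDl.
  rewrite (ger0_norm (ww_ge0 Dt)) ler_wpM2r ?ww_ge0//.
  by have [] := norm_mulcJ_le (g t) (h t).
- move=> t Dt; rewrite cImM /= mulr0 add0r normrM -mulrDl.
  rewrite (ger0_norm (ww_ge0 Dt)) ler_wpM2r ?ww_ge0//.
  by have [] := norm_mulcJ_le (g t) (h t).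
Qed.

Lemma ipwDl x y z : ipw (x + y) z = ipw x z + ipw y z.
Proof.
rewrite /ipw -cintegralD//; [|exact: (cintegrable_ip (L2fP _) (L2fP _))..].
by congr (cintegral _ _ _); apply/funext => t; rewrite -!mulrDl.
Qed.

Lemma ipwZl c x z : ipw (c *: x) z = c * ipw x z.
Proof.
rewrite /ipw -cintegralZ//; last exact: (cintegrable_ip (L2fP _) (L2fP _)).
by congr (cintegral _ _ _); apply/funext => t; rewrite -!mulrA.
Qed.

Lemma ipwC x y : ipw y x = (ipw x y)^*%C.
Proof.
rewrite /ipw -cintegralJ//; last exact: (cintegrable_ip (L2fP _) (L2fP _)).
congr (cintegral _ _ _); apply/funext => t.
by rewrite !conjcM conjcR conjcK [y t * _]mulrC.
Qed.

Lemma Re_ipw (x : L2t) : complex.Re (ipw x x) = \int[mu]_(t in D) (sqmod (x t) * w t).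
Proof. by apply: eq_Rintegral => t _; rewrite mulcJ cReM /= mulr0 subr0. Qed.

Lemma sqn_ipw (x : L2t) : sqn x = (complex.Re (ipw x x))%:E.
Proof.
rewrite Re_ipw fineK//; apply: integrable_fin_num => //.
exact: (integrable_sqw (L2fP _)).
Qed.

Lemma ipw_ge0 x : 0 <= complex.Re (ipw x x).
Proof. by rewrite -lee_fin -sqn_ipw sqn_ge0. Qed.

(** The rate 8^-k leaves room for a factor 4^k: the series of the 4^k |v_(k+1) - v_k|^2 still has a
    finite integral, and where its terms are bounded the increments are of order 2^-k. *)
Lemma fast_subsequence (u : nat -> T -> R[i]) :
  (forall e : R, 0 < e -> exists n0, forall n m, (n0 <= n)%N -> (n0 <= m)%N ->
    (sqn (fun t => u n t - u m t)%R < e%:E)%E) ->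
  exists p : nat -> nat, (forall k, (k <= p k)%N) /\
    forall k, (sqn (fun t => u (p k.+1) t - u (p k) t)%R < (8^-1 ^+ k)%:E)%E.
Proof.
move=> hu.
have /choice[n0 hn0] (k : nat) : exists n0, forall n m, (n0 <= n)%N -> (n0 <= m)%N ->
    (sqn (fun t => u n t - u m t)%R < (8^-1 ^+ k)%:E)%E.
  by apply: hu; rewrite exprn_gt0// invr_gt0.
(* The maximum runs over all i <= k, so that both [p k] and [p k.+1] reach the threshold belonging
   to [k]; the summand [k] makes [p] unbounded. *)
exists (fun k => (k + \max_(i < k.+1) n0 i)%N); split; first by move=> k; exact: leq_addr.
move=> k; apply: hn0.
  apply: leq_trans (leq_addl _ _); rewrite big_ord_recr/=.
  apply: leq_trans (leq_maxl _ _).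
  by rewrite (bigD1 ord_max)//= leq_maxl.
apply: leq_trans (leq_addl _ _).
by rewrite (bigD1 ord_max)//= leq_maxl.
Qed.

Lemma ae_cvg_fast (v : nat -> T -> R[i]) : (forall n, L2W (v n)) ->
  (forall k, (sqn (fun t => v k.+1 t - v k t)%R <= (8^-1 ^+ k)%:E)%E) ->
  {ae mu, forall t, D t -> 0 < w t ->
    cvgn (fun k => complex.Re (v k t)) /\ cvgn (fun k => complex.Im (v k t))}.
Proof.
move=> Lv hv.
(* sum_k F k is integrable, and wherever it is finite the increments of v are
   dominated by a geometric sequence *)
pose F k t := ((4 ^+ k * (sqmod (v k.+1 t - v k t) * w t))%:E : \bar R).
have Fm k : measurable_fun D (F k).
  apply/measurable_EFinP; apply: measurable_funM; first exact: measurable_cst.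
  by apply: measurable_sqw; apply: cmeasurableB; [exact: (Lv _).1|exact: (Lv _).1].
have p4 k : 0 < (4 : R) ^+ k by rewrite exprn_gt0.
have F0 k t : D t -> (0 <= F k t)%E.
  by move=> Dt; rewrite lee_fin mulr_ge0 ?(ltW (p4 _))// (sqw_ge0 (fun t => v k.+1 t - v k t)).
have FI k : (\int[mu]_(t in D) F k t <= (2^-1 ^+ k)%:E)%E.
  rewrite /F; under eq_integral do rewrite EFinM.
  rewrite integralZl//; last exact: (integrable_sqw (L2_B (Lv _) (Lv _))).
  apply: (@le_trans _ _ ((4 ^+ k)%:E * (8^-1 ^+ k)%:E)%E).
    by rewrite lee_pmul2l ?hv// ?lte_fin.
  by rewrite -EFinM -exprMn lee_fin lerXn2r ?nnegrE//; lra.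
have SI : (\int[mu]_(t in D) (\sum_(k <oo) F k t) < +oo)%E.
  rewrite integral_nneseries//.
  apply: (@le_lt_trans _ _ (\sum_(k <oo) (2^-1 ^+ k)%:E)%E).
    apply: lee_nneseries => [k _ _|k _]; last exact: FI.
    by apply: integral_ge0 => t Dt; exact: F0.
  have h2 : `|2^-1 : R| < 1 by rewrite ger0_norm// invf_lt1// ltr1n.
  rewrite (_ : (\sum_(k <oo) (2^-1 ^+ k)%:E)%E = (1 / (1 - 2^-1) : R)%:E) ?ltry//.
  apply: cvg_lim => //.
  rewrite (_ : (fun n => _) = EFin \o series (geometric 1 2^-1)); last first.
    apply/funext => n /=; rewrite seriesEnat /= sumEFin; congr EFin.
    by apply: eq_bigr => i _; rewrite /geometric/= mul1r.
  by apply: cvg_EFin; [exact: nearW|exact: cvg_geometric_series].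
have mS : measurable_fun D (fun t => \sum_(k <oo) F k t)%E.
  by apply: ge0_emeasurable_sum => // k t Dt _; exact: F0.
have iS : mu.-integrable D (fun t => \sum_(k <oo) F k t)%E.
  apply/integrableP; split=> //.
  rewrite (eq_integral (fun t => \sum_(k <oo) F k t)%E)// => t /set_mem Dt.
  by rewrite gee0_abs// nneseries_ge0// => k _ _; exact: F0.
apply: filterS (integrable_ae mD iS) => t /(_ _) + Dt wt => /(_ Dt) fS.
have hF k : 4 ^+ k * sqmod (v k.+1 t - v k t) <= fine (\sum_(k <oo) F k t)%E / w t.
  rewrite ler_pdivlMr// -mulrA -lee_fin fineK//.
  apply: le_trans (nneseries_lim_ge k.+1 _) => [|j _]; last by move=> *; exact: F0.
  by rewrite big_nat_recr//= leeDr// sume_ge0// => j _; exact: F0.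
split; apply: (@cvg_of_fast_increments _ _ (fine (\sum_(k <oo) F k t)%E / w t)) => k.
  apply: le_trans (hF k); rewrite ler_wpM2l ?(ltW (p4 _))//.
  by rewrite sqmodE cReD cReN lerDl sqr_ge0.
apply: le_trans (hF k); rewrite ler_wpM2l ?(ltW (p4 _))//.
by rewrite sqmodE cImD cImN lerDr sqr_ge0.
Qed.

Lemma L2_complete (u : nat -> T -> R[i]) : (forall n, L2W (u n)) ->
  (forall e : R, 0 < e -> exists n0, forall n m, (n0 <= n)%N -> (n0 <= m)%N ->
    (sqn (fun t => u n t - u m t)%R < e%:E)%E) ->
  exists2 g, L2W g & forall e : R, 0 < e -> exists n0, forall n, (n0 <= n)%N ->
    (sqn (fun t => u n t - g t)%R < e%:E)%E.
Proof.
move=> Lu hu; have [p [kp hp]] := fast_subsequence hu.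
pose v k := u (p k).
have Lv k : L2W (v k) by exact: Lu.
have cv : {ae mu, forall t, D t -> 0 < w t ->
    cvgn (fun k => complex.Re (v k t)) /\ cvgn (fun k => complex.Im (v k t))}.
  by apply: ae_cvg_fast => // k; exact/ltW/hp.
(* an upper limit is measurable whether or not the sequence converges *)
pose g t := (fine (limn_esup (fun k => (complex.Re (v k t))%:E)) +i*
             fine (limn_esup (fun k => (complex.Im (v k t))%:E)))%C.
have mg : cmeasurable D g.
  split=> /=; apply: measurableT_comp => //; apply: measurable_fun_limn_esup => k;
    apply/measurable_EFinP; [exact: (Lv k).1.1|exact: (Lv k).1.2].
have lim_fine (a : nat -> R) : cvgn a -> fine (limn_esup (EFin \o a)) = limn a.
  move=> ca; have /cvg_limn_einf_sup[_ ->] : (EFin \o a) k @[k --> \oo] --> (limn a)%:E.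
    by apply: cvg_EFin => //; exact: nearW.
  by [].
(* Fatou's lemma along the subsequence: a bound on [v k - u n] valid for all large k passes to
   [g - u n]. *)
have key n (e : R) n0 : (forall k, (n0 <= k)%N -> (sqn (fun t => v k t - u n t)%R <= e%:E)%E) ->
    (sqn (fun t => g t - u n t)%R <= e%:E)%E.
  move=> hk; pose f k t := (sqmod (v k t - u n t) * w t)%:E.
  have mf k : measurable_fun D (f k).
    by apply/measurable_EFinP/measurable_sqw/cmeasurableB; [exact: (Lv _).1|exact: (Lu _).1].
  have f0 k t : D t -> (0 <= f k t)%E.
    by move=> Dt; rewrite lee_fin (sqw_ge0 (fun t => v k t - u n t)).
  apply: (@le_trans _ _ (\int[mu]_(t in D) limn_einf (f^~ t))%E).
    apply: ae_ge0_le_integral => //.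
    - by move=> t Dt; rewrite lee_fin (sqw_ge0 (fun t => g t - u n t)).
    - by apply/measurable_EFinP/measurable_sqw/cmeasurableB => //; exact: (Lu _).1.
    - move=> t Dt; rewrite limn_einf_lim; apply: lime_ge; first exact: is_cvg_einfs.
      by apply: nearW => k; apply: le_ereal_inf_tmp => _ [j _ <-]; exact: f0.
    - rewrite (_ : (fun t => _) = (fun t => - limn_esup (fun k => - f k t))%E) //.
      apply: measurableT_comp => //; apply: measurable_fun_limn_esup => k.
      exact: measurableT_comp.
    apply: filterS cv => t + Dt => /(_ Dt) cvt.
    (* Where the weight vanishes the sequence [v] may diverge, but there the left side is 0. *)
    have [w0|wt] := eqVneq (w t) 0.
      rewrite w0 mulr0 limn_einf_lim; apply: lime_ge; first exact: is_cvg_einfs.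
      by apply: nearW => k; apply: le_ereal_inf_tmp => _ [j _ <-]; exact: f0.
    have [|cR cI] := cvt; first by rewrite lt_def wt ww_ge0.
    have : (f^~ t) k @[k --> \oo] --> (sqmod (g t - u n t) * w t)%:E.
      apply: cvg_EFin; first exact: nearW.
      suff h1 : sqmod (v k t - u n t) @[k --> \oo] --> sqmod (g t - u n t).
        exact: (cvgM h1 (cvg_cst _)).
      rewrite (_ : (fun k => _) = (fun k => (complex.Re (v k t) - complex.Re (u n t)) ^+ 2 +
         (complex.Im (v k t) - complex.Im (u n t)) ^+ 2)); last first.
        by apply/funext => k; rewrite sqmodE !(cReD, cImD, cReN, cImN).
      rewrite sqmodE !(cReD, cImD, cReN, cImN) /=.
      rewrite (lim_fine _ cR) (lim_fine _ cI).
      have sq (a : nat -> R) (l : R) : a k @[k --> \oo] --> l -> a k ^+ 2 @[k --> \oo] --> l ^+ 2.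
        by move=> h; exact: (cvgM h h).
      by apply: cvgD; apply: sq; apply: cvgB => //; exact: cvg_cst.
    by move/cvg_limn_einf_sup => [-> _].
  apply: le_trans (fatou _ _ _ _) _ => //.
  exact: einf_le_near hk.
have small (e : R) : 0 < e -> exists n0, forall n, (n0 <= n)%N ->
    (sqn (fun t => u n t - g t)%R < e%:E)%E.
  move=> e0; have [n0 hn0] := hu (e / 2) ltac:(lra).
  exists n0 => n hn; rewrite sqnB.
  apply: (@le_lt_trans _ _ (e / 2)%:E); last by rewrite lte_fin; lra.
  apply: (key n _ n0) => k hk; apply/ltW/hn0 => //.
  exact: leq_trans hk (kp k).
exists g => //.
have [n0 /(_ n0 (leqnn _)) h] := small 1 ltac:(lra).
(* Square integrability of [g] follows by writing it as [u n0] minus this function. *)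
have Lug : L2W (fun t => u n0 t - g t).
  split; first by apply: cmeasurableB => //; exact: (Lu _).1.
  exact: lt_trans h (ltry _).
rewrite (_ : g = (fun t => u n0 t - (u n0 t - g t))).
  by apply: L2_B.
by apply/funext => t; rewrite opprB addrC subrK.
Qed.

Lemma ipw_complete (u : nat -> L2t) :
    (forall e : R, 0 < e -> exists n0, forall n m, (n0 <= n)%N -> (n0 <= m)%N ->
      complex.Re (ipw (u n - u m) (u n - u m)) < e) ->
    exists x, forall e : R, 0 < e -> exists n0, forall n, (n0 <= n)%N ->
      complex.Re (ipw (u n - x) (u n - x)) < e.
Proof.
move=> hu; have [|e e0|g Lg hg] := @L2_complete (fun n => u n : T -> R[i]).
- by move=> n; exact: L2fP.
- have [n0 h] := hu e e0; exists n0 => n m hn hm.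
  by have := h n m hn hm; rewrite -lte_fin -sqn_ipw.
exists (mkL2 Lg) => e e0; have [n0 h] := hg e e0; exists n0 => n hn.
by have := h n hn; rewrite -lte_fin -sqn_ipw.
Qed.

Definition L2_hilbert : hilbert R :=
  @Hilbert R L2t ipw ipwDl ipwZl ipwC ipw_ge0 ipw_complete.

Lemma sqn_N2 (x : L2_hilbert) : sqn (x : L2t) = (N2 x)%:E.
Proof. exact: sqn_ipw. Qed.

Lemma L2t_sumE (I : Type) (s : seq I) (F : I -> L2t) t :
  (\sum_(i <- s) F i) t = \sum_(i <- s) F i t.
Proof.
elim: s => [|i s IH]; first by rewrite !big_nil.
by rewrite !big_cons -IH.
Qed.

Lemma closed_spanP (K : set int) (e : int -> L2_hilbert) (x : L2_hilbert) :
  closed_span mu D w K (fun k => (e k : L2t) : T -> R[i]) (x : L2t) <-> cspan K e x.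
Proof.
have E s (c : int -> R[i]) :
    (fun t => (x : L2t) t - \sum_(k <- s) c k * (e k : L2t) t) =
    ((x - \sum_(k <- s) c k *: e k : L2_hilbert) : L2t).
  apply/funext => t.
  transitivity ((x : L2t) t - (\sum_(k <- s) (c k *: (e k : L2t))) t) => //.
  by rewrite L2t_sumE.
split=> [[_ h] d /h[_ [[s [c [ks ->]]]]]|h].
  by rewrite E sqn_N2 lte_fin => hN; exists s, c.
split=> [|d /h[s [c [ks hN]]]]; first exact: L2fP.
exists (fun t => \sum_(k <- s) c k * (e k : L2t) t); split; first by exists s, c.
by rewrite E sqn_N2 lte_fin.
Qed.

Lemma L2_sumP (u : nat -> L2_hilbert) (x : L2_hilbert) :
  L2_sum mu D w (fun k => (u k : L2t) : T -> R[i]) (x : L2t) <->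
  cvgH (fun n => \sum_(k < n) u k) x.
Proof.
have E n : (fun t => (x : L2t) t - \sum_(k < n) (u k : L2t) t) =
    ((x - \sum_(k < n) u k : L2_hilbert) : L2t).
  apply/funext => t.
  transitivity ((x : L2t) t - (\sum_(k < n) (u k : L2t)) t) => //.
  by rewrite L2t_sumE.
split=> [[_ h] d d0|h].
  have /fine_cvgP[_ /(@cvgrPdist_lt _ R^o)/(_ d d0)[n0 _ h0]] := h.
  exists n0 => n /h0 /=; rewrite E sqn_N2 /= sub0r normrN ger0_norm ?N2_ge0//.
  by rewrite N2C.
split; first exact: L2fP.
rewrite (_ : (fun n => _) = EFin \o (fun n => N2 (x - \sum_(k < n) u k))); last first.
  by apply/funext => n; rewrite E sqn_N2.
apply: cvg_EFin; first exact: nearW.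
apply/(@cvgrPdist_lt _ R^o) => d /h[n0 h0]; exists n0 => // n /h0 /=.
by rewrite sub0r normrN ger0_norm ?N2_ge0// N2C.
Qed.

End WeightedL2.

(** * Uniqueness of Fourier coefficients *)

Section Exponentials.
Context (R : realType).
Implicit Types (t : R).

Lemma expiE (k : int) t : @expi R k t = (cos (k%:~R * t) +i* sin (k%:~R * t))%C.
Proof. by []. Qed.

Lemma expi0 t : @expi R 0 t = 1.
Proof. by rewrite expiE mul0r cos0 sin0. Qed.

Lemma expiD (j k : int) t : @expi R (j + k) t = expi j t * expi k t.
Proof.
rewrite !expiE intrD mulrDl cosD sinD; apply: complex_eq; first by rewrite cReM.
by rewrite cImM /=; ring.
Qed.

Lemma expiN (k : int) t : @expi R (- k) t = (expi k t)^*%C.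
Proof. by rewrite !expiE intrN mulNr cosN sinN. Qed.

Lemma sqmod_expi (k : int) t : sqmod (@expi R k t) = 1.
Proof. by rewrite sqmodE /= cos2Dsin2. Qed.

Lemma expiX (n : nat) t : @expi R n%:Z t = expi 1 t ^+ n.
Proof.
elim: n => [|n IH]; first by rewrite expi0 expr0.
by rewrite exprSr -IH -expiD -PoszD addn1.
Qed.

Lemma measurable_circle : measurable (@circle R).
Proof. exact: measurable_itv. Qed.

Lemma leb_circle : leb R (@circle R) = (2 * pi)%:E.
Proof.
rewrite /leb/= lebesgue_measure_itv/= lte_fin gtrN ?pi_gt0//.
by rewrite -EFinB opprK mulrDl !mul1r.
Qed.

Lemma leb_circle_lty : (leb R (@circle R) < +oo)%E.
Proof. by rewrite leb_circle ltry. Qed.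

Lemma continuous_measurableT (f : R -> R) (D : set R) :
  continuous f -> measurable_fun D f.
Proof. by move=> cf; apply: measurable_funTS; exact: continuous_measurable_fun. Qed.

Lemma cmeasurable_expi (k : int) (D : set (measurableTypeR R)) : cmeasurable D (@expi R k).
Proof.
have ck : continuous (fun t : R => k%:~R * t) by move=> t; exact: mulrl_continuous.
split => /=; apply: continuous_measurableT => t.
  by apply: continuous_comp; [exact: ck|exact: continuous_cos].
by apply: continuous_comp; [exact: ck|exact: continuous_sin].
Qed.

Lemma integrable_bounded_circle (v : R -> R) (M : R) : measurable_fun (@circle R) v ->
  (forall t, circle t -> `|v t| <= M) -> (leb R).-integrable (@circle R) (fun t => (v t)%:E).
Proof.
move=> mv hv; apply: (le_integrableE measurable_circle (u := cst M)) => //.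
apply/integrableP; split; first by apply/measurable_EFinP; exact: measurable_cst.
rewrite (eq_integral (cst `|M|%:E))// integral_cst//; last exact: measurable_circle.
by apply: lte_mul_pinfty => //; exact: leb_circle_lty.
Qed.

Lemma norm_Re_le (z : R[i]) (M : R) : 0 <= M -> sqmod z <= M ^+ 2 ->
  `|complex.Re z| <= M /\ `|complex.Im z| <= M.
Proof.
move=> M0; rewrite sqmodE => h; split; rewrite -(ger0_norm M0) -ler_sqr ?nnegrE//.
  by rewrite !real_normK ?num_real//; apply: le_trans h; rewrite lerDl sqr_ge0.
by rewrite !real_normK ?num_real//; apply: le_trans h; rewrite lerDr sqr_ge0.
Qed.

Lemma cintegrable_bdM (g v : R -> R[i]) (M : R) :
  cintegrable (leb R) (@circle R) g ->
  cmeasurable (@circle R) v -> (forall t, circle t -> sqmod (v t) <= M ^+ 2) ->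
  cintegrable (leb R) (@circle R) (fun t => g t * v t).
Proof.
move=> [g1 g2] mv hv.
have mD := measurable_circle.
have i1 : (leb R).-integrable (@circle R) (fun t =>
    (`|M| * (`|complex.Re (g t)| + `|complex.Im (g t)|))%:E).
  by apply: integrableZE => //; apply: integrableDE => //;
    [exact: (integrable_norm g1)|exact: (integrable_norm g2)].
apply: (le_cintegrable mD _ _ _ i1).
  by apply: cmeasurableM => //; apply: cintegrable_meas; split; [exact: g1|exact: g2].
- move=> t Dt; have [|h1 h2] := @norm_Re_le (v t) `|M| (normr_ge0 _).
    by rewrite real_normK ?num_real// hv.
  rewrite cReM mulrDr; apply: le_trans (ler_normB _ _) _; rewrite !normrM.
  by apply: lerD; rewrite mulrC ler_wpM2r.
- move=> t Dt; have [|h1 h2] := @norm_Re_le (v t) `|M| (normr_ge0 _).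
    by rewrite real_normK ?num_real// hv.
  rewrite cImM mulrDr; apply: le_trans (ler_normD _ _) _; rewrite !normrM.
  by apply: lerD; rewrite mulrC ler_wpM2r.
Qed.

End Exponentials.

Section FourierUniqueness.
Context (R : realType).
Local Notation mu := (leb R).
Local Notation D := (@circle R).
Variable g : R -> R[i].
Hypothesis ig : cintegrable mu D g.
Hypothesis hg : forall k, cintegral mu D (fun t => g t * @expi R k t) = 0.

(** Bounded multipliers v such that g v still has vanishing Fourier coefficients. They are stable
    under linear combinations and under multiplication by exponentials, hence by any trigonometric
    polynomial. *)
Definition annihilated (v : R -> R[i]) : Prop := [/\ cmeasurable D v,
  exists M, forall t, D t -> sqmod (v t) <= M ^+ 2 &
  forall k, cintegral mu D (fun t => g t * (v t * @expi R k t)) = 0].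

Lemma annihilated_int v (k : int) : annihilated v ->
  cintegrable mu D (fun t => g t * (v t * @expi R k t)).
Proof.
move=> [mv [M hM] _]; apply: (@cintegrable_bdM _ _ _ M) => //.
  by apply: cmeasurableM => //; exact: cmeasurable_expi.
by move=> t Dt; rewrite sqmodM sqmod_expi mulr1 hM.
Qed.

Lemma annihilated1 : annihilated (fun=> 1).
Proof.
split; first exact: cmeasurable_cst.
  by exists 1 => t _; rewrite sqmod_real.
by move=> k; rewrite -[RHS](hg k); apply: eq_cintegral => t _; rewrite mul1r.
Qed.

Lemma annihilatedD v w : annihilated v -> annihilated w -> annihilated (fun t => v t + w t).
Proof.
move=> av aw; have [mv [M hM] hv] := av; have [mw [N hN] hw] := aw; split.
- exact: cmeasurableD.
- exists (2 * (`|M| + `|N|)) => t Dt; apply: le_trans (ler_sqmodD _ _) _.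
  have := hM t Dt; have := hN t Dt; rewrite -(real_normK (num_real M)) -(real_normK (num_real N)).
  by have := normr_ge0 M; have := normr_ge0 N; nra.
- move=> k; rewrite -(addr0 0) -{1}(hv k) -(hw k) -cintegralD; last 3 first.
  + exact: measurable_circle.
  + exact: annihilated_int.
  + exact: annihilated_int.
  by apply: eq_cintegral => t _; rewrite mulrDl mulrDr.
Qed.

Lemma annihilatedZ c v : annihilated v -> annihilated (fun t => c * v t).
Proof.
move=> av; have [mv [M hM] hv] := av; split.
- by apply: cmeasurableM => //; exact: cmeasurable_cst.
- exists ((1 + sqmod c) * M) => t Dt; rewrite sqmodM exprMn.
  apply: ler_pM; rewrite ?sqmod_ge0 ?hM//.
  by have := sqmod_ge0 c; nra.
- move=> k; rewrite -(mulr0 c) -(hv k) -cintegralZ; last 2 first.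
  + exact: measurable_circle.
  + exact: annihilated_int.
  by apply: eq_cintegral => t _; rewrite !mulrA [g t * c]mulrC.
Qed.

Lemma annihilatedM_expi (j : int) v : annihilated v -> annihilated (fun t => v t * @expi R j t).
Proof.
move=> [mv [M hM] hv]; split.
- by apply: cmeasurableM => //; exact: cmeasurable_expi.
- by exists M => t Dt; rewrite sqmodM sqmod_expi mulr1 hM.
- move=> k; rewrite -(hv (j + k)); apply: eq_cintegral => t _.
  by rewrite expiD !mulrA.
Qed.

Lemma annihilated_trig (a b c : R[i]) n m v : annihilated v ->
  let p t := a + b * @expi R 1 t + c * @expi R (-1) t in
  annihilated (fun t => v t * (1 - p t ^+ n) ^+ m).
Proof.
move=> av p.
have eqa u w : (forall t, u t = w t) -> annihilated u -> annihilated w.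
  by move=> /funext ->.
have mulp u : annihilated u -> annihilated (fun t => u t * p t).
  move=> au; apply: (eqa (fun t => (a * u t + b * (u t * @expi R 1 t)) + c * (u t * @expi R (-1) t))).
    by move=> t; rewrite /p; ring.
  by apply: annihilatedD; [apply: annihilatedD|]; apply: annihilatedZ => //;
    exact: annihilatedM_expi.
have mulX u k : annihilated u -> annihilated (fun t => u t * p t ^+ k).
  elim: k u => [|k IH] u au; first by apply: eqa au => t; rewrite mulr1.
  apply: (eqa (fun t => (u t * p t ^+ k) * p t)); first by move=> t; rewrite exprSr mulrA.
  by apply: mulp; exact: IH.
elim: m => [|m IH]; first by apply: eqa av => t; rewrite mulr1.
pose u t := v t * (1 - p t ^+ n) ^+ m.
apply: (eqa (fun t => u t + (-1) * (u t * p t ^+ n))).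
  by move=> t; rewrite /u exprSr; ring.
by apply: annihilatedD => //; apply: annihilatedZ; exact: mulX.
Qed.

End FourierUniqueness.

(** The polynomials of the Brosowski-Deutsch proof of the Stone-Weierstrass theorem. On [0, 1] the
    size of 2^n y^n = (2 y)^n decides: they tend to 1 for y < 1/2 and to 0 for y > 1/2. *)
Definition step_poly (R : realType) (y : R) (n : nat) : R := (1 - y ^+ n) ^+ (2 ^ n).

Lemma bernoulli_le (R : realType) (x : R) n : -1 <= x -> 1 + n%:R * x <= (1 + x) ^+ n.
Proof.
move=> hx; elim: n => [|n IH]; first by rewrite mul0r addr0.
rewrite exprSr; apply: (@le_trans _ _ ((1 + n%:R * x) * (1 + x))).
  rewrite -natr1; have := mulr_ge0 (ler0n R n) (sqr_ge0 x); nra.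
by apply: ler_wpM2r => //; lra.
Qed.

Lemma step_poly_bound (R : realType) (y : R) n : 0 <= y <= 1 -> 0 <= step_poly y n <= 1.
Proof.
move=> /andP[y0 y1]; have h := exprn_ile1 n y0 y1; have h0 := exprn_ge0 n y0.
by rewrite /step_poly exprn_ge0 ?exprn_ile1//; lra.
Qed.

Lemma step_poly_cvg1 (R : realType) (y : R) : 0 <= y < 2^-1 ->
  step_poly y n @[n --> \oo] --> (1 : R).
Proof.
move=> /andP[y0 y1].
have y01 : 0 <= y <= 1 by apply/andP; split; lra.
apply: (@squeeze_cvgr _ _ _ _ (fun n => 1 - (2 * y) ^+ n) (fun=> 1)); last exact: cvg_cst.
  apply: nearW => n; have /andP[_ ->] := step_poly_bound n y01; rewrite andbT.
  apply: le_trans (bernoulli_le _ _); last by have := exprn_ile1 n y0 ltac:(lra); lra.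
  by rewrite exprMn natrX mulrN.
rewrite -[X in _ --> X]subr0; apply: cvgB; first exact: cvg_cst.
by apply: cvg_expr; rewrite ger0_norm; lra.
Qed.

Lemma step_poly_cvg0 (R : realType) (y : R) : 2^-1 < y <= 1 ->
  step_poly y n @[n --> \oo] --> (0 : R).
Proof.
move=> /andP[y0 y1].
have y01 : 0 <= y <= 1 by apply/andP; split; lra.
apply: (@squeeze_cvgr _ _ _ _ (fun=> 0) (fun n => (2 * y)^-1 ^+ n)); first last.
- by apply: cvg_expr; rewrite ger0_norm ?invr_ge0 ?invf_lt1; lra.
- exact: cvg_cst.
apply: nearW => n; have /andP[-> _] := step_poly_bound n y01.
have yn0 : 0 <= y ^+ n by rewrite exprn_ge0//; lra.
have yn1 : y ^+ n <= 1 by rewrite exprn_ile1//; lra.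
have p : 0 < (2 * y) ^+ n by rewrite exprn_gt0//; lra.
rewrite exprVn -[leRHS]div1r ler_pdivlMr//.
(* The product (1 - y^n)^(2^n) (1 + y^n)^(2^n) = (1 - y^(2n))^(2^n) is at most 1, and Bernoulli's
   inequality bounds its second factor below by (2 y)^n. *)
have h1 : (2 * y) ^+ n <= (1 + y ^+ n) ^+ (2 ^ n).
  apply: le_trans (bernoulli_le _ _); last by lra.
  by rewrite exprMn natrX lerDr.
apply: (@le_trans _ _ (step_poly y n * (1 + y ^+ n) ^+ (2 ^ n))).
  by rewrite ler_wpM2l//; have /andP[] := step_poly_bound n y01.
rewrite /step_poly -exprMn exprn_ile1//; nra.
Qed.

(** * Indicators of arcs as limits of trigonometric polynomials *)

Section FourierUniqueness2.
Context (R : realType).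
Local Notation mu := (leb R).
Local Notation D := (@circle R).

(* This function is positive on (-pi, x) and negative on (x, pi); being a
   trigonometric polynomial, it detects the arc (-pi, x). *)
Definition arc_sign (x t : R) : R := cos (t / 2) * sin ((x - t) / 2).

(** Moves the values into [0, 1] and the sign change at t = x to the threshold 1/2 of
    [step_poly]. *)
Definition arc_arg (x t : R) : R := (1 - arc_sign x t) / 2.

(** The half angles in t disappear: cos (t/2) sin ((x - t)/2) = (sin (x/2) + sin (x/2 - t)) / 2, a
    trigonometric polynomial of degree one. *)
Lemma arc_argE (x t : R) : (arc_arg x t)%:C%C =
  (2^-1 - sin (x / 2) / 4)%:C%C + (- (sin (x / 2) / 8) +i* (- (cos (x / 2) / 8)))%C * @expi R 1 t
  + (- (sin (x / 2) / 8) +i* (cos (x / 2) / 8))%C * @expi R (-1) t.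
Proof.
have E : arc_sign x t = (sin (x / 2) + (sin (x / 2) * cos t - cos (x / 2) * sin t)) / 2.
  have ct : cos t = cos (t / 2) ^+ 2 - sin (t / 2) ^+ 2.
    by rewrite {1}(splitr t) cosD -!expr2.
  have st : sin t = 2 * (sin (t / 2) * cos (t / 2)).
    by rewrite {1}(splitr t) sinD [cos _ * _]mulrC; ring.
  rewrite ct st /arc_sign (_ : (x - t) / 2 = x / 2 - t / 2); last by rewrite mulrBl.
  rewrite sinB; have := cos2Dsin2 (t / 2).
  move: (cos (t / 2)) (sin (t / 2)) (cos (x / 2)) (sin (x / 2)) => c s c' s' h.
  have -> : s' + (s' * (c ^+ 2 - s ^+ 2) - c' * (2 * (s * c))) =
     s' * (c ^+ 2 + s ^+ 2) + (s' * (c ^+ 2 - s ^+ 2) - c' * (2 * (s * c))) by rewrite h mulr1.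
  by field.
rewrite expiN !expiE !mul1r; apply: complex_eq.
  by rewrite !cReD !cReM /= /arc_arg E; field.
by rewrite !cImD !cImM /=; field.
Qed.

Lemma arc_arg_bound (x t : R) : 0 <= arc_arg x t <= 1.
Proof.
rewrite /arc_arg; have : `|arc_sign x t| <= 1.
  rewrite normrM mulr_ile1//; rewrite ler_norml.
    by rewrite cos_geN1 cos_le1.
  by rewrite sin_geN1 sin_le1.
by rewrite ler_norml => /andP[h1 h2]; apply/andP; split; lra.
Qed.

Lemma arc_arg_lt (x t : R) : - pi < t < pi -> - pi < x < pi -> t < x -> arc_arg x t < 2^-1.
Proof.
move=> /andP[t1 t2] /andP[x1 x2] tx.
have : 0 < arc_sign x t.
  rewrite /arc_sign mulr_gt0//; first by apply: cos_gt0_pihalf; apply/andP; split; lra.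
  by apply: sin_gt0_pi; apply/andP; split; lra.
by rewrite /arc_arg; lra.
Qed.

Lemma arc_arg_gt (x t : R) : - pi < t < pi -> - pi < x < pi -> x < t -> 2^-1 < arc_arg x t.
Proof.
move=> /andP[t1 t2] /andP[x1 x2] tx.
have : arc_sign x t < 0.
  rewrite /arc_sign pmulr_rlt0; last by apply: cos_gt0_pihalf; apply/andP; split; lra.
  rewrite -oppr_gt0 -sinN -mulNr opprB.
  by apply: sin_gt0_pi; apply/andP; split; lra.
by rewrite /arc_arg; lra.
Qed.

Lemma ae_neq (c : R) : {ae mu, forall t, t != c}.
Proof.
exists [set c]; split; first exact: measurable_set1.
  exact: lebesgue_measure_set1.
by move=> t /= /negP; rewrite negbK => /eqP.
Qed.

Lemma measurable_arc_arg x : measurable_fun D (arc_arg x).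
Proof.
apply: continuous_measurableT => t; apply: cvgM; last exact: cvg_cst.
apply: cvgB; first exact: cvg_cst.
apply: cvgM.
  by apply: continuous_comp; [exact: mulrr_continuous|exact: continuous_cos].
apply: (@continuous_comp _ _ _ (fun t => (x - t) / 2) sin); last exact: continuous_sin.
apply: cvgM; last exact: cvg_cst.
by apply: cvgB; [exact: cvg_cst|exact: cvg_id].
Qed.

Lemma measurable_step x n : measurable_fun D (fun t => step_poly (arc_arg x t) n).
Proof.
rewrite /step_poly.
apply: measurable_funX; apply: measurable_funB; first exact: measurable_cst.
by apply: measurable_funX; exact: measurable_arc_arg.
Qed.

Lemma arc_integral0 (G : R -> R) (x : R) : - pi < x < pi ->
  mu.-integrable D (fun t => (G t)%:E) ->
  (forall n, \int[mu]_(t in D) (G t * step_poly (arc_arg x t) n) = 0) ->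
  \int[mu]_(t in D) (G t * ((t : R) <= x)%R%:R) = 0.
Proof.
move=> hx iG h0.
pose f_ n (t : R) := (G t * step_poly (arc_arg x t) n)%:E.
pose f (t : R) := (G t * (t <= x)%R%:R)%:E.
have mG := integrable_meas iG.
have [| | | | |_ _] := @dominated_convergence _ _ _ mu D (@measurable_circle R) f_ f
  (fun t => `|G t|%:E).
- move=> n; apply/measurable_EFinP/measurable_funM => //; exact: measurable_step.
- apply/measurable_EFinP/measurable_funM => //.
  apply: measurable_funTS; rewrite (_ : (fun t => _) = \1_(`]-oo, x])); last first.
    by apply/funext => t; rewrite indicE mem_setE in_itv.
  exact: measurable_indic.
(* At t = x and t = - pi, pi the argument is 1/2, where (1 - 2^-n)^(2^n) tends to 1/e; these three
   points are negligible. *)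
- apply: (filterS3 (ae_filter_ringOfSetsType mu)) (ae_neq (- pi)) (ae_neq x) (ae_neq pi) => t n1 n2 n3.
  rewrite /circle/= in_itv/= => /andP[t1 t2].
  have ht : - pi < t < pi by rewrite !lt_def n1 t1 eq_sym n3 t2.
  apply: cvg_EFin; first exact: nearW.
  have [tx|xt] := leP t x.
    have tx' : t < x by rewrite lt_neqAle n2.
    apply: (cvgM (cvg_cst _)); apply: step_poly_cvg1.
    by have /andP[-> _] := arc_arg_bound x t; rewrite arc_arg_lt.
  apply: (cvgM (cvg_cst _)); apply: step_poly_cvg0.
  by have /andP[_ ->] := arc_arg_bound x t; rewrite arc_arg_gt.
- exact: (integrable_norm iG).
- apply: nearW => t n Dt; rewrite lee_fin normrM ler_piMr//.
  have /andP[a b] := step_poly_bound n (arc_arg_bound x t).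
  by rewrite ger0_norm.
rewrite [X in X @ _ --> _](_ : _ = cst 0%E); last first.
  apply/funext => n /=; rewrite -(fineK (x := integral _ _ _)).
    by congr EFin; exact: h0.
  apply: integrable_fin_num; first exact: measurable_circle.
  have : mu.-integrable D (fun t => `|G t|%:E) by exact: (integrable_norm iG).
  apply: le_integrableE; first exact: measurable_circle.
    by apply: measurable_funM => //; exact: measurable_step.
  move=> t Dt; rewrite normrM ler_piMr//.
  have /andP[a b] := step_poly_bound n (arc_arg_bound x t).
  by rewrite ger0_norm.
move=> h; have E : (\int[mu]_(t in D) f t)%E = 0%E.
  by apply: (cvg_unique (@ereal_hausdorff R) h); exact: cvg_cst.
by rewrite /Rintegral -[RHS]/(fine 0%E) -E.
Qed.

(** By Lebesgue's differentiation theorem [G] is almost everywhere the derivative of its primitive,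
    and the hypothesis says that this primitive vanishes on the open interval. *)
Lemma ae_zero_of_arc_integrals (G : R -> R) : mu.-integrable D (fun t => (G t)%:E) ->
  (forall x, - pi < x < pi -> \int[mu]_(t in D) (G t * ((t : R) <= x)%R%:R) = 0) ->
  {ae mu, forall t, D t -> G t = 0}.
Proof.
move=> iG h0.
have iGT : mu.-integrable setT (EFin \o (G \_ D)).
  rewrite (_ : EFin \o _ = (EFin \o G) \_ D); last by rewrite restrict_EFin.
  exact/(integrable_mkcond _ (@measurable_circle R)).
have i1 y : mu.-integrable [set` Interval (BLeft (- pi)) (BRight y)] (EFin \o (G \_ D)).
  by apply: integrableS iGT.
have l1 : locally_integrable [set: R] (G \_ D) by apply: integrable_locally; [exact: measurable_circle|exact: iG].
have := FTC1 i1 l1; set F := (fun x => _) => hF.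
have F0 x : - pi < x < pi -> F x = 0.
  move=> hx; rewrite -(h0 x hx) /F Rintegral_mkcond [RHS]Rintegral_mkcond.
  apply: eq_Rintegral => t _; rewrite !patchE !mem_setE !in_itv/=.
  by case: (leP (- pi) t) => //= _; case: (leP t x) => //= tx; case: (leP t pi); rewrite ?mulr1 ?mulr0.
apply: (filterS3 (ae_filter_ringOfSetsType mu)) (ae_neq (- pi)) (ae_neq pi) hF => t n1 n2 + Dt.
move: (Dt); rewrite /circle/= in_itv/= => /andP[t1 t2].
have ht : - pi < t < pi by rewrite !lt_def n1 t1 eq_sym n2 t2.
have lt1 : ((- pi)%:E < t%:E)%E by rewrite lte_fin; case/andP: ht.
move=> /(_ lt1)[_].
rewrite patchE mem_set// => <-.
rewrite derive1E; transitivity ('D_1 (cst 0 : R -> R) t); last by rewrite derive_cst.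
apply: near_eq_derive.
have : \forall y \near t, y \in `]- pi, pi[ by apply: near_in_itvoo; rewrite in_itv.
by apply: filterS => y; rewrite in_itv/= => /F0 ->.
Qed.

Theorem fourier_unique (g : R -> R[i]) : cintegrable mu D g ->
  (forall k, cintegral mu D (fun t => g t * @expi R k t) = 0) ->
  {ae mu, forall t, D t -> g t = 0}.
Proof.
move=> ig hg.
have key x n : cintegral mu D (fun t => g t * (step_poly (arc_arg x t) n)%:C%C) = 0.
  have [_ _ /(_ 0) <-] := annihilated_trig ig (2^-1 - sin (x / 2) / 4)%:C%C
    (- (sin (x / 2) / 8) +i* (- (cos (x / 2) / 8)))%C (- (sin (x / 2) / 8) +i* (cos (x / 2) / 8))%C
    n (2 ^ n) (annihilated1 hg).
  apply: eq_cintegral => t _; rewrite -arc_argE expi0 mul1r mulr1.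
  by rewrite /step_poly !(rmorphXn, rmorphB, rmorph1).
have [g1 g2] := ig.
(* The multipliers are real, so the real and the imaginary part of [g] can be treated separately. *)
have z1 : {ae mu, forall t, D t -> complex.Re (g t) = 0}.
  apply: ae_zero_of_arc_integrals => // x hx; apply: arc_integral0 => // n.
  have /(congr1 (@complex.Re R)) /= := key x n => <-.
  by apply: eq_Rintegral => t _; rewrite cReM /= mulr0 subr0.
have z2 : {ae mu, forall t, D t -> complex.Im (g t) = 0}.
  apply: ae_zero_of_arc_integrals => // x hx; apply: arc_integral0 => // n.
  have /(congr1 (@complex.Im R)) /= := key x n => <-.
  by apply: eq_Rintegral => t _; rewrite cImM /= mulr0 add0r.
apply: (filterS2 (ae_filter_ringOfSetsType mu)) z1 z2 => t h1 h2 Dt; apply: complex_eq; [exact: h1|exact: h2].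
Qed.
End FourierUniqueness2.

(** * Jensen's inequality for polynomials *)

Section PeriodicShift.
Context (R : realType).
Local Notation mu := (@lebesgue_measure R).

Lemma Rintegral_shift (u : R -> R) (a b c : R) : a <= b -> continuous u ->
  \int[mu]_(t in `[a, b]) u (t + c) = \int[mu]_(t in `[a + c, b + c]) u t.
Proof.
move=> ab cu; rewrite /Rintegral; congr fine.
have dF : (fun t : R => t + c)^`()%classic = cst 1.
  by apply/funext => t; rewrite derive1E derive_val addr0.
rewrite (@integration_by_substitution_increasing _ (fun t => t + c) u a b) //.
- by apply: eq_integral => t _; rewrite dF !fctE mulr1.
- by move=> x y _ _; rewrite ltrD2r.
- by rewrite dF => ? _; exact: cvg_cst.
- by rewrite dF; apply: is_cvg_cst.
- by rewrite dF; apply: is_cvg_cst.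
- split=> //.
  + by apply: cvg_at_right_filter; apply: cvgD; [exact: cvg_id|exact: cvg_cst].
  + by apply: cvg_at_left_filter; apply: cvgD; [exact: cvg_id|exact: cvg_cst].
- exact: continuous_subspaceT.
Qed.

Lemma integrable_continuous (u : R -> R) (a b : R) : continuous u ->
  mu.-integrable `[a, b] (EFin \o u).
Proof.
move=> cu; apply: continuous_compact_integrable; first exact: segment_compact.
exact: continuous_subspaceT.
Qed.

Lemma Rintegral_chasles (u : R -> R) (a b c : R) : a <= b -> b <= c -> continuous u ->
  \int[mu]_(t in `[a, c]) u t = \int[mu]_(t in `[a, b]) u t + \int[mu]_(t in `[b, c]) u t.
Proof.
move=> ab bc cu; have iu := integrable_continuous a c cu.
have := Rintegral_itvB iu; move=> /(_ b); rewrite !bnd_simp => /(_ ab bc).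
rewrite Rintegral_itv_obnd_cbnd; last first.
  by apply: integrableS iu => //; apply: subset_itv; rewrite bnd_simp.
by move=> <-; rewrite addrC subrK.
Qed.

Lemma Rintegral_periodic (u : R -> R) (c : R) : continuous u ->
  (forall t, u (t + 2 * pi) = u t) -> 0 <= c <= 2 * pi ->
  \int[mu]_(t in `[- pi, pi]) u (t + c) = \int[mu]_(t in `[- pi, pi]) u t.
Proof.
move=> cu pu /andP[c0 c1]; have p0 := pi_gt0 R.
rewrite Rintegral_shift//; last lra.
rewrite (@Rintegral_chasles u (- pi + c) pi (pi + c))//; [|lra..].
rewrite (@Rintegral_chasles u (- pi) (- pi + c) pi)//; [|lra..].
rewrite addrC; congr (_ + _).
have -> : pi + c = (- pi + c) + 2 * pi by lra.
rewrite {1}(_ : pi = - pi + 2 * pi); last lra.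
rewrite -Rintegral_shift//; last lra.
by apply: eq_Rintegral => t _; exact: pu.
Qed.
End PeriodicShift.

Lemma sqmodX (R : realType) (z : R[i]) n : sqmod (z ^+ n) = sqmod z ^+ n.
Proof.
elim: n => [|n IH]; first by rewrite !expr0 sqmod_real expr1n.
by rewrite !exprS sqmodM IH.
Qed.

Section Jensen.
Context (R : realType).
Local Notation mu := (leb R).
Local Notation D := (@circle R).

Definition logdist (n : nat) (z : R[i]) (t : R) : R := ln (sqmod (@expi R n%:Z t - z)).

Lemma sqmod_dist_ge (w z : R[i]) : sqmod w = 1 ->
  2^-1 - sqmod z <= sqmod (w - z) /\ sqmod z / 2 - 1 <= sqmod (w - z).
Proof.
move=> w1; split.
  have := ler_sqmodD (w - z) z; rewrite subrK w1; lra.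
have := ler_sqmodD (w - z) (- w); rewrite addrC addKr !sqmodN w1; lra.
Qed.

Lemma sqmod_dist_gt0 (w z : R[i]) : sqmod w = 1 -> sqmod z != 1 -> 0 < sqmod (w - z).
Proof.
move=> w1 z1; rewrite lt_def sqmod_ge0 andbT; apply: contraNneq z1 => /sqmod_eq0 /eqP.
by rewrite subr_eq0 => /eqP <-; rewrite w1.
Qed.

Lemma continuous_sqmod_dist n (z : R[i]) : continuous (fun t => sqmod (@expi R n%:Z t - z)).
Proof.
have -> : (fun t => sqmod (@expi R n%:Z t - z)) = (fun t =>
    (cos (n%:Z%:~R * t) - complex.Re z) * (cos (n%:Z%:~R * t) - complex.Re z) +
    (sin (n%:Z%:~R * t) - complex.Im z) * (sin (n%:Z%:~R * t) - complex.Im z)).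
  by apply/funext => t; rewrite sqmodE cReD cImD cReN cImN /= -!expr2.
have ck : continuous (fun t : R => n%:Z%:~R * t) by move=> t; exact: mulrl_continuous.
have cc : continuous (fun t : R => cos (n%:Z%:~R * t)).
  by move=> t; apply: continuous_comp; [exact: ck|exact: continuous_cos].
have cs : continuous (fun t : R => sin (n%:Z%:~R * t)).
  by move=> t; apply: continuous_comp; [exact: ck|exact: continuous_sin].
move=> t; apply: cvgD; apply: cvgM; apply: cvgB; [exact: cc|exact: cvg_cst|exact: cc|
  exact: cvg_cst|exact: cs|exact: cvg_cst|exact: cs|exact: cvg_cst].
Qed.

Lemma continuous_logdist n (z : R[i]) : sqmod z != 1 -> continuous (logdist n z).
Proof.
move=> z1 t; apply: (@continuous_comp _ _ _ (fun t => sqmod (@expi R n%:Z t - z)) (@ln R)).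
  exact: continuous_sqmod_dist.
by apply: continuous_ln; apply: sqmod_dist_gt0 => //; exact: sqmod_expi.
Qed.

Lemma integrable_logdist n (z : R[i]) : sqmod z != 1 ->
  mu.-integrable D (fun t => (logdist n z t)%:E).
Proof. by move=> z1; apply: integrable_continuous; exact: continuous_logdist. Qed.

Lemma expi_shift (n : nat) (t : R) : (0 < n)%N ->
  @expi R n%:Z (t + pi / n%:R) = - @expi R n%:Z t.
Proof.
move=> n0; have e : n%:Z%:~R * (t + pi / n%:R) = n%:Z%:~R * t + pi :> R.
  by rewrite mulrDr mulrCA divff ?mulr1// pnatr_eq0 -lt0n.
by rewrite !expiE e cosDpi sinDpi.
Qed.

Lemma expi_periodic (n : nat) (t : R) : @expi R n%:Z (t + 2 * pi) = @expi R n%:Z t.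
Proof.
elim: n => [|n IH]; first by rewrite !expi0.
rewrite -addn1 PoszD !expiD IH; congr (_ * _).
by rewrite !expiE !mul1r mulr_natl cosD2pi sinD2pi.
Qed.

Lemma Rintegral_logdistN n (z : R[i]) : (0 < n)%N -> sqmod z != 1 ->
  \int[mu]_(t in D) logdist n (- z) t = \int[mu]_(t in D) logdist n z t.
Proof.
move=> n0 z1; rewrite -(@Rintegral_periodic _ (logdist n z) (pi / n%:R)).
- by apply: eq_Rintegral => t _; rewrite /logdist expi_shift// -opprD sqmodN opprK.
- exact: continuous_logdist.
- by move=> t; rewrite /logdist expi_periodic.
- have p0 := pi_gt0 R; have n1 : 1 <= n%:R :> R by rewrite ler1n.
  rewrite divr_ge0 ?(ltW p0)//= ler_pdivrMr ?ltr0n//; nra.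
Qed.

(* |w^(2n) - z^2| = |w^n - z| |w^n + z|, and t |-> t + pi / n exchanges the two
   factors up to sign. *)
Lemma Rintegral_logdist_double n (z : R[i]) : (0 < n)%N -> sqmod z != 1 ->
  \int[mu]_(t in D) logdist n.*2 (z ^+ 2) t = 2 * \int[mu]_(t in D) logdist n z t.
Proof.
move=> n0 z1; have Nz1 : sqmod (- z) != 1 by rewrite sqmodN.
rewrite mulr_natl mulr2n -{2}(Rintegral_logdistN n0 z1) -RintegralD; last 3 first.
- exact: measurable_circle.
- exact: integrable_logdist.
- exact: integrable_logdist.
apply: eq_Rintegral => t _; rewrite /logdist -lnM ?posrE; last 2 first.
- by apply: sqmod_dist_gt0 => //; exact: sqmod_expi.
- by apply: sqmod_dist_gt0 => //; exact: sqmod_expi.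
rewrite -sqmodM; congr (ln (sqmod _)).
by rewrite -addnn PoszD expiD; ring.
Qed.

Lemma Rintegral_logdist_iter m (z : R[i]) : sqmod z != 1 ->
  \int[mu]_(t in D) logdist (2 ^ m) (z ^+ (2 ^ m)) t =
  2 ^+ m * \int[mu]_(t in D) logdist 1 z t.
Proof.
move=> z1; elim: m => [|m IH]; first by rewrite expn0 expr1 expr0 mul1r.
rewrite expnSr muln2 -muln2 exprM muln2 Rintegral_logdist_double ?expn_gt0//.
  by rewrite IH exprS mulrA.
by rewrite sqmodX pexpr_eq1 ?expn_gt0 ?sqmod_ge0.
Qed.

(** The thresholds 1/4 and 4 are those for which [sqmod_dist_ge] keeps the squared distance from
    z^(2^m) to the unit circle at least 1/4 in either case. *)
Lemma near_sqmod_iter (z : R[i]) : sqmod z != 1 ->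
  exists m0, forall m, (m0 <= m)%N ->
    sqmod (z ^+ (2 ^ m)) <= 4^-1 \/ 4 <= sqmod (z ^+ (2 ^ m)).
Proof.
rewrite neq_lt => /orP[z1|z1].
  have i1 : `|sqmod z| < 1 by rewrite (ger0_norm (sqmod_ge0 _)).
  have /(@cvgrPdist_lt _ R^o)/(_ 4^-1) := cvg_expr i1.
  move=> [|m0 _ h]; first by rewrite invr_gt0.
  exists m0 => m hm; left; rewrite sqmodX.
  have /h /= : (m0 <= 2 ^ m)%N by apply: leq_trans hm (ltnW (ltn_expl _ _)).
  by rewrite sub0r normrN (ger0_norm (exprn_ge0 _ (sqmod_ge0 _))) => /ltW.
have i1 : `|(sqmod z)^-1| < 1 by rewrite ger0_norm ?invr_ge0 ?sqmod_ge0// invf_lt1//; lra.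
have /(@cvgrPdist_lt _ R^o)/(_ 4^-1) := cvg_expr i1.
move=> [|m0 _ h]; first by rewrite invr_gt0.
exists m0 => m hm; right; rewrite sqmodX.
have /h /= : (m0 <= 2 ^ m)%N by apply: leq_trans hm (ltnW (ltn_expl _ _)).
have p : 0 < sqmod z ^+ (2 ^ m) by rewrite exprn_gt0//; lra.
rewrite exprVn sub0r normrN gtr0_norm ?invr_gt0// => hlt.
by rewrite -lef_pV2 ?posrE// ltW.
Qed.

(* By iterated doubling the integral is 2^-m times an integral bounded below. *)
Lemma jensen_linear (z : R[i]) : sqmod z != 1 -> 0 <= \int[mu]_(t in D) logdist 1 z t.
Proof.
move=> z1; have [m0 hm0] := near_sqmod_iter z1.
set J := \int[mu]_(t in D) _.
have hJ m : (m0 <= m)%N -> ln 4^-1 * (2 * pi) <= 2 ^+ m * J.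
  move=> hm; rewrite -Rintegral_logdist_iter//.
  have zm1 : sqmod (z ^+ (2 ^ m)) != 1.
    by rewrite sqmodX pexpr_eq1 ?expn_gt0 ?sqmod_ge0.
  have -> : ln 4^-1 * (2 * pi) = \int[mu]_(t in D) (fun=> ln (4^-1 : R)) t.
    rewrite Rintegral_cst; last exact: measurable_circle.
    by congr (_ * _); have := congr1 fine (leb_circle R) => /= ->.
  apply: le_Rintegral; first exact: measurable_circle.
  - by apply: integrable_continuous => t; exact: cvg_cst.
  - exact: integrable_logdist.
  move=> t _; rewrite /logdist.
  have ex := sqmod_expi (2 ^ m)%:Z t.
  have [h1 h2] := sqmod_dist_ge (z ^+ (2 ^ m)) ex.
  rewrite ler_ln ?posrE ?invr_gt0//; last exact: sqmod_dist_gt0.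
  by have [h|h] := hm0 m hm; [apply: le_trans h1|apply: le_trans h2]; lra.
rewrite leNgt; apply/negP => J0.
pose C := - (ln 4^-1 * (2 * pi)) : R.
have [n hn] : exists n : nat, C / - J < n%:R.
  by exists (Num.truncn (C / - J)).+1; exact: truncnS_gt.
have nJ : 0 < - J by rewrite oppr_gt0.
have := hJ (maxn m0 n) (leq_maxl _ _).
have : n%:R <= 2 ^+ (maxn m0 n) :> R.
  by rewrite -natrX ler_nat; apply: leq_trans (leq_maxr m0 n) (ltnW (ltn_expl _ _)).
move: hn; rewrite ltr_pdivrMr// /C.
by move: (n%:R) (2 ^+ _) (ln _ * _) => x y c; nra.
Qed.

End Jensen.

(** * Szego's lower bound *)

Section SzegoBound.
Context (R : realType).
Local Notation mu := (leb R).
Local Notation D := (@circle R).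

Lemma ln_le_subr1 (x : R) : 0 < x -> ln x <= x - 1.
Proof. by move=> x0; have := @le_ln1Dx R (x - 1); rewrite [1 + _]addrC subrK; apply; lra. Qed.

Variable f : R -> R.
Hypothesis sf : spectral_density f.
Hypothesis rf : regular f.

Let f0 t : D t -> 0 <= f t.
Proof. by move=> Dt; apply: sf.1. Qed.

Let mf : measurable_fun D f.
Proof. exact: integrable_meas sf.2. Qed.

Let mD := @measurable_circle R.

Lemma integrable_lne : mu.-integrable D (fun t => lne (f t)%:E).
Proof.
pose u t := lne (f t)%:E.
have mu_u : measurable_fun D u.
  rewrite (_ : u = (fun t => if f t <= 0 then -oo%E else (ln (f t))%:E)); last first.
    apply/funext => t; rewrite /u; case: leP => ft; first by rewrite le0_lneNy.
    by rewrite lne_EFin.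
  apply: measurable_fun_if => //.
  - by apply: measurable_fun_ler => //; exact: measurable_cst.
  - apply/measurable_EFinP; apply: measurableT_comp; first exact: measurable_ln.
    by apply: measurable_funS mf => //; exact: subIsetl.
have up : (\int[mu]_(t in D) u^\+ t < +oo)%E.
  apply: le_lt_trans (integrable_lty mD sf.2); apply: ge0_le_integral => //.
  - exact: measurable_funepos.
  - exact/measurable_EFinP.
  move=> t Dt; rewrite funeposE ge_max lee_fin f0// andbT /u.
  have := f0 Dt; rewrite le_eqVlt => /predU1P[<-|ft]; first by rewrite le0_lneNy ?leNye.
  by rewrite lne_EFin// lee_fin ltW// ln_sublinear.
(* The positive part has a finite integral, so an infinite negative part would make the whole
   integral -oo, against regularity. *)
have un : (\int[mu]_(t in D) u^\- t < +oo)%E.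
  move: rf; rewrite /regular integralE => h.
  rewrite ltey; apply/eqP => un; move: h; rewrite -/u un /=.
  have up0 : (0 <= \int[mu]_(t in D) u^\+ t)%E by exact: integral_ge0.
  by move: up up0; case: (\int[mu]_(t in D) _)%E.
apply/integrableP; split=> //.
rewrite (_ : (fun t => _) = (fun t => u^\+ t + u^\- t)%E); last first.
  exact: fune_abse u.
rewrite ge0_integralD//; first exact: lte_add_pinfty.
- exact: measurable_funepos.
- exact: measurable_funeneg.
Qed.

Lemma spectral_density_gt0 : {ae mu, forall t, D t -> 0 < f t}.
Proof.
apply: (@filterS _ _ (ae_filter_ringOfSetsType mu) _ _ _ (integrable_ae mD integrable_lne)) => t + Dt.
by move=> /(_ Dt); apply: contraTT; rewrite -leNgt => ft; rewrite le0_lneNy.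
Qed.

Lemma integrable_ln : mu.-integrable D (fun t => (ln (f t))%:E).
Proof.
apply: le_integrable integrable_lne => //.
  by apply/measurable_EFinP; apply: measurableT_comp => //; exact: measurable_ln.
move=> t Dt; have := f0 Dt; rewrite le_eqVlt => /predU1P[<-|ft].
  by rewrite le0_lneNy//= leey.
by rewrite lne_EFin.
Qed.

(** The geometric mean of [f]. By Szego's theorem, 2 pi times it is the infimum of the integrals of
    |p|^2 f over monic polynomials p in e^{it}; the lower bound is the half needed here. *)
Definition szego_const : R := expR ((\int[mu]_(t in D) ln (f t)) / (2 * pi)).

Definition root_prod (zs : seq R[i]) (t : R) : R[i] := \prod_(z <- zs) (@expi R 1 t - z).

Lemma cmeasurable_root_prod zs : cmeasurable D (root_prod zs).
Proof.
rewrite /root_prod; elim: zs => [|z s IH].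
  by under eq_fun do rewrite big_nil; exact: cmeasurable_cst.
under eq_fun do rewrite big_cons; apply: cmeasurableM => //.
by apply: cmeasurableB; [exact: cmeasurable_expi|exact: cmeasurable_cst].
Qed.

Lemma root_prod_bounded zs : exists2 M, 0 < M & forall t, sqmod (root_prod zs t) <= M.
Proof.
elim: zs => [|z s [M M0 hM]].
  by exists 1 => // t; rewrite /root_prod big_nil sqmod_real expr1n.
exists ((2 + 2 * sqmod z) * M); first by have := sqmod_ge0 z; nra.
move=> t; rewrite /root_prod big_cons sqmodM ler_pM ?sqmod_ge0 ?hM//.
by have := ler_sqmodD (@expi R 1 t) (- z); rewrite sqmod_expi sqmodN mulr1.
Qed.

Lemma integrable_bounded_density (v : R -> R) (M : R) : measurable_fun D v ->
  (forall t, D t -> `|v t| <= M) -> mu.-integrable D (fun t => (v t * f t)%:E).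
Proof.
move=> mv hv; have := integrableZE mD M sf.2.
apply: le_integrableE => //; first exact: measurable_funM.
by move=> t Dt; rewrite normrM (ger0_norm (f0 Dt)) ler_wpM2r ?f0// hv.
Qed.

Lemma integrable_root_prod_density zs :
  mu.-integrable D (fun t => (sqmod (root_prod zs t) * f t)%:E).
Proof.
have [M _ hM] := root_prod_bounded zs.
apply: (@integrable_bounded_density _ M).
  by apply: measurable_sqmod; exact: cmeasurable_root_prod.
by move=> t _; rewrite ger0_norm ?sqmod_ge0.
Qed.

Lemma jensen_root_prod zs : (forall z, z \in zs -> sqmod z != 1) ->
  [/\ forall t, 0 < sqmod (root_prod zs t),
    mu.-integrable D (fun t => (ln (sqmod (root_prod zs t)))%:E) &
    0 <= \int[mu]_(t in D) ln (sqmod (root_prod zs t))].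
Proof.
elim: zs => [_|z s IH h].
  have E t : sqmod (root_prod [::] t) = 1 by rewrite /root_prod big_nil sqmod_real expr1n.
  split; first by move=> t; rewrite E.
    by under eq_fun do rewrite E ln1; exact: integrable0.
  by under eq_Rintegral do rewrite E ln1; rewrite Rintegral_cst// mul0r.
have [|p ip hp] := IH; first by move=> y ys; apply: h; rewrite inE ys orbT.
have z1 : sqmod z != 1 by apply: h; rewrite inE eqxx.
have pz t : 0 < sqmod (@expi R 1 t - z) by apply: sqmod_dist_gt0 => //; exact: sqmod_expi.
have E t : sqmod (root_prod (z :: s) t) = sqmod (@expi R 1 t - z) * sqmod (root_prod s t).
  by rewrite /root_prod big_cons sqmodM.
have El t : ln (sqmod (root_prod (z :: s) t)) = logdist 1 z t + ln (sqmod (root_prod s t)).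
  by rewrite E lnM ?posrE.
split.
- by move=> t; rewrite E mulr_gt0.
- by under eq_fun do rewrite El; apply: integrableDE => //; exact: integrable_logdist.
- under eq_Rintegral do rewrite El; rewrite RintegralD//; last exact: integrable_logdist.
  by rewrite addr_ge0//; exact: jensen_linear.
Qed.

Lemma fine_leb_circle : fine (mu D) = 2 * pi.
Proof. by rewrite leb_circle. Qed.

Lemma szego_bound_offcircle zs : (forall z, z \in zs -> sqmod z != 1) ->
  2 * pi * szego_const <= \int[mu]_(t in D) (sqmod (root_prod zs t) * f t).
Proof.
move=> h; have [p ip hp] := jensen_root_prod h.
have c0 : 0 < szego_const by exact: expR_gt0.
have lc : ln szego_const * (2 * pi) = \int[mu]_(t in D) ln (f t).
  by rewrite expRK divfK// mulf_neq0// gt_eqF// pi_gt0.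
have icst (k : R) : mu.-integrable D (fun t => k%:E).
  by apply: (@integrable_bounded_circle _ (cst k) `|k|).
have i1 : mu.-integrable D (fun t => (1 - ln szego_const +
    (ln (sqmod (root_prod zs t)) + ln (f t)))%:E).
  apply: integrableDE => //.
  by apply: integrableDE => //; exact: integrable_ln.
have i2 := integrableZE mD szego_const^-1 (integrable_root_prod_density zs).
(* x >= 1 + ln x for x = |p|^2 f / szego_const *)
have le12 : \int[mu]_(t in D) (1 - ln szego_const + (ln (sqmod (root_prod zs t)) + ln (f t))) <=
    \int[mu]_(t in D) (szego_const^-1 * (sqmod (root_prod zs t) * f t)).
  apply: ae_le_Rintegral => //.
  apply: (@filterS _ _ (ae_filter_ringOfSetsType mu) _ _ _ spectral_density_gt0) => t + Dt => /(_ Dt) ft.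
  have pp : 0 < sqmod (root_prod zs t) * f t by rewrite mulr_gt0.
  have := @ln_le_subr1 (szego_const^-1 * (sqmod (root_prod zs t) * f t)).
  rewrite mulr_gt0 ?invr_gt0// => /(_ isT).
  by rewrite lnM ?posrE ?invr_gt0// lnV ?posrE// lnM ?posrE//; lra.
move: le12; rewrite RintegralD//; last 2 first.
- exact: icst.
- by apply: integrableDE => //; exact: integrable_ln.
rewrite RintegralD//; last exact: integrable_ln.
rewrite RintegralZl//; last exact: integrable_root_prod_density.
rewrite Rintegral_cst// -lc fine_leb_circle => le12.
rewrite -ler_pdivlMr// [X in _ <= X]mulrC; move: le12 hp.
move: (_^-1 * _) (ln _) => x y; lra.
Qed.

(** Jensen's inequality was obtained for roots off the circle, where the logarithm is continuous. A
    root on the circle is moved slightly inwards, and the change of the product is controlled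
    uniformly, one factor at a time. *)
Lemma perturb_roots zs (e : R) : 0 < e ->
  exists zs', (forall z, z \in zs' -> sqmod z != 1) /\
    forall t, sqmod (root_prod zs' t - root_prod zs t) <= e.
Proof.
elim: zs e => [|z s IH] e e0.
  by exists [::]; split=> // t; rewrite subrr sqmod0 ltW.
have sz := sqmod_ge0 z.
(* Each of the two terms in the difference of products is to be at most e / 4, since [ler_sqmodD]
   doubles them; 2 + 2 |z|^2 bounds |e^{it} - z|^2. *)
have [|s' [hs' hd]] := IH (e / (4 * (2 + 2 * sqmod z))).
  by rewrite divr_gt0//; lra.
have [M M0 hM] := root_prod_bounded s'.
have [z' [z'1 zz']] : exists z', sqmod z' != 1 /\ sqmod (z' - z) <= e / (4 * M).
  have eM : 0 < e / (4 * M) by rewrite divr_gt0// mulr_gt0.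
  have [z1|z1] := eqVneq (sqmod z) 1; last first.
    by exists z; split => //; rewrite subrr sqmod0 ltW.
  (* The displacement has squared modulus r^2 <= r, and 0 < r <= 1/2 keeps (1 - r)^2 away from 1. *)
  pose r := Num.min (e / (4 * M)) 2^-1.
  have r0 : 0 < r by rewrite lt_min eM/=; lra.
  have r2 : r <= 2^-1 by rewrite ge_min lexx orbT.
  exists ((1 - r)%:C%C * z); rewrite sqmodM sqmod_real z1 mulr1; split.
    by apply/eqP => h; nra.
  have -> : (1 - r)%:C%C * z - z = (- r)%:C%C * z by rewrite rmorphB rmorphN rmorph1; ring.
  rewrite sqmodM sqmod_real z1 mulr1.
  apply: (@le_trans _ _ r); first nra.
  by rewrite ge_min lexx.
exists (z' :: s'); split.
  by move=> y; rewrite inE => /orP[/eqP ->//|/hs'].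
move=> t; rewrite /root_prod !big_cons -!/(root_prod _ _).
have -> : (expi 1 t - z') * root_prod s' t - (expi 1 t - z) * root_prod s t =
   (z - z') * root_prod s' t + (expi 1 t - z) * (root_prod s' t - root_prod s t) by ring.
apply: le_trans (ler_sqmodD _ _) _; rewrite !sqmodM.
have h1 : sqmod (z - z') * sqmod (root_prod s' t) <= e / 4.
  have -> : e / 4 = e / (4 * M) * M by field; rewrite gt_eqF.
  by rewrite ler_pM ?sqmod_ge0 ?hM// -sqmodN opprB.
have h2 : sqmod (@expi R 1 t - z) * sqmod (root_prod s' t - root_prod s t) <= e / 4.
  have -> : e / 4 = (2 + 2 * sqmod z) * (e / (4 * (2 + 2 * sqmod z))).
    by field; rewrite gt_eqF//; lra.
  rewrite ler_pM ?sqmod_ge0 ?hd//.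
  by have := ler_sqmodD (@expi R 1 t) (- z); rewrite sqmod_expi sqmodN mulr1.
lra.
Qed.

Lemma szego_bound_roots : exists2 d : R, 0 < d & forall zs,
  d <= \int[mu]_(t in D) (sqmod (root_prod zs t) * f t).
Proof.
have c0 : 0 < szego_const by exact: expR_gt0.
have p0 := pi_gt0 R.
pose d := 2 * pi * szego_const.
have d0 : 0 < d by rewrite /d !mulr_gt0.
exists (d / 4); first by rewrite divr_gt0.
move=> zs; set I := \int[mu]_(t in D) f t.
have I0 : 0 <= I by apply: Rintegral_ge0 => t /f0.
(* With error q = d / (4 (I + 1)) the perturbed product p' satisfies d <= int |p'|^2 f <= 2 int
   |p|^2 f + 2 q I, where 2 q I <= d / 2. This leaves d / 4, whatever the roots. *)
have [|zs' [h1 h2]] := @perturb_roots zs (d / (4 * (I + 1))).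
  by rewrite divr_gt0//; lra.
have := szego_bound_offcircle h1; rewrite -/d => h3.
have h4 : \int[mu]_(t in D) (sqmod (root_prod zs' t) * f t) <=
    \int[mu]_(t in D) (2 * (sqmod (root_prod zs t) * f t) + 2 * (d / (4 * (I + 1))) * f t).
  apply: le_Rintegral => //.
  - exact: integrable_root_prod_density.
  - apply: integrableDE => //; apply: integrableZE => //.
      exact: integrable_root_prod_density.
    exact: sf.2.
  - move=> t Dt; rewrite mulrA -mulrDl ler_wpM2r ?f0//.
    rewrite -(subrK (root_prod zs t) (root_prod zs' t)) addrC.
    by apply: le_trans (ler_sqmodD _ _) _; rewrite lerD2l ler_pM2l.
move: h4; rewrite RintegralD//; last 2 first.
- by apply: integrableZE => //; exact: integrable_root_prod_density.
- by apply: integrableZE => //; exact: sf.2.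
rewrite !RintegralZl//; [|exact: sf.2|exact: integrable_root_prod_density].
rewrite -/I => h4.
have h5 : 2 * (d / (4 * (I + 1))) * I <= d / 2.
  rewrite (_ : 2 * (d / (4 * (I + 1))) * I = (d / 2) * (I / (I + 1))); last first.
    by field; rewrite gt_eqF//; lra.
  by rewrite ler_piMr ?ler_pdivrMr; lra.
move: h3 h4 h5; move: (\int[mu]_(t in D) _) (\int[mu]_(t in D) _) => x y; lra.
Qed.

Lemma past_poly_roots (s : seq int) (c : int -> R[i]) : (forall k, k \in s -> k <= -1) ->
  exists zs, forall t, sqmod (1 - \sum_(k <- s) c k * @expi R k t) = sqmod (root_prod zs t).
Proof.
move=> hs; pose n := \max_(k <- s) `|k|%N.
(* Since k <= -1, the exponent n + k stays below n, so the constant 1 becomes the leading term. *)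
have hn k : k \in s -> exists2 m, (m < n)%N & n%:Z + k = m%:Z.
  move=> ks; have kn : (`|k| <= n)%N by rewrite /n (big_rem k)//= leq_maxl.
  have k1 := hs k ks; exists (n - `|k|)%N; lia.
(* e^{in lambda} turns the sum into a monic polynomial in e^{i lambda} *)
pose p : {poly R[i]} := 'X^n - \sum_(k <- s) c k *: 'X^(absz (n%:Z + k)%R).
have szs : (size (\sum_(k <- s) c k *: 'X^(absz (n%:Z + k)%R) : {poly R[i]})%R < n.+1)%N.
  rewrite ltnS big_seq; apply: (big_ind (fun q : {poly R[i]} => (size q <= n)%N)).
  - by rewrite size_poly0.
  - by move=> q r hq hr; apply: leq_trans (size_polyD _ _) _; rewrite geq_max hq.
  - move=> k /hn[m mn ->]; apply: leq_trans (size_scale_leq _ _) _.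
    by rewrite size_polyXn absz_nat.
have szp : size p = n.+1 by rewrite /p size_polyDl size_polyXn// size_polyN.
have lp : lead_coef p = 1.
  by rewrite /p lead_coefDl ?lead_coefXn// size_polyN size_polyXn.
have [zs hzs] := closed_field_poly_normal p.
exists zs => t; rewrite -(mul1r (sqmod (1 - _))) -(sqmod_expi n%:Z t) -sqmodM.
congr sqmod; transitivity p.[@expi R 1 t].
  rewrite /p hornerD hornerN hornerXn horner_sum mulrBr mulr1 expiX; congr (_ - _).
  rewrite mulr_sumr; apply: eq_big_seq => k /hn[m mn hm].
  by rewrite hornerZ hornerXn mulrCA -expiX -expiD hm absz_nat expiX.
rewrite hzs lp scale1r horner_prod /root_prod.
by apply: eq_bigr => z _; rewrite hornerXsubC.
Qed.

Theorem szego_bound : exists2 d : R, 0 < d &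
  forall (s : seq int) (c : int -> R[i]), (forall k, k \in s -> k <= -1) ->
    d <= \int[mu]_(t in D) (sqmod (1 - \sum_(k <- s) c k * @expi R k t) * f t).
Proof.
have [d d0 hd] := szego_bound_roots; exists d => // s c hs.
have [zs hzs] := past_poly_roots c hs.
by under eq_Rintegral do rewrite hzs.
Qed.
End SzegoBound.

(** * Moduli and integrals of the exponentials *)

Lemma normc_nneg (R : realType) (z : R[i]) : 0 <= Normc.normc z.
Proof. by case: z => x y; exact: sqrtr_ge0. Qed.

Lemma normc_ge (R : realType) (z : R[i]) : `|complex.Re z| <= Normc.normc z /\ `|complex.Im z| <= Normc.normc z.
Proof. by apply: norm_Re_le => //; exact: normc_nneg. Qed.

Lemma normcM_expi (R : realType) (z : R[i]) k t : Normc.normc (z * @expi R k t) = Normc.normc z.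
Proof.
apply/eqP; rewrite -(@eqrXn2 _ 2) ?normc_nneg//; apply/eqP.
by have := sqmodM z (@expi R k t); rewrite sqmod_expi mulr1.
Qed.

Lemma cintegrable_expi (R : realType) (k : int) :
  cintegrable (leb R) (@circle R) (@expi R k).
Proof.
have h (t : R) : `|complex.Re (@expi R k t)| <= 1 /\ `|complex.Im (@expi R k t)| <= 1.
  by apply: norm_Re_le => //; rewrite sqmod_expi expr1n.
have [m1 m2] := cmeasurable_expi k (@circle R).
split; first by apply: (integrable_bounded_circle m1 (M := 1)) => t _; have [] := h t.
by apply: (integrable_bounded_circle m2 (M := 1)) => t _; have [] := h t.
Qed.

Lemma cintegral_expi (R : realType) (k : int) :
  cintegral (leb R) (@circle R) (@expi R k) = (2 * pi * (k == 0)%:R)%:C%C.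
Proof.
have [->|k0] := eqVneq k 0.
  rewrite mulr1; apply: complex_eq => /=.
    under eq_Rintegral do rewrite mul0r cos0.
    rewrite Rintegral_cst; last exact: measurable_circle.
    by rewrite mul1r fine_leb_circle.
  by under eq_Rintegral do rewrite mul0r sin0; rewrite Rintegral_cst ?mul0r//; exact: measurable_circle.
rewrite mulr0; have -> : (0 : R)%:C%C = 0 by [].
have key (n : nat) : (0 < n)%N -> cintegral (leb R) (@circle R) (@expi R n%:Z) = 0.
  move=> n0; have ck : continuous (fun t : R => n%:Z%:~R * t) by move=> t; exact: mulrl_continuous.
  (* Translation by pi / n preserves the integral over a period and changes the sign of both parts
     of e^{int}, so the integral equals its opposite. *)
  have sh (u : R -> R) : continuous u -> (forall t, u (t + 2 * pi) = u t) ->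
      (forall t, u (t + pi / n%:R) = - u t) -> \int[leb R]_(t in @circle R) u t = 0.
    move=> cu pu nu; set I := Rintegral _ _ _.
    suff : I = - I by lra.
    rewrite {1}/I -(@Rintegral_periodic _ u (pi / n%:R)) //.
      under eq_Rintegral do rewrite nu -mulN1r.
      by rewrite RintegralZl ?mulN1r//; exact: integrable_continuous.
    have p0 := pi_gt0 R; have n1 : 1 <= n%:R :> R by rewrite ler1n.
    rewrite divr_ge0 ?(ltW p0)//= ler_pdivrMr ?ltr0n//; nra.
  apply: complex_eq => /=; apply: sh => t.
  - exact: (@continuous_comp _ _ _ (fun t : R => n%:Z%:~R * t) (@cos R) t (ck t) (@continuous_cos R _)).
  - exact: (congr1 (@complex.Re R) (@expi_periodic R n t)).
  - by have := congr1 (@complex.Re R) (@expi_shift R n t n0); rewrite cReN.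
  - exact: (@continuous_comp _ _ _ (fun t : R => n%:Z%:~R * t) (@sin R) t (ck t) (@continuous_sin R _)).
  - exact: (congr1 (@complex.Im R) (@expi_periodic R n t)).
  - by have := congr1 (@complex.Im R) (@expi_shift R n t n0); rewrite cImN.
case: (intP k) k0 => [//|n _|n _]; first exact: key.
have := congr1 (@conjc R) (key n.+1 isT); rewrite conjc0 => <-.
rewrite -cintegralJ; [|exact: measurable_circle|exact: cintegrable_expi].
by apply: eq_cintegral => t _; rewrite expiN.
Qed.

(** * Innovations in the spectral space *)

Section SpectralSpace.
Context (R : realType).
Local Notation mu := (leb R).
Local Notation D := (@circle R).
Variable f : R -> R.
Hypothesis sf : spectral_density f.

Let pi2 : 0 < 2 * pi :> R.
Proof. by rewrite mulr_gt0// pi_gt0. Qed.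

Lemma weight_ge0 t : D t -> 0 <= weight f t.
Proof. by move=> Dt; rewrite divr_ge0 ?(ltW pi2)//; apply: sf.1. Qed.

Lemma measurable_weight : measurable_fun D (weight f).
Proof.
apply: measurable_funM; last exact: measurable_cst.
exact: integrable_meas sf.2.
Qed.

Definition spectral_wspace : wspace R :=
  @WSpace R _ (measurableTypeR R) mu D (weight f) (@measurable_circle R)
    measurable_weight weight_ge0.

Definition L2f_space : hilbert R := L2_hilbert spectral_wspace.
Local Notation H := L2f_space.
Local Notation toL2 := (@mkL2 R spectral_wspace).
Local Notation fn x := ((x : L2t spectral_wspace) : R -> R[i]).

Lemma integrable_weight : mu.-integrable D (fun t => (weight f t)%:E).
Proof.
rewrite /weight; under eq_fun do rewrite mulrC.
by apply: integrableZE; [exact: measurable_circle|exact: sf.2].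
Qed.

Lemma L2_bounded (g : R -> R[i]) (M : R) : cmeasurable D g ->
  (forall t, D t -> sqmod (g t) <= M) -> L2 mu D (weight f) g.
Proof.
move=> mg hg; apply: (@L2P_integrable R spectral_wspace) => //.
have := integrableZE (@measurable_circle R) M integrable_weight.
apply: le_integrableE; first exact: measurable_circle.
  by apply: measurable_funM; [exact: measurable_sqmod|exact: measurable_weight].
move=> t Dt; rewrite normrM (ger0_norm (weight_ge0 Dt)) (ger0_norm (sqmod_ge0 _)).
by rewrite ler_wpM2r ?hg// weight_ge0.
Qed.

Lemma L2_expi (k : int) : L2 mu D (weight f) (@expi R k).
Proof.
apply: (@L2_bounded _ 1); first exact: cmeasurable_expi.
by move=> t _; rewrite sqmod_expi.
Qed.

Definition Eexp (k : int) : H := toL2 (L2_expi k).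

Lemma L2_shift (j : int) (g : R -> R[i]) : L2 mu D (weight f) g ->
  L2 mu D (weight f) (fun t => g t * @expi R j t).
Proof.
move=> Lg; apply: (@le_L2 R spectral_wspace _ g g 1) => //.
  by apply: cmeasurableM; [exact: Lg.1|exact: cmeasurable_expi].
by move=> t _; rewrite sqmodM sqmod_expi mulr1 mul1r lerDl sqmod_ge0.
Qed.

(** The unitary time shift of a stationary sequence, seen in the spectral domain. *)
Definition shift (j : int) (x : H) : H := toL2 (L2_shift j (L2fP x)).

Lemma L2t_inj (x y : H) : (forall t, fn x t = fn y t) -> x = y.
Proof. by move=> h; apply: val_inj; apply/funext. Qed.

Lemma shiftE j x t : fn (shift j x) t = fn x t * @expi R j t.
Proof. by []. Qed.

Lemma shift_lin j c x y : shift j (c *: x + y) = c *: shift j x + shift j y.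
Proof.
apply: L2t_inj => t; rewrite shiftE.
transitivity ((c * fn x t + fn y t) * @expi R j t) => //.
by rewrite mulrDl -mulrA.
Qed.

Lemma shiftB j x y : shift j (x - y) = shift j x - shift j y.
Proof. by apply: L2t_inj => t; exact: mulrBl. Qed.

Lemma shift_sum (I : Type) (s : seq I) (c : I -> R[i]) (F : I -> H) j :
  shift j (\sum_(i <- s) c i *: F i) = \sum_(i <- s) c i *: shift j (F i).
Proof.
elim: s => [|i s IH]; first by rewrite !big_nil; apply: L2t_inj => t; exact: mul0r.
by rewrite !big_cons shift_lin IH.
Qed.

Lemma shift_Eexp j k : shift j (Eexp k) = Eexp (k + j).
Proof. by apply: L2t_inj => t; rewrite [RHS]expiD. Qed.

Lemma shift_shift j k x : shift j (shift k x) = shift (k + j) x.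
Proof. by apply: L2t_inj => t; rewrite !shiftE expiD mulrA. Qed.

Lemma shift0 x : shift 0 x = x.
Proof. by apply: L2t_inj => t; rewrite shiftE expi0 mulr1. Qed.

Lemma ip_shift j x y : ip (shift j x) (shift j y) = ip x y.
Proof.
apply: eq_cintegral => t _.
rewrite /= conjcM mulrACA mulcJ sqmod_expi.
by rewrite (_ : (1 : R)%:C%C = 1) ?mulr1.
Qed.

Lemma N2_shift j x : N2 (shift j x) = N2 x.
Proof. by rewrite /N2 ip_shift. Qed.

Definition pastE (n : int) : set H := cspan [set k : int | k <= n] Eexp.

Lemma closed_pastE n : closed_subspace (pastE n).
Proof. exact: cspan_closed. Qed.

Lemma pastE_gen (n k : int) : k <= n -> pastE n (Eexp k).
Proof. by move=> kn; exact: (@cspan_gen _ H _ [set k : int | k <= n] Eexp). Qed.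

Lemma pastE_le m n x : m <= n -> pastE m x -> pastE n x.
Proof.
move=> mn; apply: cspan_sub => k /= km; apply: pastE_gen; exact: le_trans mn.
Qed.

Lemma pastE_shift n j x : pastE n x -> pastE (n + j) (shift j x).
Proof.
move=> hx; have := cspan_isometry (shift_lin j) (N2_shift j) hx.
apply: cspan_sub => k /= kn; rewrite shift_Eexp; apply: pastE_gen.
by rewrite lerD2r.
Qed.

Lemma N2_int (x : H) : N2 x = \int[mu]_(t in D) (sqmod (fn x t) * weight f t).
Proof. exact: Re_ipw. Qed.

Lemma N2_ae0 (x : H) : {ae mu, forall t, D t -> sqmod (fn x t) * weight f t = 0} -> N2 x = 0.
Proof.
move=> h; rewrite N2_int /Rintegral (ae_eq_integral (cst 0%E)).
- by rewrite integral_cst ?mul0e//; exact: measurable_circle.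
- exact: measurable_circle.
- apply/measurable_EFinP; apply: (@measurable_sqw R spectral_wspace).
  exact: (L2fP _).1.
- exact: measurable_cst.
- apply: (@filterS _ _ (ae_filter_ringOfSetsType mu) _ _ _ h) => t + Dt.
  by move=> /(_ Dt) ->.
Qed.

End SpectralSpace.

Arguments pastE {R f} sf n _.

Section Innovations.
Context (R : realType).
Local Notation mu := (leb R).
Local Notation D := (@circle R).
Variable f : R -> R.
Hypothesis sf : spectral_density f.
Local Notation H := (L2f_space sf).
Local Notation toL2 := (@mkL2 R (spectral_wspace sf)).
Local Notation fn x := ((x : L2t (spectral_wspace sf)) : R -> R[i]).
Local Notation E := (Eexp sf).

Variable ep : H.
Hypothesis ep_white : {ae mu, forall t, D t -> sqmod (fn ep t) * f t = 1}.

Definition innov (k : int) : H := shift k ep.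

Let pi2 : 0 < 2 * pi :> R.
Proof. by rewrite mulr_gt0// pi_gt0. Qed.

Lemma cintegrable_fip (x y : H) :
  cintegrable mu D (fun t => fn x t * (fn y t)^*%C * (weight f t)%:C%C).
Proof. exact: (@cintegrable_ip R (spectral_wspace sf) _ _ (L2fP x) (L2fP y)). Qed.

Lemma innov_orthonormal i j : ip (innov i) (innov j) = (i == j)%:R.
Proof.
transitivity (cintegral mu D (fun t => ((2 * pi)^-1 : R)%:C%C * @expi R (i - j) t)).
  apply: ae_eq_cintegral; first exact: measurable_circle.
  - exact: (cintegrable_meas (cintegrable_fip (innov i) (innov j))).
  - by apply: cmeasurableM; [exact: cmeasurable_cst|exact: cmeasurable_expi].
  apply: (@filterS _ _ (ae_filter_ringOfSetsType mu) _ _ _ ep_white) => t + Dt => /(_ Dt) h.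
  rewrite /= conjcM mulrACA mulcJ -expiN -expiD mulrAC -rmorphM /weight mulrA h mul1r.
  by [].
rewrite cintegralZ; [|exact: measurable_circle|exact: cintegrable_expi].
have nz : 2 * pi != 0 :> R by rewrite gt_eqF.
rewrite cintegral_expi subr_eq0 -rmorphM mulrA (mulVf nz) mul1r.
by case: eqP.
Qed.

(** The hypothesis says that all Fourier coefficients of x conj(ep) f vanish, so this product is 0
    almost everywhere; [ep] and [f] are nonzero almost everywhere because |ep|^2 f = 1. *)
Lemma innov_complete (x : H) : (forall k, ip x (innov k) = 0) -> N2 x = 0.
Proof.
move=> hx; pose g t := fn x t * (fn ep t)^*%C * (weight f t)%:C%C.
have ig : cintegrable mu D g by exact: cintegrable_fip.
have h0 : {ae mu, forall t, D t -> g t = 0}.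
  apply: fourier_unique => // k; rewrite -(hx (- k)).
  apply: eq_cintegral => t _.
  by rewrite /= conjcM -expiN opprK !mulrA mulrAC -/(g t) /g; ring.
apply: N2_ae0; apply: (filterS2 (ae_filter_ringOfSetsType mu)) h0 ep_white.
move=> t + + Dt => /(_ Dt) h1 /(_ Dt) h2.
have : sqmod (g t) = 0 by rewrite h1 sqmod0.
rewrite /g !sqmodM sqmodJ sqmod_real /weight => h3.
have f0 : f t != 0 by apply: contraTneq isT => h; move: h2; rewrite h mulr0 => /eqP; rewrite eq_sym oner_eq0.
have e0 : sqmod (fn ep t) != 0.
  by apply: contraTneq isT => h; move: h2; rewrite h mul0r => /eqP; rewrite eq_sym oner_eq0.
have w0 : (f t / (2 * pi)) ^+ 2 != 0.
  by rewrite expf_neq0// mulf_neq0// invr_neq0// gt_eqF.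
move/eqP: h3; rewrite mulf_eq0 (negPf w0) orbF mulf_eq0 (negPf e0) orbF => /eqP ->.
by rewrite mul0r.
Qed.

Variable d : nat -> R[i].
Hypothesis E0_innov : cvgH (fun n => \sum_(k < n) d k *: innov (- k%:Z)) (E 0).

Lemma Eexp_innov (j : int) : cvgH (fun n => \sum_(k < n) d k *: innov (j - k%:Z)) (E j).
Proof.
move=> e /E0_innov[n0 h]; exists n0 => n hn.
have -> : \sum_(k < n) d k *: innov (j - k%:Z) - E j =
    shift j (\sum_(k < n) d k *: innov (- k%:Z) - E 0).
  rewrite shiftB shift_sum shift_Eexp add0r; congr (_ - _).
  by apply: eq_bigr => k _; rewrite /innov shift_shift addrC.
by rewrite N2_shift; exact: h.
Qed.

(** Causality of the representation: [E j] involves only noise of index at most j, so the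
    coefficient is 0 when j < k. *)
Lemma ip_Eexp_innov (j k : int) :
  ip (E j) (innov k) = if j - k is Posz m then d m else 0.
Proof.
apply/eqP; rewrite -subr_eq0; apply/eqP/sqmod_eq0/eqP; rewrite eq_le sqmod_ge0 andbT.
apply/ler_addgt0Pr => e e0; rewrite add0r.
have [n0 h] := @cvg_ip R H _ _ (innov k) (Eexp_innov j) _ e0.
(* Besides being close to [E j], the partial sum has to contain the term of index j - k. *)
pose n := maxn n0 `|j - k|%N.+1.
have := h n (leq_maxl _ _); rewrite -sqmodN opprB => /ltW.
suff -> : ip (\sum_(i < n) d i *: innov (j - i%:Z)) (innov k) =
   (if j - k is Posz m then d m else 0) by [].
rewrite ip_suml; under eq_bigr do rewrite ipZl innov_orthonormal.
have hn : (`|j - k| < n)%N by rewrite leq_max ltnSn orbT.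
case Ejk : (j - k) => [m|m].
  have mn : (m < n)%N by move: hn; rewrite Ejk.
  rewrite (bigD1 (Ordinal mn))//= big1 ?addr0.
    by rewrite (_ : (_ == k)) ?mulr1//; apply/eqP; lia.
  move=> i im; rewrite (_ : (_ == k) = false) ?mulr0//; apply/negP => /eqP ik.
  by move/negP: im; apply; apply/eqP/val_inj => /=; lia.
rewrite big1// => i _; rewrite (_ : (_ == k) = false) ?mulr0//.
by apply/negP => /eqP ik; lia.
Qed.

Lemma past_orth_innov (x : H) (k : nat) : pastE sf (-1) x -> ip x (innov k%:Z) = 0.
Proof.
move=> hx; apply: (@cspan_orth R H _ _ E x (innov k%:Z) _ hx) => j /= j1.
have := ip_Eexp_innov j k%:Z.
by case Ejk : (j - k%:Z) => [m|m]; [lia|exact].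
Qed.

(** * The functional A and its coefficients along the noise *)

Variable a : nat -> R[i].
Hypothesis a_summable : (\sum_(0 <= j <oo) (Normc.normc (a j))%:E < +oo)%E.

Definition partialA n (t : R) : R[i] := \sum_(j < n) a j * @expi R j%:Z t.

Lemma normc_series_cvg : cvgn (series (fun j => Normc.normc (a j))).
Proof. by apply: nnseries_is_cvg => // n; exact: normc_nneg. Qed.

Lemma Afun_cvg t : (complex.Re (partialA n t)) @[n --> \oo] --> complex.Re (Afun a t) /\
  (complex.Im (partialA n t)) @[n --> \oo] --> complex.Im (Afun a t).
Proof.
have cN := normc_series_cvg.
have h (u : nat -> R) : (forall n, `|u n| <= Normc.normc (a n)) -> cvgn (series u).
  move=> hu; apply: normed_cvg; apply: (series_le_cvg (v_ := fun j => Normc.normc (a j))) => //.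
  - by move=> n; exact: normr_ge0.
  - by move=> n; exact: normc_nneg.
split; rewrite /Afun /csum /=.
  rewrite (_ : (fun n => _) = series (fun k => complex.Re (a k * @expi R k%:Z t))); last first.
    by apply/funext => n; rewrite /partialA Re_sum seriesEord.
  by apply: h => n; rewrite -(normcM_expi _ n%:Z t); exact: (normc_ge _).1.
rewrite (_ : (fun n => _) = series (fun k => complex.Im (a k * @expi R k%:Z t))); last first.
  by apply/funext => n; rewrite /partialA Im_sum seriesEord.
by apply: h => n; rewrite -(normcM_expi _ n%:Z t); exact: (normc_ge _).2.
Qed.

Lemma cmeasurable_partialA n : cmeasurable D (partialA n).
Proof.
apply: cmeasurable_sum => j; apply: cmeasurableM; first exact: cmeasurable_cst.
exact: cmeasurable_expi.
Qed.

Lemma cmeasurable_Afun : cmeasurable D (Afun a).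
Proof.
split.
  apply: (@measurable_fun_cvg _ _ _ D (fun n t => complex.Re (partialA n t))).
    by move=> n; exact: (cmeasurable_partialA n).1.
  by move=> t _; exact: (Afun_cvg t).1.
apply: (@measurable_fun_cvg _ _ _ D (fun n t => complex.Im (partialA n t))).
  by move=> n; exact: (cmeasurable_partialA n).2.
by move=> t _; exact: (Afun_cvg t).2.
Qed.

Definition tailA n : R := limn (series (fun j => Normc.normc (a j))) -
  series (fun j => Normc.normc (a j)) n.

(** The real and the imaginary part are each bounded by the tail of the sum of the |a(j)|, whence
    the factor 2. The bound is uniform in t, which gives convergence in every L2(f). *)
Lemma sqmod_Afun_partial n t : sqmod (Afun a t - partialA n t) <= 2 * tailA n ^+ 2.
Proof.
have cN := normc_series_cvg.
have nd : nondecreasing_seq (series (fun j => Normc.normc (a j))).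
  by apply: nondecreasing_series => *; exact: normc_nneg.
have t0 : 0 <= tailA n by rewrite subr_ge0 nondecreasing_cvgn_le.
have bd (u : nat -> R) : (forall k, `|u k| <= Normc.normc (a k)) -> forall m, (n <= m)%N ->
    `|\sum_(j < m) u j - \sum_(j < n) u j| <= tailA n.
  move=> hu m nm; rewrite -!(big_mkord xpredT) (big_cat_nat _ nm)//= [X in `|X - _|]addrC addrK.
  apply: le_trans (ler_norm_sum _ _ _) _.
  apply: (@le_trans _ _ (\sum_(n <= j < m) Normc.normc (a j))); first exact: ler_sum.
  rewrite -sub_series_geq//; apply: lerB => //.
  exact: nondecreasing_cvgn_le.
have lim_bd (v : nat -> R) (c l : R) : v @ \oo --> l ->
    (forall m, (n <= m)%N -> `|v m - c| <= tailA n) -> `|l - c| <= tailA n.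
  move=> vl hv; have h1 : `|v m - c| @[m --> \oo] --> `|l - c|.
    by apply: cvg_norm; apply: cvgB => //; exact: cvg_cst.
  by apply: (cvgr_to_le h1); exists n.
have [c1 c2] := Afun_cvg t.
have h1 : `|complex.Re (Afun a t) - complex.Re (partialA n t)| <= tailA n.
  apply: lim_bd c1 _ => m nm; rewrite /partialA !Re_sum; apply: (bd (fun k => complex.Re (a k * @expi R k%:Z t))) => // k.
  by rewrite -(normcM_expi _ k%:Z t); exact: (normc_ge _).1.
have h2 : `|complex.Im (Afun a t) - complex.Im (partialA n t)| <= tailA n.
  apply: lim_bd c2 _ => m nm; rewrite /partialA !Im_sum; apply: (bd (fun k => complex.Im (a k * @expi R k%:Z t))) => // k.
  by rewrite -(normcM_expi _ k%:Z t); exact: (normc_ge _).2.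
rewrite sqmodE cReD cImD cReN cImN mulr_natl mulr2n.
by apply: lerD; rewrite -(real_normK (num_real (_ - _))) lerXn2r ?nnegrE.
Qed.

Lemma L2_Afun : L2 mu D (weight f) (Afun a).
Proof.
apply: (@L2_bounded _ _ sf _ (2 * tailA 0 ^+ 2)); first exact: cmeasurable_Afun.
by move=> t _; have := sqmod_Afun_partial 0 t; rewrite /partialA big_ord0 subr0.
Qed.

Definition AH : H := toL2 L2_Afun.

Lemma AH_cvg : cvgH (fun n => \sum_(j < n) a j *: E j%:Z) AH.
Proof.
move=> e e0; set I := fine (\int[mu]_(t in D) (weight f t)%:E).
have iw := integrable_weight sf.
have I0 : 0 <= I by apply: Rintegral_ge0 => t; exact: weight_ge0.
have key n : N2 (\sum_(j < n) a j *: E j%:Z - AH) <= 2 * tailA n ^+ 2 * I.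
  rewrite N2C N2_int -RintegralZl//; last exact: measurable_circle.
  have EA t : fn (AH - \sum_(j < n) a j *: E j%:Z) t = Afun a t - partialA n t.
    transitivity (Afun a t - (\sum_(j < n) (a j *: (E j%:Z : L2t (spectral_wspace sf)))) t) => //.
    by rewrite L2t_sumE.
  apply: le_Rintegral; first exact: measurable_circle.
  - exact: (integrable_sqw (L2fP (AH - \sum_(j < n) a j *: E j%:Z))).
  - by apply: integrableZE => //; exact: measurable_circle.
  - move=> t Dt; rewrite EA ler_wpM2r ?sqmod_Afun_partial//; exact: weight_ge0.
have : tailA n @[n --> \oo] --> (0 : R).
  rewrite -(subrr (limn (series (fun j => Normc.normc (a j))))).
  by apply: cvgB; [exact: cvg_cst|exact: normc_series_cvg].
(* Once the tail is below 1, its square is at most the tail itself; [I + 1] avoids dividing by a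
   zero mass. *)
pose r := Num.min 1 (e / (2 * (I + 1))).
have r0 : 0 < r by rewrite lt_min ltr01/= divr_gt0//; lra.
move=> /(@cvgrPdist_lt _ R^o)/(_ r r0)[n0 _ h]; exists n0 => n /h /=.
rewrite sub0r normrN => hr; apply: le_lt_trans (key n) _.
have hr2 : tailA n ^+ 2 < e / (2 * (I + 1)).
  rewrite -(real_normK (num_real (tailA n))).
  have : `|tailA n| < 1 by move: hr; rewrite lt_min => /andP[].
  have : `|tailA n| < e / (2 * (I + 1)) by move: hr; rewrite lt_min => /andP[].
  by move: (normr_ge0 (tailA n)); move: (`|tailA n|) (e / _) => x y; nra.
move: hr2; rewrite ltr_pdivlMr; last lra.
by have := sqr_ge0 (tailA n); move: (tailA n ^+ 2) => x; nra.
Qed.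

Lemma ip_AH_innov (k : nat) : ip AH (innov k%:Z) = csum (fun l => a (k + l)%N * d l).
Proof.
have cv (e : R) : 0 < e -> exists n0, forall n, (n0 <= n)%N ->
    sqmod (\sum_(l < n) a (k + l)%N * d l - ip AH (innov k%:Z)) < e.
  move=> e0; have [n0 h] := @cvg_ip R H _ _ (innov k%:Z) AH_cvg _ e0; exists n0 => n hn.
  (* With k + n terms, the indices below k contribute 0 and the remaining ones are exactly the first
     n terms of the series. *)
  have := h (k + n)%N (leq_trans hn (leq_addl _ _)).
  congr (sqmod (_ - _) < _); rewrite ip_suml big_split_ord/= big1 ?add0r; last first.
    move=> i _; rewrite ipZl ip_Eexp_innov.
    by case Eik : (i%:Z - k%:Z) => [m|m]; rewrite ?mulr0//; have := ltn_ord i; lia.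
  apply: eq_bigr => i _; rewrite ipZl ip_Eexp_innov.
  by rewrite (_ : (k + i)%N%:Z - k%:Z = i%:Z)//; lia.
rewrite /csum; symmetry; apply: complex_eq => /=; apply: cvg_lim => //;
  apply/(@cvgrPdist_lt _ R^o) => e e0; have [n0 h] := cv (e ^+ 2) (exprn_gt0 _ e0);
  exists n0 => // n /h /=; rewrite seriesEord sqmodE cReD cImD cReN cImN => hlt;
  rewrite distrC -(@ltr_pXn2r _ 2) ?nnegrE ?normr_ge0 ?(ltW e0)// real_normK ?num_real//;
  apply: le_lt_trans hlt; rewrite ?Re_sum ?Im_sum.
- by rewrite lerDl sqr_ge0.
- by rewrite lerDr sqr_ge0.
Qed.

Let innovN (k : nat) : H := innov k%:Z.

Let innovN_orthonormal i j : ip (innovN i) (innovN j) = (i == j)%:R.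
Proof. by rewrite innov_orthonormal eqz_nat. Qed.

(** Subtracting an element of the past does not change the coefficients along the noise of index k
    >= 0, and those of [AH] are the (A d)_k. *)
Lemma normAd2_le (x : H) : pastE sf (-1) x -> (normAd2 a d <= (N2 (AH - x))%:E)%E.
Proof.
move=> hx; rewrite /normAd2.
apply: lime_le; first by apply: is_cvg_nneseries => n _ _; rewrite lee_fin sqmod_ge0.
apply: nearW => n; rewrite sumEFin lee_fin big_mkord.
apply: le_trans (bessel innovN_orthonormal (AH - x) n).
by apply: ler_sum => k _; rewrite ipBl (past_orth_innov k hx) subr0 ip_AH_innov.
Qed.

(** Because [ep] lies in the past up to 0, the noise of negative index lies in the past up to -1 and
    is orthogonal to the residual. The residual is thus spanned by the noise of index k >= 0, and
    Bessel's inequality becomes Parseval's identity. *)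
Lemma normAd2_eq (x : H) : pastE sf 0 ep -> pastE sf (-1) x ->
  (forall y, pastE sf (-1) y -> ip (AH - x) y = 0) -> (N2 (AH - x))%:E = normAd2 a d.
Proof.
move=> ep0 hx ho; set z := AH - x.
have zneg (k : nat) : ip z (innov (- k.+1%:Z)) = 0.
  apply: ho; apply: (@pastE_le _ _ sf (0 - k.+1%:Z)); first by lia.
  exact: (@pastE_shift R f sf 0 (- k.+1%:Z) ep ep0).
have zpos (k : nat) : ip z (innovN k) = csum (fun l => a (k + l)%N * d l).
  by rewrite /z ipBl (past_orth_innov k hx) subr0 ip_AH_innov.
have cS := @cspan_closed R H nat setT innovN.
have [y Sy hy] := projection z cS.
have oy := projection_orth cS Sy hy.
have zy0 : N2 (z - y) = 0.
  (* For k >= 0 the projection residual is orthogonal to the noise; for k < 0 both [z] and [y]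
     are. *)
  apply: innov_complete => k; have [k0|k0] := leP 0 k.
    by rewrite -(gez0_abs k0); apply: oy; exact: cspan_gen.
  have -> : k = - (`|k|.-1).+1%:Z by lia.
  rewrite ipBl zneg sub0r; apply/eqP; rewrite oppr_eq0; apply/eqP.
  apply: (@cspan_orth R H _ setT innovN y _ _ Sy) => i _; rewrite /innovN innov_orthonormal.
  by rewrite (_ : (_ == _) = false)//; apply/negP => /eqP; lia.
have Sz : cspan setT innovN z by apply: (csubC cS) => e e0; exists y; rewrite ?zy0.
rewrite -(cvg_parseval innovN_orthonormal Sz) /normAd2.
by apply: eq_eseriesr => k _; rewrite zpos.
Qed.

End Innovations.

(** * The Wold decomposition and its factorization *)

Section Wold.
Context (R : realType).
Local Notation mu := (leb R).
Local Notation D := (@circle R).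
Variable f : R -> R.
Hypothesis sf : spectral_density f.
Local Notation H := (L2f_space sf).
Local Notation fn x := ((x : L2t (spectral_wspace sf)) : R -> R[i]).
Local Notation E := (Eexp sf).

Let pi2 : 0 < 2 * pi :> R.
Proof. by rewrite mulr_gt0// pi_gt0. Qed.

Lemma N2_past_poly (s : seq int) (c : int -> R[i]) :
  N2 (E 0 - \sum_(k <- s) c k *: E k) = (2 * pi)^-1 *
    \int[mu]_(t in D) (sqmod (1 - \sum_(k <- s) c k * @expi R k t) * f t).
Proof.
rewrite N2_int; set x : H := E 0 - _.
have xE t : fn x t = 1 - \sum_(k <- s) c k * @expi R k t.
  transitivity (@expi R 0 t - (\sum_(k <- s) (c k *: (E k : L2t (spectral_wspace sf)))) t) => //.
  by rewrite L2t_sumE expi0.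
have ix : mu.-integrable D (fun t => (sqmod (fn x t) * weight f t)%:E).
  exact: (integrable_sqw (L2fP x)).
have nz : 2 * pi != 0 :> R by rewrite gt_eqF.
have -> : \int[mu]_(t in D) (sqmod (1 - \sum_(k <- s) c k * @expi R k t) * f t) =
    2 * pi * \int[mu]_(t in D) (sqmod (fn x t) * weight f t).
  rewrite -RintegralZl//; last exact: measurable_circle.
  by apply: eq_Rintegral => t _; rewrite xE /weight mulrCA [2 * pi * _]mulrC divfK.
by rewrite mulKf.
Qed.

Hypothesis rf : regular f.

Lemma innovation_exists : exists2 ep : H, N2 ep = 1 &
  pastE sf 0 ep /\ forall y, pastE sf (-1) y -> ip ep y = 0.
Proof.
have cS := closed_pastE sf (-1).
have [y Sy hy] := projection (E 0) cS.
have oy := projection_orth cS Sy hy.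
set eta : H := E 0 - y.
have p0 : 0 < N2 eta.
  have [d d0 hd] := szego_bound sf rf.
  have dp : 0 < (2 * pi)^-1 * d by rewrite mulr_gt0// invr_gt0.
  (* The accuracy is a quarter of Szego's bound b = (2 pi)^-1 d: then b <= 2 N2 eta + 2 (b / 4)
     leaves N2 eta >= b / 4. *)
  have [s [c [hs hN]]] := Sy ((2 * pi)^-1 * d / 4) (divr_gt0 dp (ltr0n _ 4)).
  have := ler_wpM2l (ltW (_ : 0 < (2 * pi)^-1)) (hd s c hs).
  rewrite invr_gt0 => /(_ pi2); rewrite -N2_past_poly.
  have -> : E 0 - \sum_(k <- s) c k *: E k = eta + (y - \sum_(k <- s) c k *: E k).
    by rewrite /eta addrA subrK.
  have := ler_N2D eta (y - \sum_(k <- s) c k *: E k).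
  by move: hN dp; move: (N2 _) (N2 _) (N2 _) (_ * d) => u v w z; lra.
pose s := (Num.sqrt (N2 eta))^-1.
have s2 : s ^+ 2 * N2 eta = 1.
  by rewrite /s exprVn sqr_sqrtr ?(ltW p0)// mulVf// gt_eqF.
exists (s%:C%C *: eta); first by rewrite N2Z sqmod_real.
split.
  have c0 := closed_pastE sf 0; apply: (csubZ c0); apply: (csubB c0).
    exact: pastE_gen.
  by apply: pastE_le Sy.
by move=> z hz; rewrite ipZl oy// mulr0.
Qed.

(** The shifts of [ep] to negative indices lie in the past, so [ep] is orthogonal to them, and to
    the positive ones by unitarity. These inner products are the Fourier coefficients of |ep|^2 f /
    (2 pi), which therefore agree with those of the constant 1 / (2 pi). *)
Lemma white_of_innovation (ep : H) : N2 ep = 1 -> pastE sf 0 ep ->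
  (forall y, pastE sf (-1) y -> ip ep y = 0) ->
  {ae mu, forall t, D t -> sqmod (fn ep t) * f t = 1}.
Proof.
move=> n1 h0 ho.
have ipk (k : int) : ip (shift k ep) ep = (k == 0)%:R.
  have neg (m : nat) : ip (shift (- m.+1%:Z) ep) ep = 0.
    have hs : pastE sf (-1) (shift (- m.+1%:Z) ep).
      apply: (@pastE_le _ _ sf (0 - m.+1%:Z)); first by lia.
      exact: (@pastE_shift R f sf 0 (- m.+1%:Z) ep h0).
    by rewrite ipC (ho _ hs) conjc0.
  case: (intP k) => [|m|m].
  - by rewrite shift0 ipxx n1.
  - have := ip_shift (- m.+1%:Z) (shift m.+1%:Z ep) ep.
    rewrite shift_shift subrr shift0 => <-.
    by rewrite ipC neg conjc0.
  - exact: neg.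
pose w t := (sqmod (fn ep t) * weight f t)%:C%C - ((2 * pi)^-1 : R)%:C%C.
have iw : cintegrable mu D w.
  apply: cintegrableB; first exact: measurable_circle.
    by split => /=; [exact: (integrable_sqw (L2fP ep))|exact: integrable0].
  split; last exact: integrable0.
  apply: (@integrable_bounded_circle _ (cst (2 * pi)^-1) `|(2 * pi)^-1|) => //.
have i1 (k : int) : cintegrable mu D (fun t => ((2 * pi)^-1 : R)%:C%C * @expi R k t).
  by apply: cintegrableZ; [exact: measurable_circle|exact: cintegrable_expi].
have hw k : cintegral mu D (fun t => w t * @expi R k t) = 0.
  transitivity (ip (shift k ep) ep - cintegral mu D (fun t => ((2 * pi)^-1 : R)%:C%C * @expi R k t)).
    rewrite -cintegralB; [|exact: measurable_circle|exact: cintegrable_fip|exact: i1].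
    apply: eq_cintegral => t _; rewrite /w mulrBl; congr (_ - _).
    have -> : (sqmod (fn ep t) * weight f t)%:C%C =
        fn ep t * (fn ep t)^*%C * (weight f t)%:C%C by rewrite mulcJ -rmorphM.
    by rewrite shiftE; ring.
  rewrite ipk cintegralZ; [|exact: measurable_circle|exact: cintegrable_expi].
  have nz : 2 * pi != 0 :> R by rewrite gt_eqF.
  rewrite cintegral_expi -rmorphM mulrA (mulVf nz) mul1r.
  by case: eqP => _; rewrite subrr.
apply: (@filterS _ _ (ae_filter_ringOfSetsType mu) _ _ _ (fourier_unique iw hw)) => t + Dt.
move=> /(_ Dt) /(congr1 (@complex.Re R)); rewrite /w cReD cReN /= /weight => h.
have -> : sqmod (fn ep t) * f t = (sqmod (fn ep t) * (f t / (2 * pi))) * (2 * pi).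
  by rewrite -mulrA divfK// gt_eqF.
have -> : sqmod (fn ep t) * (f t / (2 * pi)) = (2 * pi)^-1 by move: h; lra.
by rewrite mulVf// gt_eqF.
Qed.

Lemma wold : exists (ep : H) (d : nat -> R[i]),
  [/\ {ae mu, forall t, D t -> sqmod (fn ep t) * f t = 1}, pastE sf 0 ep,
    square_summable d &
    cvgH (fun n => \sum_(k < n) d k *: innov ep (- k%:Z)) (E 0)].
Proof.
have [ep n1 [h0 ho]] := innovation_exists.
have hw := white_of_innovation n1 h0 ho.
pose e' (k : nat) : H := innov ep (- k%:Z).
have oe i j : ip (e' i) (e' j) = (i == j)%:R.
  by rewrite innov_orthonormal// eqr_opp eqz_nat.
have cS := @cspan_closed R H nat setT e'.
have [y Sy hy] := projection (E 0) cS.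
have oy := projection_orth cS Sy hy.
have zy0 : N2 (E 0 - y) = 0.
  apply: (innov_complete hw) => k; have [k0|k0] := leP k 0.
    have -> : k = - `|k|%N%:Z by lia.
    by apply: oy; exact: (@cspan_gen _ _ _ _ e').
  (* Future noise is invisible to the present: shifting by -k turns this product into that of e^{-ik
     lambda}, an element of the past, with [ep]. *)
  have E0k : ip (E 0) (innov ep k) = 0.
    have := ip_shift (- k) (E 0) (innov ep k).
    rewrite shift_Eexp shift_shift subrr shift0 => <-.
    have hs : pastE sf (-1) (E (0 - k)) by apply: pastE_gen; lia.
    by rewrite ipC (ho _ hs) conjc0.
  rewrite ipBl E0k sub0r; apply/eqP; rewrite oppr_eq0; apply/eqP.
  apply: (@cspan_orth R H _ setT e' y _ _ Sy) => i _; rewrite /e' innov_orthonormal//.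
  by rewrite (_ : (_ == _) = false)//; apply/negP => /eqP; lia.
have SE : cspan setT e' (E 0) by apply: (csubC cS) => e e0; exists y; rewrite ?zy0.
exists ep, (fun k => ip (E 0) (e' k)); split => //.
  by rewrite /square_summable (cvg_parseval oe SE) ltry.
exact: (cvg_fourier_sum oe SE).
Qed.

Section Factor.
Variable ep : H.
Hypothesis ep_white : {ae mu, forall t, D t -> sqmod (fn ep t) * f t = 1}.
Variable phi : R -> R[i].
Hypothesis mphi : cmeasurable D phi.
Hypothesis ep_phi : {ae mu, forall t, D t -> fn ep t * phi t = 1}.
Variable d : nat -> R[i].

Let rem n : H := E 0 - \sum_(k < n) d k *: innov ep (- k%:Z).

Lemma remE n t : fn (rem n) t = 1 - fn ep t * (\sum_(k < n) d k * @expi R (- k%:Z) t).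
Proof.
transitivity (@expi R 0 t -
  (\sum_(k < n) (d k *: (innov ep (- k%:Z) : L2t (spectral_wspace sf)))) t) => //.
rewrite L2t_sumE expi0 mulr_sumr; congr (_ - _); apply: eq_bigr => k _.
transitivity (d k * (fn ep t * @expi R (- k%:Z) t)) => //.
by rewrite mulrCA.
Qed.

(** Since ep phi = 1, the remainder is 1 - ep p = ep (phi - p), and |ep|^2 f = 1 removes the factor
    [ep]. Expanding 1 in noise is thus the same as expanding phi in a Fourier series. *)
Lemma sqnorm_factor n :
  sqnorm mu D (cst 1) (fun t => phi t - \sum_(k < n) d k * @expi R (- k%:Z) t) =
  (2 * pi * N2 (rem n))%:E.
Proof.
have mS : cmeasurable D (fun t => phi t - \sum_(k < n) d k * @expi R (- k%:Z) t).
  apply: cmeasurableB => //; apply: cmeasurable_sum => k.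
  by apply: cmeasurableM; [exact: cmeasurable_cst|exact: cmeasurable_expi].
have ir := integrable_sqw (L2fP (rem n)).
rewrite EFinM -(sqn_N2 (rem n)) /sqnorm -integralZl; [|exact: measurable_circle|exact: ir].
apply: ge0_ae_eq_integral.
- exact: measurable_circle.
- apply/measurable_EFinP; apply: measurable_funM; last exact: measurable_cst.
  exact: measurable_sqmod.
- apply/measurable_EFinP; apply: measurable_funM; first exact: measurable_cst.
  by have := integrable_meas ir.
- by move=> t Dt; rewrite lee_fin mulr1 sqmod_ge0.
- move=> t Dt; rewrite lee_fin mulr_ge0 ?(ltW pi2)//.
  by rewrite (sqw_ge0 (W := spectral_wspace sf) (rem n : L2t _)).
apply: (filterS2 (ae_filter_ringOfSetsType mu)) ep_white ep_phi => t + + Dt.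
move=> /(_ Dt) h1 /(_ Dt) h2; rewrite -EFinM mulr1; congr EFin.
rewrite remE -{1}h2 -mulrBr sqmodM /= /weight.
set x := sqmod (phi t - _).
have -> : 2 * pi * (sqmod (fn ep t) * x * (f t / (2 * pi))) = (sqmod (fn ep t) * f t) * x.
  by rewrite mulrCA [2 * pi * _]mulrC divfK ?gt_eqF// mulrAC.
by rewrite h1 mul1r.
Qed.

Lemma factor_cvgP : cvgH (fun n => \sum_(k < n) d k *: innov ep (- k%:Z)) (E 0) <->
  sqnorm mu D (cst 1) (fun t => phi t - \sum_(k < n) d k * @expi R (- k%:Z) t)
    @[n --> \oo] --> 0%E.
Proof.
rewrite (_ : (fun n => _) = EFin \o (fun n => 2 * pi * N2 (rem n))); last first.
  by apply/funext => n; exact: sqnorm_factor.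
split=> h.
  apply: cvg_EFin; first exact: nearW.
  apply/(@cvgrPdist_lt _ R^o) => e e0.
  have [n0 h0] := h (e / (2 * pi)) (divr_gt0 e0 pi2).
  exists n0 => // n /h0 /=; rewrite N2C ltr_pdivlMr// mulrC => hN.
  by rewrite sub0r normrN ger0_norm// mulr_ge0 ?N2_ge0// ltW.
move=> e e0; have /fine_cvgP[_ /(@cvgrPdist_lt _ R^o)] := h.
move=> /(_ (2 * pi * e) (mulr_gt0 pi2 e0))[n0 _ h0]; exists n0 => n /h0 /=.
rewrite sub0r normrN ger0_norm; last by rewrite mulr_ge0 ?N2_ge0// ltW.
by rewrite ltr_pM2l// N2C.
Qed.
End Factor.

Lemma wold_factorization (ep : H) (d : nat -> R[i]) :
  {ae mu, forall t, D t -> sqmod (fn ep t) * f t = 1} -> square_summable d ->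
  cvgH (fun n => \sum_(k < n) d k *: innov ep (- k%:Z)) (E 0) -> factorization f d.
Proof.
(* From |ep|^2 f = 1, this [phi] is 1 / ep almost everywhere, and |phi|^2 = |ep|^2 f^2 = f. *)
move=> hw sd hc; split=> //; pose phi t := (fn ep t)^*%C * (f t)%:C%C.
have mf : measurable_fun D f by exact: integrable_meas sf.2.
have mphi : cmeasurable D phi.
  apply: cmeasurableM; last exact: cmeasurable_real.
  by apply: cmeasurableJ; exact: (L2fP ep).1.
have hphi : {ae mu, forall t, D t -> fn ep t * phi t = 1}.
  apply: (@filterS _ _ (ae_filter_ringOfSetsType mu) _ _ _ hw) => t + Dt => /(_ Dt) h.
  by rewrite /phi mulrA mulcJ -rmorphM h.
have sphi : {ae mu, forall t, D t -> f t = sqmod (phi t)}.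
  apply: (@filterS _ _ (ae_filter_ringOfSetsType mu) _ _ _ hw) => t + Dt => /(_ Dt) h.
  by rewrite /phi sqmodM sqmodJ sqmod_real expr2 mulrA h mul1r.
exists phi; split=> //; split; last exact/(factor_cvgP hw mphi hphi).
split=> //; rewrite /sqnorm.
have -> : (\int[mu]_(t in D) (sqmod (phi t) * cst 1 t)%:E = \int[mu]_(t in D) (f t)%:E)%E.
  apply: ge0_ae_eq_integral.
  - exact: measurable_circle.
  - apply/measurable_EFinP; apply: measurable_funM; last exact: measurable_cst.
    exact: measurable_sqmod.
  - exact/measurable_EFinP.
  - by move=> t Dt; rewrite lee_fin mulr1 sqmod_ge0.
  - by move=> t Dt; rewrite lee_fin; apply: sf.1.
  - apply: (@filterS _ _ (ae_filter_ringOfSetsType mu) _ _ _ sphi) => t + Dt => /(_ Dt) h.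
    by rewrite mulr1 h.
by apply: integrable_lty; [exact: measurable_circle|exact: sf.2].
Qed.

(** The noise obtained is white and causal, but no membership in the past is claimed: an inner
    factor of phi would prevent it. *)
Lemma innov_of_factorization (d : nat -> R[i]) : factorization f d ->
  exists ep : H, {ae mu, forall t, D t -> sqmod (fn ep t) * f t = 1} /\
    cvgH (fun n => \sum_(k < n) d k *: innov ep (- k%:Z)) (E 0).
Proof.
move=> [_ [phi [[[mphi _] hphi] aef]]].
have mf : measurable_fun D f by exact: integrable_meas sf.2.
have f0 := spectral_density_gt0 sf rf.
(* u = 1 / phi almost everywhere; expR (- ln (f t)) is the inverse of f t > 0 *)
pose u t := (phi t)^*%C * (expR (- ln (f t)))%:C%C.
have mu_u : cmeasurable D u.
  apply: cmeasurableM; first exact: cmeasurableJ.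
  apply: cmeasurable_real; apply: measurableT_comp; first exact: measurable_expR.
  by apply: measurableT_comp => //; apply: measurableT_comp => //; exact: measurable_ln.
have uw : {ae mu, forall t, D t -> sqmod (u t) * f t = 1}.
  apply: (filterS2 (ae_filter_ringOfSetsType mu)) f0 aef => t + + Dt => /(_ Dt) h1 /(_ Dt) h2.
  rewrite /u sqmodM sqmodJ -h2 sqmod_real expRN lnK ?posrE//.
  by field; rewrite gt_eqF.
have Lu : L2 mu D (weight f) u.
  split=> //; rewrite /sqnorm.
  have -> : (\int[mu]_(t in D) (sqmod (u t) * weight f t)%:E =
      \int[mu]_(t in D) (cst ((2 * pi)^-1)%:E t))%E.
    apply: ge0_ae_eq_integral.
    - exact: measurable_circle.
    - by apply/measurable_EFinP; exact: (@measurable_sqw R (spectral_wspace sf)).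
    - exact: measurable_cst.
    - by move=> t Dt; rewrite lee_fin (sqw_ge0 (W := spectral_wspace sf) u).
    - by move=> t Dt; rewrite lee_fin invr_ge0 ltW.
    - apply: (@filterS _ _ (ae_filter_ringOfSetsType mu) _ _ _ uw) => t + Dt => /(_ Dt) h.
      by rewrite /weight mulrA h mul1r.
  rewrite integral_cst; last exact: measurable_circle.
  by rewrite leb_circle -EFinM ltry.
pose ep : H := @mkL2 R (spectral_wspace sf) u Lu.
have hep : {ae mu, forall t, D t -> fn ep t * phi t = 1}.
  apply: (filterS2 (ae_filter_ringOfSetsType mu)) f0 aef => t + + Dt => /(_ Dt) h1 /(_ Dt) h2.
  rewrite /= /u mulrAC [_^*%C * _]mulrC mulcJ -h2 -rmorphM expRN lnK ?posrE//.
  by rewrite mulfV// gt_eqF.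
exists ep; split; first exact: uw.
by apply/(@factor_cvgP ep uw phi mphi hep d).
Qed.

End Wold.

(** * Extrapolation *)

Section Extrapolation.
Context (R : realType).
Variable f : R -> R.
Hypothesis sf : spectral_density f.
Variable a : nat -> R[i].
Hypothesis a_summable : (\sum_(0 <= j <oo) (Normc.normc (a j))%:E < +oo)%E.
Local Notation H := (L2f_space sf).
Local Notation fn x := ((x : L2t (spectral_wspace sf)) : R -> R[i]).
Local Notation A := (AH sf a_summable).

Lemma DeltaE (x : H) : Delta a (fn x) f = (N2 (A - x))%:E.
Proof. by rewrite -sqn_N2. Qed.

Lemma minimizer_exists : exists x : H, [/\ pastE sf (-1) x, is_minimizer a f (fn x) &
  forall y, pastE sf (-1) y -> ip (A - x) y = 0].
Proof.
have cS := closed_pastE sf (-1).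
have [x Sx hx] := projection A cS.
have ox := projection_orth cS Sx hx.
exists x; split=> //; split.
  exact: (closed_spanP (W := spectral_wspace sf) [set n : int | n <= -1] (Eexp sf) x).2.
move=> h' Lh'; pose y : H := @mkL2 R (spectral_wspace sf) h' Lh'.1.
have Sy : pastE sf (-1) y.
  exact: (closed_spanP (W := spectral_wspace sf) [set n : int | n <= -1] (Eexp sf) y).1.
by rewrite DeltaE (DeltaE y) lee_fin; exact: hx.
Qed.

Hypothesis rf : regular f.

Lemma Delta_ge_normAd2 (d : nat -> R[i]) h : factorization f d -> L2minus f h ->
  (normAd2 a d <= Delta a h f)%E.
Proof.
move=> fd Lh; have [ep [hw hc]] := innov_of_factorization sf rf fd.
pose y : H := @mkL2 R (spectral_wspace sf) h Lh.1.
have Sy : pastE sf (-1) y.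
  exact: (closed_spanP (W := spectral_wspace sf) [set n : int | n <= -1] (Eexp sf) y).1.
by rewrite (DeltaE y); exact: (normAd2_le hw hc).
Qed.

Lemma optimal_error : exists h d,
  [/\ is_minimizer a f h, factorization f d & Delta a h f = normAd2 a d].
Proof.
have [ep [d [hw h0 sd hc]]] := wold sf rf.
have [x [Sx mx ox]] := minimizer_exists.
exists (fn x), d; split=> //; first exact: wold_factorization hw sd hc.
by rewrite DeltaE; exact: (normAd2_eq hw hc).
Qed.
End Extrapolation.

(** * Stationary sequences on a probability space *)

Section SequenceSpace.
Context (R : realType) (disp : measure_display) (T : measurableType disp).
Variable P : probability T R.

Lemma cst1_ge0 (t : T) : [set: T] t -> 0 <= (cst 1 : T -> R) t.
Proof. by []. Qed.

Definition prob_wspace : wspace R :=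
  @WSpace R disp T P [set: T] (cst 1) measurableT (measurable_cst _) cst1_ge0.

Definition vecs (xi : int -> T -> R[i]) (hxi : forall j, L2P P (xi j)) (j : int) :
  L2_hilbert prob_wspace := @mkL2 R prob_wspace (xi j) (hxi j).

Lemma ip_vecs xi eta (hxi : forall j, L2P P (xi j)) (heta : forall j, L2P P (eta j)) i j :
  ip (vecs hxi i) (vecs heta j) = cexpect P (fun t => xi i t * (eta j t)^*%C).
Proof.
apply: eq_cintegral => t _; rewrite /= (_ : (1 : R)%:C%C = 1) ?mulr1//.
Qed.

Lemma past_cspan xi (hxi : forall j, L2P P (xi j)) n (x : L2_hilbert prob_wspace) :
  past P xi n ((x : L2t prob_wspace) : T -> R[i]) <-> cspan [set k : int | k <= n] (vecs hxi) x.
Proof. exact: (closed_spanP (W := prob_wspace) [set k : int | k <= n] (vecs hxi) x). Qed.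

Lemma past_eqP xi eta (hxi : forall j, L2P P (xi j)) (heta : forall j, L2P P (eta j)) n :
  past P xi n = past P eta n <->
  cspan [set k : int | k <= n] (vecs hxi) = cspan [set k : int | k <= n] (vecs heta).
Proof.
split=> h; apply/seteqP; split.
- by move=> x /(past_cspan hxi); rewrite h => /(past_cspan heta).
- by move=> x /(past_cspan heta); rewrite -h => /(past_cspan hxi).
- move=> g hg; pose x : L2_hilbert prob_wspace := @mkL2 R prob_wspace g hg.1.
  have := (past_cspan hxi n x).1 hg; rewrite h; exact: (past_cspan heta n x).2.
- move=> g hg; pose x : L2_hilbert prob_wspace := @mkL2 R prob_wspace g hg.1.
  have := (past_cspan heta n x).1 hg; rewrite -h; exact: (past_cspan hxi n x).2.
Qed.
End SequenceSpace.

(** The Gram matrix depends on the density alone, so any two sequences with the same density are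
    isometric. *)
Lemma stationary_gram (R : realType) (f : R -> R) (disp : measure_display)
    (T : measurableType disp) (P : probability T R) (xi : int -> T -> R[i])
    (hxi : forall j, L2P P (xi j)) : stationary_with P f xi ->
  forall i j, ip (vecs hxi i) (vecs hxi j) = ((2 * pi)^-1)%:C%C *
    cintegral (@leb R) (@circle R) (fun t => expi (i - j) t * (f t)%:C%C).
Proof.
by move=> [_ _ h] i j; rewrite ip_vecs -(h j (i - j)) addrC subrK.
Qed.

Lemma canonical_representation_transfer (R : realType) (f : R -> R) (d : nat -> R[i]) :
  canonical_factorization f d ->
  forall (disp : measure_display) (T : measurableType disp)
         (P : probability T R) (xi : int -> T -> R[i]),
    stationary_with P f xi ->
    exists eps : int -> T -> R[i], canonical_representation P xi eps d.
Proof.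
move=> [_ [disp' [T' [P' [xi' [eps' [st' [[wL wo] ws wp]]]]]]]] disp T P xi st.
have [L' _ _] := st'; have [L _ _] := st.
have gram i j : ip (vecs L' i) (vecs L' j) = ip (vecs L i) (vecs L j).
  by rewrite (stationary_gram _ st') (stationary_gram _ st).
have eo i j : ip (vecs wL i) (vecs wL j) = (i == j)%:R by rewrite ip_vecs.
have xe j : cvgH (fun n => \sum_(k < n) d k *: vecs wL (j - k%:Z)) (vecs L' j).
  exact: ((L2_sumP (W := prob_wspace P') (fun k => d k *: vecs wL (j - k%:Z)) (vecs L' j)).1 (ws j)).
have ex n : cspan [set k : int | k <= n] (vecs L') (vecs wL n).
  rewrite ((past_eqP L' wL n).1 (wp n)).
  exact: (@cspan_gen _ _ _ [set k : int | k <= n] (vecs wL) n (lexx n)).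
have [e [h1 h2 h3]] := transfer_representation gram eo xe ex.
pose eps n : T -> R[i] := (e n : L2t (prob_wspace P)).
have Le j : L2P P (eps j) by exact: (L2fP (e j)).
have eE : e = vecs Le by apply/funext => n; apply: val_inj.
exists eps; split.
- by split=> // i j; rewrite -(h1 i j) eE ip_vecs.
- move=> j.
  exact: ((L2_sumP (W := prob_wspace P) (fun k => d k *: e (j - k%:Z)) (vecs L j)).2 (h2 j)).
- by move=> n; apply/(past_eqP L Le); rewrite (h3 n) {1}eE.
Qed.

Theorem theorem11 (R : realType) (a : nat -> R[i]) (D : set (R -> R))
    (f0 : R -> R) (d0 : nat -> R[i])
    (a_summable : (\sum_(0 <= j <oo) (Normc.normc (a j))%:E < +oo)%E)
    (a_weighted :
      (\sum_(0 <= j <oo) ((j.+1)%:R * Normc.normc (a j) ^+ 2)%:E < +oo)%E)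
    (D_densities : forall f, D f -> spectral_density f /\ regular f)
    (D_f0 : D f0)
    (f0_canonical : canonical_factorization f0 d0)
    (d0_solution : solves_max_problem a D d0) :
  least_favourable a D f0 /\
  forall (disp : measure_display) (T : measurableType disp)
         (P : probability T R) (xi : int -> T -> R[i]),
    stationary_with P f0 xi ->
    exists eps : int -> T -> R[i], canonical_representation P xi eps d0.
Proof.
split; last exact: canonical_representation_transfer.
have [sf0 rf0] := D_densities _ D_f0.
(* The coefficients that come with this minimizer may differ from [d0]; the comparison with [d0]
   goes through the lower bound valid for every factorization of [f0]. *)
have [h0 [_ [m0 _ _]]] := optimal_error sf0 a_summable rf0.
split=> //; exists h0; split=> // f Df.
have [sf rf] := D_densities _ Df.
have [h [d [mh fd hd]]] := optimal_error sf a_summable rf.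
exists h; split=> //; rewrite hd; apply: (@le_trans _ _ (normAd2 a d0)).
  by apply: d0_solution.2; exists f.
exact: (Delta_ge_normAd2 sf0 a_summable rf0 f0_canonical.1 m0.1).
Qed.
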